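(* Let $\varphi$ be a Boolean circuit satisfiability instance, let $N\ge\max\{2,|\varphi|\}$ be a padding parameter large enough to hold the Boolean quadratic encoding of $\varphi$ (that is, at least the number of variables of that encoding), and put $R=\lfloor\log N\rfloor$. There is a deterministic algorithm which, given $\varphi$, $N$ and any prime $p>\max\{2^N,2NR\}$, runs in time $\mathrm{poly}(N,\log p)$ and outputs an ordered basis $M_1,\ldots,M_k$ of a linear space $\mathcal S\subseteq\mathbb F_p^{m\times m}$, where $$m=(N+1)(2NR+1)\binom{2R}{R}=O(N^4\log N),$$ such that: 1. If $\varphi$ is satisfiable, every satisfying witness efficiently (in time $\mathrm{poly}(N,\log p)$) yields $a\in\mathbb F_p^k$ and $u,v\in\mathbb F_p^m$ satisfying $$\sum_{j=1}^k a_jM_j=uv^T\ne 0,\qquad v\in\{0,1\}^m,\qquad \mathrm{wt}(v)\le N+1.$$ 2. If $\varphi$ is unsatisfiable, every nonzero matrix in $\mathcal S$ has rank at least $R+1$. The matrix order $m$ depends only on $N$ and can be computed in polynomial time before choosing $p$.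
   Context: Logarithms have base two. Ranks and spans are over $\mathbb F_p=\mathbb Z/p\mathbb Z$. A basis of a matrix space is linearly independent. A Boolean vector in $\mathbb F_p^m$ is the image of a vector in $\{0,1\}^m$; $\mathrm{wt}(v)$ is the number of nonzero coordinates of $v$. Boolean quadratic encoding of a circuit $\varphi$ with AND and NOT gates: there is one variable $b_i$ taking values in $\{0,1\}$ for each input bit and each gate output. An AND gate with inputs $b_i,b_j$ and output $b_k$ gives the equation $b_k-b_ib_j=0$; a NOT gate with input $b_i$ and output $b_k$ gives $b_k+b_i-1=0$; acceptance gives $b_{\rm out}-1=0$. There are $O(|\varphi|)$ variables and equations, and the encoding is padded with unused Boolean variables to have exactly $N$ variables. Satisfying inputs of the circuit correspond to Boolean solutions of the equations (up to the values of unused variables). *)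

(* Defs.v *)
From mathcomp Require Import all_boot all_order all_algebra.

Set Implicit Arguments.
Unset Strict Implicit.
Unset Printing Implicit Defensive.

Import GRing.Theory.
Local Open Scope nat_scope.

(* Wires are numbered: first the input bits, then one wire per gate, in the
   order of the gate list.  A gate may only read wires preceding its own. *)
Inductive gate := AND (i j : nat) | NOT (i : nat).

Definition gate_wf (w : nat) (g : gate) : bool :=
  match g with
  | AND i j => (i < w) && (j < w)
  | NOT i => i < w
  end.

Fixpoint gates_wf (w : nat) (gs : seq gate) : bool :=
  if gs is g :: gs' then gate_wf w g && gates_wf w.+1 gs' else true.

Record circuit := Circuit {
  ninputs : nat;
  gates : seq gate;
  out : nat;
  gates_ok : gates_wf ninputs gates;
  out_ok : out < ninputs + size gates
}.

Definition circuit_size (phi : circuit) : nat :=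
  ninputs phi + size (gates phi).

Definition gate_value (w : seq bool) (g : gate) : bool :=
  match g with
  | AND i j => nth false w i && nth false w j
  | NOT i => ~~ nth false w i
  end.

Definition wires (x : seq bool) (gs : seq gate) : seq bool :=
  foldl (fun w g => rcons w (gate_value w g)) x gs.

Definition satisfies (phi : circuit) (x : (ninputs phi).-tuple bool) : bool :=
  nth false (wires x (gates phi)) (out phi).

Definition satisfiable (phi : circuit) : Prop :=
  exists x : (ninputs phi).-tuple bool, satisfies x.

(* A quadratic polynomial is a list of terms (coefficient, monomial), a
   monomial being the list of the indices of its variables; the equation it
   stands for is [polynomial = 0]. *)
Definition quadratic := seq (int * seq nat).

Definition gate_equation (k : nat) (g : gate) : quadratic :=
  match g with
  | AND i j => [:: (1%R, [:: k]); ((-1)%R, [:: i; j])]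
  | NOT i => [:: (1%R, [:: k]); (1%R, [:: i]); ((-1)%R, [::])]
  end.

Record encoding := Encoding { num_vars : nat; equations : seq quadratic }.

(* Variable b_k, k < num_vars, is the value of wire k. *)
Definition boolean_quadratic_encoding (phi : circuit) : encoding :=
  {| num_vars := ninputs phi + size (gates phi);
     equations :=
       rcons [seq gate_equation kg.1 kg.2
             | kg <- zip (iota (ninputs phi) (size (gates phi))) (gates phi)]
             [:: (1%R, [:: out phi]); ((-1)%R, [::])] |}.

(* Algorithms are structured RAM programs under the logarithmic cost criterion.
   The memory consists of banks of cells holding natural numbers: [s a i] is
   cell [i] of bank [a].  Bank numbers are constants of the program, so a
   program uses finitely many banks; addresses are computed.  The model is
   polynomially equivalent to Turing machines. *)
Definition state := nat -> nat -> nat.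

Definition update (s : state) (a i v : nat) : state :=
  fun b j => if (b == a) && (j == i) then v else s b j.

Inductive binop := Add | Sub | Mul | Div | Mod.

(* Subtraction is truncated; n %/ 0 = 0 and n %% 0 = n. *)
Definition eval_op (o : binop) : nat -> nat -> nat :=
  match o with
  | Add => addn | Sub => subn | Mul => muln | Div => divn | Mod => modn
  end.

Inductive expr :=
  | Const (n : nat)
  | Get (a : nat) (e : expr)
  | Op (o : binop) (e1 e2 : expr).

Inductive prog :=
  | Skip
  | Assign (a : nat) (i e : expr)
  | Seq (c1 c2 : prog)
  | If (e : expr) (c1 c2 : prog)
  | While (e : expr) (c : prog).

Definition bitlen (n : nat) : nat := (trunc_log 2 n).+1.

Fixpoint eval (e : expr) (s : state) : nat :=
  match e with
  | Const n => n
  | Get a e1 => s a (eval e1 s)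
  | Op o e1 e2 => eval_op o (eval e1 s) (eval e2 s)
  end.

(* An operation is charged the product of the lengths of its operands, as in
   schoolbook multiplication and division. *)
Fixpoint cost (e : expr) (s : state) : nat :=
  match e with
  | Const n => bitlen n
  | Get a e1 => cost e1 s + bitlen (eval e1 s) + bitlen (s a (eval e1 s))
  | Op o e1 e2 =>
      cost e1 s + cost e2 s + bitlen (eval e1 s) * bitlen (eval e2 s)
  end.

(* [exec c s s' t]: started in [s], program [c] halts in [s'] after time [t];
   a test succeeds when its value is nonzero. *)
Inductive exec : prog -> state -> state -> nat -> Prop :=
  | ExecSkip s : exec Skip s s 1
  | ExecAssign a i e s :
      exec (Assign a i e) s (update s a (eval i s) (eval e s))
        (cost i s + cost e s + bitlen (eval i s) + bitlen (eval e s))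
  | ExecSeq c1 c2 s s1 s2 t1 t2 :
      exec c1 s s1 t1 -> exec c2 s1 s2 t2 ->
      exec (Seq c1 c2) s s2 (t1 + t2)
  | ExecIfTrue e c1 c2 s s' t :
      eval e s != 0 -> exec c1 s s' t ->
      exec (If e c1 c2) s s' (cost e s + t)
  | ExecIfFalse e c1 c2 s s' t :
      eval e s = 0 -> exec c2 s s' t ->
      exec (If e c1 c2) s s' (cost e s + t)
  | ExecWhileTrue e c s s1 s2 t1 t2 :
      eval e s != 0 -> exec c s s1 t1 -> exec (While e c) s1 s2 t2 ->
      exec (While e c) s s2 (cost e s + t1 + t2)
  | ExecWhileFalse e c s :
      eval e s = 0 -> exec (While e c) s s (cost e s).

Lemma exec_deterministic c s s1 s2 t1 t2 :
  exec c s s1 t1 -> exec c s s2 t2 -> s1 = s2 /\ t1 = t2.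
Proof.
move=> E; elim: E s2 t2 => {c s s1 t1}.
- by move=> s s2 t2 E; inversion E.
- by move=> a i e s s2 t2 E; inversion E.
- move=> c1 c2 s s1 s' t1 t1' _ IH1 _ IH2 s2 t2 E.
  inversion E as [| |? ? ? ? ? ? ? F1 F2| | | |]; subst.
  by case: (IH1 _ _ F1) => ??; subst; case: (IH2 _ _ F2) => ??; subst.
- move=> e c1 c2 s s' t nz _ IH s2 t2 E.
  inversion E as [| | |? ? ? ? ? ? nz' F|? ? ? ? ? ? z' F| |]; subst.
    by case: (IH _ _ F) => ??; subst.
  by rewrite z' in nz.
- move=> e c1 c2 s s' t z _ IH s2 t2 E.
  inversion E as [| | |? ? ? ? ? ? nz' F|? ? ? ? ? ? z' F| |]; subst.
    by rewrite z in nz'.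
  by case: (IH _ _ F) => ??; subst.
- move=> e c s s1 s' t1 t1' nz _ IH1 _ IH2 s2 t2 E.
  inversion E as [| | | | |? ? ? ? ? ? ? nz' F1 F2|? ? ? z']; subst.
    by case: (IH1 _ _ F1) => ??; subst; case: (IH2 _ _ F2) => ??; subst.
  by rewrite z' in nz.
- move=> e c s z s2 t2 E.
  inversion E as [| | | | |? ? ? ? ? ? ? nz' F1 F2|? ? ? z']; subst => //.
  by rewrite z in nz'.
Qed.

(* Bank 0 holds the length of the input followed by the input; all other cells
   are 0.  Bank 1 holds the output in the same format. *)
Definition load (l : seq nat) : state :=
  fun a i => if a == 0 then nth 0 (size l :: l) i else 0.

Definition output (s : state) : seq nat := mkseq (fun i => s 1 i.+1) (s 1 0).

Definition computes_within (c : prog) (x y : seq nat) (T : nat) : Prop :=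
  exists (s : state) (t : nat), [/\ exec c (load x) s t, output s = y & t <= T].

Definition code_gate (g : gate) : seq nat :=
  match g with
  | AND i j => [:: 0; i; j]
  | NOT i => [:: 1; i; 0]
  end.

Definition code_circuit (phi : circuit) : seq nat :=
  [:: ninputs phi, out phi, size (gates phi)
    & flatten [seq code_gate g | g <- gates phi]].

Definition code_witness (x : seq bool) : seq nat := [seq nat_of_bool b | b <- x].

(* Row-major, each entry as its representative in {0, ..., p-1}. *)
Definition code_mx (p r c : nat) (X : 'M['F_p]_(r, c)) : seq nat :=
  [seq (X i j : nat) | i <- enum 'I_r, j <- enum 'I_c].

Definition code_mxs (p n : nat) (Ms : seq 'M['F_p]_n) : seq nat :=
  size Ms :: flatten [seq code_mx X | X <- Ms].

Definition log_floor (N : nat) : nat := trunc_log 2 N.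

Definition mx_order (N : nat) : nat :=
  let R := log_floor N in N.+1 * (2 * N * R).+1 * 'C(2 * R, R).

Definition boolean_vector (p n : nat) (v : 'cV['F_p]_n) : Prop :=
  exists b : 'I_n -> bool, v = (\col_i (b i)%:R)%R.

Definition wt (p n : nat) (v : 'cV['F_p]_n) : nat := #|[set i | v i ord0 != 0%R]|.

(* Main.v *)
Require Import Defs.
From mathcomp Require Import all_boot all_order all_algebra.
From mathcomp Require Import zify ring.

(* Let n = N + 1, b_0 = 1, and let y_k(t) = \sum_m z_k^m t^m b_m for k <= R be
   linear forms in b over F_p[t], with z_0 = 0 and z_k = 2^(k-1), so y_0 = b_0.
   The unknowns L(x,s,i,l) stand for the coefficient of t^s in y^x, times
   b_i b_l, where y^x runs over the 'C(2R, R) monomials of degree R.  A matrix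
   of S consists, for each (x,s), of a group of n rows carrying the n x n
   block L(x,s,.,.) and, for each linear equation expected of L (symmetry,
   Booleanity, the circuit equations, and the exchange relations
   y_j (y_k y^w) = y_k (y_j y^w)), of a Toeplitz band with R+1 rows that is
   constant along its diagonal.  A violated equation gives rank >= R+1 by
   itself, and the values of L at a satisfying assignment give a matrix of
   rank one.

   Suppose now that all equations hold and the rank r is at most R.  Over
   F_p(t) the y_k condense the column space: the r x r matrix of twisted
   moments is nonsingular because the 2^m are distinct mod p (p > 2^N), so
   every coordinate b_l is, on L, a combination of y_0, ..., y_R.  Expanding
   R of the coordinates makes L a symmetric Boolean tensor of order R+2 that
   satisfies the circuit equations and whose linear relations have corank at
   most R.  As long as some coordinate is neither 0 nor b_0 on the tensor,
   conditioning on it lowers the corank by one, so after at most R steps the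
   tensor is concentrated on a single Boolean solution. *)

Set Implicit Arguments.
Unset Strict Implicit.
Unset Printing Implicit Defensive.

Import GRing.Theory.
Local Open Scope nat_scope.

(** * Commands *)

(** Conditioning R times consumes a symmetric tensor of order R+2, and storing one would take about
    $(N+1)^{R+2}$ unknowns, too many for polynomial time. Low rank is what rescues this: over
    $\mathbb F_p(t)$ the coordinates are spanned by at most R forms, so moments against monomials in
    a few forms already determine the tensor. There are $\binom{2R}{R}\le 4^R\le N^2$ such
    monomials, which is where the choice of R as a logarithm is spent.

    The forms have to be fixed before the column space is known. Scalar forms would fail on some
    spaces; the twist $t^m$ lets one family serve all of them, at the price of storing every
    coefficient in t: NR+1 for a monomial of degree R, and NR+N+1, at most 2NR+1, for an exchange
    relation. Rows of a block, powers of t and monomials give the three factors of the matrix order.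

    The time bounds are read off the syntax of the programs: loop bounds depend on read-only memory
    alone, and an assignment lengthens numbers only by a bounded amount, so polynomially many steps
    take polynomial time. *)

Inductive cmd :=
  | CSkip
  | CAssign (a : nat) (i e : expr)
  | CSeq (c1 c2 : cmd)
  | CIf (e : expr) (c1 c2 : cmd)
  | CFor (x : nat) (e : expr) (c : cmd).

Definition cell (a : nat) : expr := Get a (Const 0).

(* Bank x is reserved for the loop: cell 0 is the counter and cell 1 the
   bound. *)
Fixpoint compile (c : cmd) : prog :=
  match c with
  | CSkip => Skip
  | CAssign a i e => Assign a i e
  | CSeq c1 c2 => Seq (compile c1) (compile c2)
  | CIf e c1 c2 => If e (compile c1) (compile c2)
  | CFor x e c =>
      Seq (Assign x (Const 1) e) (Seq (Assign x (Const 0) (Const 0))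
        (While (Op Defs.Sub (Get x (Const 1)) (cell x))
           (Seq (compile c) (Assign x (Const 0) (Op Add (cell x) (Const 1))))))
  end.

Fixpoint run (c : cmd) (s : state) : state :=
  match c with
  | CSkip => s
  | CAssign a i e => update s a (eval i s) (eval e s)
  | CSeq c1 c2 => run c2 (run c1 s)
  | CIf e c1 c2 => if eval e s != 0 then run c1 s else run c2 s
  | CFor x e c =>
      iter (eval e s) (fun s => let s' := run c s in update s' x 0 (s' x 0 + 1))
        (update (update s x 1 (eval e s)) x 0 0)
  end.

Fixpoint writes (c : cmd) : seq nat :=
  match c with
  | CSkip => [::]
  | CAssign a _ _ => [:: a]
  | CSeq c1 c2 | CIf _ c1 c2 => writes c1 ++ writes c2
  | CFor x _ c => x :: writes c
  end.

Definition agree (ro : seq nat) (s s' : state) : Prop :=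
  forall a i, a \in ro -> s a i = s' a i.

Lemma updateE s a i v : update s a i v a i = v.
Proof. by rewrite /update !eqxx. Qed.

Lemma update_bank s a i v b j : b != a -> update s a i v b j = s b j.
Proof. by rewrite /update => /negPf ->. Qed.

Lemma update_cell s a i v b j : j != i -> update s a i v b j = s b j.
Proof. by rewrite /update => /negPf ->; rewrite andbF. Qed.

Lemma run_frame c s a i : a \notin writes c -> run c s a i = s a i.
Proof.
elim: c s => [|b i' e|c1 IH1 c2 IH2|e c1 IH1 c2 IH2|x e c IH] s //=.
- by rewrite inE => /update_bank ->.
- by rewrite mem_cat negb_or => /andP[h1 h2]; rewrite IH2 // IH1.
- by rewrite mem_cat negb_or => /andP[h1 h2]; case: ifP => _; rewrite ?IH1 ?IH2.
rewrite inE negb_or => /andP[ax ac].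
elim: {1}(eval e s) => [|n IHn] /=; first by rewrite !update_bank.
by rewrite update_bank // IH.
Qed.

(* Loop rule.  The invariant is assumed to hold of the state at the start of
   iteration i, where the counter equals i. *)
Lemma run_for (I : nat -> state -> Prop) x e c s :
  x \notin writes c ->
  I 0 (update (update s x 1 (eval e s)) x 0 0) ->
  (forall i s', i < eval e s -> s' x 0 = i -> I i s' ->
     I i.+1 (update (run c s') x 0 i.+1)) ->
  I (eval e s) (run (CFor x e c) s).
Proof.
move=> xc I0 IS /=; set n := eval e s; set s1 := update _ _ _ _.
suff H j : j <= n -> let s' := iter j (fun s0 => let s' := run c s0 in
    update s' x 0 (s' x 0 + 1)) s1 in I j s' /\ s' x 0 = j by case: (H n).
elim: j => [|j IHj] jn; first by split; rewrite //= /s1 updateE.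
have [Ij xj] := IHj (ltnW jn); rewrite /= updateE run_frame // xj addn1.
by split => //; apply: IS.
Qed.

(** * Growth of numbers and running time of commands *)

Definition bounded (s : state) (B : nat) : Prop := forall a i, bitlen (s a i) <= B.

Lemma bitlenE n B : 0 < B -> (bitlen n <= B) = (n < 2 ^ B).
Proof.
rewrite /bitlen; case: n => [|n] B0; first by rewrite trunc_log0 expn_gt0 B0.
apply/idP/idP => h.
  by apply: leq_trans (trunc_log_ltn n.+1 (isT : 1 < 2)) _; rewrite leq_exp2l.
rewrite -(@ltn_exp2l 2) //; apply: leq_ltn_trans h; exact: trunc_logP.
Qed.

Lemma leq_self_sqr n : n <= n ^ 2.
Proof. by case: n => // n; rewrite -mulnn leq_pmulr. Qed.

Lemma bitlen_lt n : n < 2 ^ bitlen n.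
Proof. by rewrite -bitlenE. Qed.

Lemma leq_bitlen m n : m <= n -> bitlen m <= bitlen n.
Proof. by move=> mn; rewrite /bitlen ltnS leq_trunc_log. Qed.

Lemma bitlen_add m n : bitlen (m + n) <= (maxn (bitlen m) (bitlen n)).+1.
Proof.
rewrite bitlenE // expnS mul2n -addnn -addSn leq_add //.
  by apply: leq_trans (bitlen_lt m) _; rewrite leq_exp2l // leq_maxl.
by rewrite ltnW // (leq_trans (bitlen_lt n)) // leq_exp2l // leq_maxr.
Qed.

Lemma bitlen_mul m n : bitlen (m * n) <= bitlen m + bitlen n.
Proof.
rewrite bitlenE // expnD; have := bitlen_lt m; have := bitlen_lt n.
case: n => [|n]; first by rewrite muln0 muln_gt0 !expn_gt0.
by move=> hn hm; rewrite ltn_mul.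
Qed.

Lemma bitlen_op o m n : bitlen (eval_op o m n) <= bitlen m + bitlen n.
Proof.
have h k : k <= m -> bitlen k <= bitlen m + bitlen n.
  by move=> km; apply: leq_trans (leq_bitlen km) (leq_addr _ _).
case: o => /=; [|apply/h/leq_subr|exact: bitlen_mul|apply/h/leq_div|apply/h/leq_mod].
apply: leq_trans (bitlen_add m n) _; rewrite /bitlen; lia.
Qed.

(** An operation at most adds the lengths of its operands, so an expression of fixed shape
    multiplies the longest length by a constant; charging products of lengths makes the time
    quadratic. Constants are absorbed because [bitlen 0 = 1] forces [0 < B]. *)
Lemma eval_bound e : exists k, forall s B, bounded s B ->
  bitlen (eval e s) <= k * B /\ cost e s <= k * B ^ 2.
Proof.
have B1 s B : bounded s B -> 0 < B by move=> /(_ 0 0); apply: leq_trans.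
elim: e => [n|a e [k IH]|o e1 [k1 IH1] e2 [k2 IH2]] /=.
- exists (bitlen n) => s B /B1 B0.
  by rewrite !leq_pmulr ?expn_gt0 ?B0.
- exists (k + k + 1) => s B sB; have [h1 h2] := IH s B sB; have B0 := B1 _ _ sB.
  have hB := sB a (eval e s).
  split; first by nia.
  have : B <= B ^ 2 by rewrite expnS leq_pmulr // expn1.
  nia.
exists (k1 + k2 + k1 * k2) => s B sB.
have [h1 c1] := IH1 s B sB; have [h2 c2] := IH2 s B sB; have B0 := B1 _ _ sB.
split; first by have := bitlen_op o (eval e1 s) (eval e2 s); nia.
have := leq_mul h1 h2; rewrite mulnACA mulnn; nia.
Qed.

Fixpoint roe (ro : seq nat) (e : expr) : bool :=
  match e with
  | Const _ => true
  | Get a e => (a \in ro) && roe ro e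
  | Op _ e1 e2 => roe ro e1 && roe ro e2
  end.

(** A syntactic certificate that a modulus is positive: since [n %% 0 = n], the length of a
    remainder is controlled by the modulus only when the modulus cannot be 0. *)
Definition is_succ (e : expr) : bool :=
  if e is Op Add (Const n) _ then 0 < n else false.

(* The value is bounded in terms of the read-only banks. *)
Fixpoint rob (ro : seq nat) (e : expr) : bool :=
  match e with
  | Const _ => true
  | Get a _ => a \in ro
  | Op Add e1 e2 | Op Mul e1 e2 => rob ro e1 && rob ro e2
  | Op Defs.Sub e1 _ | Op Div e1 _ => rob ro e1
  | Op Mod e1 e2 => rob ro e1 || (is_succ e2 && rob ro e2)
  end.

(* The value exceeds the longest number in memory in length by an amount
   bounded in terms of the read-only banks. *)
Fixpoint tame (ro : seq nat) (e : expr) : bool :=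
  rob ro e ||
  match e with
  | Const _ | Get _ _ => true
  | Op Add e1 e2 => tame ro e1 && tame ro e2
  | Op Mul e1 e2 => tame ro e1 && rob ro e2
  | Op Defs.Sub e1 _ | Op Div e1 _ | Op Mod e1 _ => tame ro e1
  end.

Lemma eval_roe ro e s s0 : roe ro e -> agree ro s s0 -> eval e s = eval e s0.
Proof.
move=> + ag; elim: e => [n|a e IH|o e1 IH1 e2 IH2] //=.
  by case/andP => aro /IH ->; apply: ag.
by case/andP => /IH1 -> /IH2 ->.
Qed.

Lemma bounded_gt0 s b : bounded s b -> 0 < b.
Proof. by move=> /(_ 0 0); apply: leq_trans. Qed.

Lemma rob_bound ro e : rob ro e -> exists k, forall s s0 b0,
  agree ro s s0 -> bounded s0 b0 -> bitlen (eval e s) <= k * b0.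
Proof.
elim: e => [n|a e IH|o e1 IH1 e2 IH2] /=.
- by move=> _; exists (bitlen n) => s s0 b0 _ /bounded_gt0 b1; rewrite leq_pmulr.
- by move=> aro; exists 1 => s s0 b0 ag sb; rewrite mul1n ag.
have first_arg : rob ro e1 -> (forall m n, eval_op o m n <= m) ->
    exists k, forall s s0 b0, agree ro s s0 -> bounded s0 b0 ->
    bitlen (eval_op o (eval e1 s) (eval e2 s)) <= k * b0.
  move=> /IH1[k hk] le; exists k => s s0 b0 ag sb.
  exact: leq_trans (leq_bitlen (le _ _)) (hk _ _ _ ag sb).
have both : rob ro e1 -> rob ro e2 ->
    exists k, forall s s0 b0, agree ro s s0 -> bounded s0 b0 ->
    bitlen (eval_op o (eval e1 s) (eval e2 s)) <= k * b0.
  move=> /IH1[k1 h1] /IH2[k2 h2]; exists (k1 + k2) => s s0 b0 ag sb.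
  apply: leq_trans (bitlen_op _ _ _) _; rewrite mulnDl leq_add //.
    exact: h1 ag sb.
  exact: h2 ag sb.
case: o first_arg both => /= first_arg both.
- by case/andP.
- by move=> r1; apply: first_arg => // m n; apply: leq_subr.
- by case/andP.
- by move=> r1; apply: first_arg => // m n; apply: leq_div.
case/orP => [r1|/andP[sc /IH2[k hk]]]; first by apply: first_arg => // m n; apply: leq_mod.
exists k => s s0 b0 ag sb; apply: leq_trans (hk _ _ _ ag sb); apply: leq_bitlen.
rewrite ltnW // ltn_pmod //; case: (e2) sc => // -[] // [] //= n e3 n0.
by rewrite addn_gt0 n0.
Qed.

(** The coefficient of [B] is 1, which is the purpose of [tame]: a product is accepted only with one
    factor bounded by read-only banks, so iterated assignments cannot square a number repeatedly. *)
Lemma tame_bound ro e : tame ro e -> exists k, forall s s0 B b0,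
  agree ro s s0 -> bounded s B -> bounded s0 b0 ->
  bitlen (eval e s) <= B + k * b0.
Proof.
have of_rob e' : rob ro e' -> exists k, forall s s0 B b0,
    agree ro s s0 -> bounded s B -> bounded s0 b0 ->
    bitlen (eval e' s) <= B + k * b0.
  move=> /rob_bound[k hk]; exists k => s s0 B b0 ag _ sb.
  by apply: leq_trans (hk _ _ _ ag sb) (leq_addl _ _).
elim: e => [n|a e IH|o e1 IH1 e2 IH2] /=; first by move=> _; apply: (of_rob (Const n)).
  by move=> _; exists 0 => s s0 B b0 _ sB _; rewrite addn0.
case/orP => [r|]; first exact: (of_rob (Op o e1 e2) r).
have first_arg : tame ro e1 -> (forall m n, eval_op o m n <= m) ->
    exists k, forall s s0 B b0, agree ro s s0 -> bounded s B -> bounded s0 b0 ->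
    bitlen (eval_op o (eval e1 s) (eval e2 s)) <= B + k * b0.
  move=> /IH1[k hk] le; exists k => s s0 B b0 ag sB sb.
  exact: leq_trans (leq_bitlen (le _ _)) (hk _ _ _ _ ag sB sb).
case: o first_arg => /= first_arg.
- case/andP => /IH1[k1 h1] /IH2[k2 h2]; exists (k1 + k2 + 1) => s s0 B b0 ag sB sb.
  have := h1 _ _ _ _ ag sB sb; have := h2 _ _ _ _ ag sB sb.
  have := bounded_gt0 sb.
  have := bitlen_add (eval e1 s) (eval e2 s); rewrite /bitlen; nia.
- by move=> t1; apply: first_arg => // m n; apply: leq_subr.
- case/andP => /IH1[k1 h1] /rob_bound[k2 h2]; exists (k1 + k2) => s s0 B b0 ag sB sb.
  have := h1 _ _ _ _ ag sB sb; have := h2 _ _ _ ag sb.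
  have := bitlen_mul (eval e1 s) (eval e2 s); rewrite /bitlen; nia.
- by move=> t1; apply: first_arg => // m n; apply: leq_div.
- by move=> t1; apply: first_arg => // m n; apply: leq_mod.
Qed.

Fixpoint wf (ro : seq nat) (c : cmd) : bool :=
  match c with
  | CSkip => true
  | CAssign a _ e => (a \notin ro) && tame ro e
  | CSeq c1 c2 | CIf _ c1 c2 => wf ro c1 && wf ro c2
  | CFor x e c => [&& x \notin ro, x \notin writes c, roe ro e & wf ro c]
  end.

(** All loop bounds are read in the single state [s]; this is sound for well-formed commands, whose
    bounds depend on read-only banks. Charging both branches of a conditional avoids following the
    test. *)
Fixpoint steps (c : cmd) (s : state) : nat :=
  match c with
  | CSkip | CAssign _ _ _ => 1
  | CSeq c1 c2 => steps c1 s + steps c2 s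
  | CIf _ c1 c2 => (steps c1 s + steps c2 s).+1
  | CFor _ e c => (eval e s * (steps c s).+1).+1
  end.

Lemma wf_writes ro c a : wf ro c -> a \in ro -> a \notin writes c.
Proof.
move=> + aro; elim: c => [|b i e|c1 IH1 c2 IH2|e c1 IH1 c2 IH2|x e c IH] //=.
- by case/andP => bro _; rewrite inE; apply: contraNneq bro => <-.
- by case/andP => /IH1 h1 /IH2 h2; rewrite mem_cat negb_or h1.
- by case/andP => /IH1 h1 /IH2 h2; rewrite mem_cat negb_or h1.
case/and4P => xro _ _ /IH h; rewrite inE negb_or h andbT.
by apply: contraNneq xro => <-.
Qed.

Lemma agree_run ro c s s0 : wf ro c -> agree ro s s0 -> agree ro (run c s) s0.
Proof. by move=> w ag a i aro; rewrite run_frame ?ag // (wf_writes w). Qed.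

Lemma agree_update ro s s0 a i v :
  a \notin ro -> agree ro s s0 -> agree ro (update s a i v) s0.
Proof.
by move=> nro ag b j bro; rewrite update_bank ?ag //; apply: contraNneq nro => <-.
Qed.

Lemma bounded_update s B a i v : bounded s B -> bitlen v <= B -> bounded (update s a i v) B.
Proof. by move=> sB vB b j; rewrite /update; case: ifP. Qed.

Lemma bounded_le s B B' : bounded s B -> B <= B' -> bounded s B'.
Proof. by move=> sB h a i; apply: leq_trans (sB a i) h. Qed.

(** The state [s0] stays fixed while [s] evolves, so read-only values keep length at most [b0] and
    each step adds at most [k * b0] to the longest number. Growth is linear in the number of steps,
    and a step costs at most quadratically in the length reached. *)
Lemma exec_compile ro c : wf ro c -> exists k, forall s s0 B b0,
  agree ro s s0 -> bounded s B -> bounded s0 b0 ->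
  bounded (run c s) (B + k * steps c s0 * b0)
  /\ exists2 t, exec (compile c) s (run c s) t
     & t <= k * steps c s0 * (B + k * steps c s0 * b0) ^ 2.
Proof.
elim: c => [|a i e|c1 IH1 c2 IH2|e c1 IH1 c2 IH2|x e c IH] /=.
- move=> _; exists 1 => s s0 B b0 ag sB sb; split; first exact: bounded_le sB (leq_addr _ _).
  exists 1; first exact: ExecSkip.
  by rewrite !mul1n expn_gt0 addn_gt0 (bounded_gt0 sB).
- case/andP => aro /tame_bound[ke he].
  have [k1 h1] := eval_bound i; have [k2 h2] := eval_bound e.
  exists (ke + 2 * (k1 + k2)) => s s0 B b0 ag sB sb.
  have [v1 c1] := h1 s B sB; have [v2 c2] := h2 s B sB.
  have ve := he s s0 B b0 ag sB sb.
  have Bgt := bounded_gt0 sB; have bgt := bounded_gt0 sb.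
  split; first by apply: bounded_update; [exact: bounded_le sB (leq_addr _ _)|nia].
  eexists; first exact: ExecAssign.
  set k := ke + 2 * (k1 + k2); rewrite muln1.
  apply: (@leq_trans (k * B ^ 2)); last first.
    by rewrite leq_mul2l leq_exp2r // leq_addr orbT.
  have := leq_self_sqr B.
  rewrite /k; nia.
- case/andP => /[dup] w1 /IH1[k1 h1] /IH2[k2 h2]; exists (k1 + k2) => s s0 B b0 ag sB sb.
  have [bd1 [t1 e1 l1]] := h1 s s0 B b0 ag sB sb.
  have [bd2 [t2 e2 l2]] := h2 _ s0 _ b0 (agree_run w1 ag) bd1 sb.
  set q1 := steps c1 s0 in bd1 l1 bd2 l2 *; set q2 := steps c2 s0 in bd2 l2 *.
  have le12 : B + k1 * q1 * b0 + k2 * q2 * b0 <= B + (k1 + k2) * (q1 + q2) * b0.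
    by clear; rewrite ?(mulnDl, mulnDr, mulnS, mulSn); lia.
  split; first exact: bounded_le bd2 le12.
  exists (t1 + t2); first exact: ExecSeq e1 e2.
  set BB := (B + _) ^ 2.
  have l1' : t1 <= k1 * q1 * BB.
    apply: leq_trans l1 _; rewrite leq_mul2l leq_exp2r //.
    by rewrite (leq_trans _ le12) ?leq_addr ?orbT.
  have l2' : t2 <= k2 * q2 * BB.
    by apply: leq_trans l2 _; rewrite leq_mul2l leq_exp2r // le12 orbT.
  move: l1' l2'; clearbody BB; clear; rewrite ?(mulnDl, mulnDr, mulnS, mulSn); lia.
- case/andP => /IH1[k1 h1] /IH2[k2 h2]; have [ke he] := eval_bound e.
  exists (ke + k1 + k2) => s s0 B b0 ag sB sb.
  have [_ ce] := he s B sB.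
  have [bd1 [t1 e1 l1]] := h1 s s0 B b0 ag sB sb.
  have [bd2 [t2 e2 l2]] := h2 s s0 B b0 ag sB sb.
  set q1 := steps c1 s0 in bd1 l1 *; set q2 := steps c2 s0 in bd2 l2 *.
  have le1 : B + k1 * q1 * b0 <= B + (ke + k1 + k2) * (q1 + q2).+1 * b0.
    by clear; rewrite ?(mulnDl, mulnDr, mulnS, mulSn); lia.
  have le2 : B + k2 * q2 * b0 <= B + (ke + k1 + k2) * (q1 + q2).+1 * b0.
    by clear; rewrite ?(mulnDl, mulnDr, mulnS, mulSn); lia.
  set BB := (B + (ke + k1 + k2) * _ * b0) ^ 2.
  have ce' : cost e s <= ke * BB.
    by apply: leq_trans ce _; rewrite leq_mul2l leq_exp2r // leq_addr orbT.
  case: ifPn => [nz|]; last (rewrite negbK => /eqP z).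
    split; first exact: bounded_le bd1 le1.
    eexists; first exact: ExecIfTrue nz e1.
    have l1' : t1 <= k1 * q1 * BB.
      by apply: leq_trans l1 _; rewrite leq_mul2l leq_exp2r // le1 orbT.
    move: ce' l1'; clearbody BB; clear; rewrite ?(mulnDl, mulnDr, mulnS, mulSn); lia.
  split; first exact: bounded_le bd2 le2.
  eexists; first exact: ExecIfFalse z e2.
  have l2' : t2 <= k2 * q2 * BB.
    by apply: leq_trans l2 _; rewrite leq_mul2l leq_exp2r // le2 orbT.
  move: ce' l2'; clearbody BB; clear; rewrite ?(mulnDl, mulnDr, mulnS, mulSn); lia.
case/and4P => xro xc re /[dup] wc /IH[kc hc].
have [ke he] := eval_bound e.
set te := Op _ (Get x _) _; have [kt ht] := eval_bound te.
set ie := Op Add _ _; have [ki hi] := eval_bound ie.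
pose K := kc + ke + kt + ki + ki + 10.
exists (K + K) => s s0 B b0 ag sB sb; rewrite (eval_roe re ag).
set n := eval e s0; set q := steps c s0; set f := fun s' => update _ _ _ _.
have B0 := bounded_gt0 sB; have b00 := bounded_gt0 sb.
(* Length bound before iteration [j]: [ke * b0] pays for storing the loop bound, [kc * q * b0] for
   one run of the body, and the extra [b0] for incrementing the counter. *)
pose Bn j := B + ke * b0 + j * (kc * q).+1 * b0.
have Bnmono i j : i <= j -> Bn i <= Bn j by move=> ij; rewrite /Bn leq_add2l !leq_mul.
pose BB := Bn n ^ 2.
have BnBB j : j <= n -> Bn j <= BB.
  move=> jn; apply: leq_trans (Bnmono _ _ jn) _.
  exact: leq_self_sqr.
have loop m : forall s', m <= n -> s' x 0 = n - m -> s' x 1 = n -> agree ro s' s0 ->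
    bounded s' (Bn (n - m)) ->
    bounded (iter m f s') (Bn n) /\ exists2 t,
      exec (While te (Seq (compile c) (Assign x (Const 0) ie))) s' (iter m f s') t
      & t <= (m * (kc * q + kt + ki + ki + 3) + kt) * BB.
  elim: m => [|m IHm] s' mn x0 x1 ag' sB'.
    split; first by rewrite /= subn0 in sB' *.
    exists (cost te s'); first by apply: ExecWhileFalse; rewrite /= x0 x1 subn0 subnn.
    by rewrite mul0n; have [_ h] := ht _ _ sB'; move: h; rewrite /BB subn0.
  have nm : n - m = (n - m.+1).+1 by rewrite subnSK.
  have le_nm : n - m.+1 <= n by apply: leq_subr.
  have [bdc [t1 e1 l1]] := hc s' s0 _ b0 ag' sB' sb.
  have stepB : Bn (n - m.+1) + kc * steps c s0 * b0 <= Bn (n - m).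
    by rewrite nm /Bn -/q; nia.
  have bdc' := bounded_le bdc (leq_trans stepB (leqnn _)).
  have vinc : eval ie (run c s') = (n - m.+1).+1 by rewrite /= run_frame // x0 addn1.
  have bdf : bounded (f s') (Bn (n - m)).
    apply: bounded_update bdc' _; rewrite run_frame // x0.
    apply: leq_trans (bitlen_add _ _) _.
    have := sB' x 0; rewrite x0 nm /Bn (_ : bitlen 1 = 1) //.
    clear -b00; rewrite !(mulnDl, mulnDr, mulnS, mulSn); rewrite /bitlen; lia.
  have [|||bd [t2 e2 l2]] := IHm (f s') (ltnW mn) _ _ _ bdf.
  - by rewrite /f updateE run_frame // x0 addn1 nm.
  - by rewrite /f update_cell // run_frame.
  - exact: agree_update (agree_run wc ag').
  have [_ ct] := ht _ _ sB'.
  have [vi ci] := hi _ _ bdc'.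
  rewrite iterSr; split=> //; eexists.
    apply: ExecWhileTrue e2; last by apply: ExecSeq e1 _; apply: ExecAssign.
    by rewrite /= x0 x1 -lt0n; lia.
  have sq j : j <= n -> Bn j ^ 2 <= BB by move=> jn; rewrite leq_exp2r ?Bnmono.
  have ct' := leq_trans ct (leq_mul (leqnn kt) (sq _ le_nm)).
  have l1' : t1 <= kc * q * BB.
    apply: leq_trans l1 _; rewrite leq_mul2l leq_exp2r //.
    by rewrite (leq_trans stepB) ?Bnmono ?orbT ?leq_subr.
  have ci' := leq_trans ci (leq_mul (leqnn ki) (sq _ (leq_subr m n))).
  have vi' := leq_trans vi (leq_mul (leqnn ki) (BnBB _ (leq_subr m n))).
  have BB1 : 0 < BB by rewrite /BB expn_gt0 /Bn -addnA addn_gt0 B0.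
  have b0E : bitlen 0 = 1 by [].
  move: ct' l1' ci' vi' BB1 l2; rewrite /= b0E; clearbody BB; clear; rewrite ?(mulnDl, mulnDr, mulnS, mulSn); lia.
have [v1 c1] := he s B sB.
have ven : bitlen n <= ke * b0 by have [] := he s0 b0 sb.
have sBn : bounded (update (update s x 1 n) x 0 0) (Bn (n - n)).
  rewrite subnn; apply: bounded_update; last by rewrite /Bn -addnA addn_gt0 B0.
  apply: bounded_update; last by rewrite /Bn -addnA (leq_trans ven) // addnCA leq_addr.
  by apply: bounded_le sB _; rewrite /Bn -addnA leq_addr.
have [|||bd [t e1 l1]] := loop n _ (leqnn n) _ _ _ sBn.
- by rewrite updateE subnn.
- by rewrite update_cell // updateE.
- by apply: agree_update => //; apply: agree_update.
have BnE : Bn n <= B + (K + K) * (n * q.+1).+1 * b0.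
  by rewrite /Bn /K; clear; rewrite ?(mulnDl, mulnDr, mulnS, mulSn); lia.
split; first exact: bounded_le bd BnE.
eexists.
  apply: ExecSeq; first exact: ExecAssign.
  apply: ExecSeq; first exact: ExecAssign.
  by rewrite (eval_roe re ag); exact: e1.
rewrite (eval_roe re ag) -/n.
apply: (@leq_trans ((K + K) * (n * q.+1).+1 * BB)); last first.
  by rewrite leq_mul2l leq_exp2r // BnE orbT.
have cb : cost e s <= ke * BB.
  apply: leq_trans c1 _; rewrite leq_mul2l /BB leq_exp2r // /Bn -addnA leq_addr orbT //.
have vb : bitlen n <= BB.
  apply: leq_trans ven (leq_trans _ (BnBB n (leqnn n))).
  by rewrite /Bn -addnA addnCA leq_addr.
have BB1 : 0 < BB by rewrite /BB expn_gt0 /Bn -addnA addn_gt0 B0.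
have b0E : bitlen 0 = 1 by []. have b1E : bitlen 1 = 1 by [].
move: l1 cb vb BB1; rewrite /= b0E b1E /K; clearbody BB; clear; rewrite ?(mulnDl, mulnDr, mulnS, mulSn); lia.
Qed.

(** * Boolean points from symmetric tensors *)

Local Open Scope ring_scope.

(* Conditioning on a coordinate i that is neither 0 nor equal to the coordinate 0
   on Psi adds the independent relation [i = 0] to U, so r can decrease; when
   there is no such i, Psi is a multiple of the power of a Boolean point. *)
Lemma boolean_point_of_tensor (K : fieldType) (N r : nat)
    (Eqs : ('I_N.+1 -> 'I_N.+1 -> K) -> Prop)
    (Psi : seq 'I_N.+1 -> K) (U : 'M[K]_N.+1) :
  (forall s1 a b s2, size (s1 ++ a :: b :: s2) = r.+2 ->
     Psi (s1 ++ a :: b :: s2) = Psi (s1 ++ b :: a :: s2)) ->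
  (forall i s, size s = r -> Psi (i :: i :: s) = Psi (i :: ord0 :: s)) ->
  (forall c s, Eqs c -> size s = r ->
     \sum_i \sum_j c i j * Psi (i :: j :: s) = 0) ->
  (forall (w : 'rV_N.+1) s, (w <= U)%MS -> size s = r.+1 ->
     \sum_l w 0 l * Psi (l :: s) = 0) ->
  (N.+1 <= \rank U + r)%N ->
  (exists2 s, size s = r.+2 & Psi s != 0) ->
  exists2 b : 'I_N.+1 -> bool, b ord0
    & forall c, Eqs c -> \sum_i \sum_j c i j * (b i)%:R * (b j)%:R = 0.
Proof.
elim: r Psi U => [|r IH] Psi U Psym Pbool Peqs PU rkU [s0 ss0 Ps0].
  (* For [r = 0] the relations in [U] have full rank, so every coordinate vanishes on [Psi],
     contradicting the nonzero entry. *)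
  case: s0 ss0 Ps0 => // l s [] ss /eqP[].
  have Ufull : ((delta_mx 0 l : 'rV[K]_N.+1) <= U)%MS.
    by apply: submx_full; rewrite -col_leq_rank -(addn0 (\rank U)).
  have := PU _ _ Ufull ss; rewrite (bigD1 l) //= mxE !eqxx mul1r big1 ?addr0 //.
  by move=> j /negPf nl; rewrite mxE nl andbF mul0r.
have swap a b s : size s = r.+1 -> Psi (a :: b :: s) = Psi (b :: a :: s).
  by move=> ss; apply: (Psym [::]); rewrite /= ss.
have swap3 a b c s : size s = r -> Psi (a :: b :: c :: s) = Psi (a :: c :: b :: s).
  by move=> ss; move: (Psym [:: a] b c s); rewrite /= ss => ->.
pose vanishes (i : 'I_N.+1) : bool := [forall s : r.+2.-tuple 'I_N.+1, Psi (i :: s) == 0].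
pose same (i : 'I_N.+1) : bool := [forall s : r.+2.-tuple 'I_N.+1, Psi (i :: s) == Psi (ord0 :: s)].
have vanishesP i : reflect (forall s, size s = r.+2 -> Psi (i :: s) = 0) (vanishes i).
  apply: (iffP forallP) => [H s /eqP ss | H s]; first exact/eqP/(H (Tuple ss)).
  by rewrite H ?size_tuple.
have sameP i : reflect (forall s, size s = r.+2 -> Psi (i :: s) = Psi (ord0 :: s)) (same i).
  apply: (iffP forallP) => [H s /eqP ss | H s]; first exact/eqP/(H (Tuple ss)).
  by rewrite H ?size_tuple.
case: (boolP [exists i, ~~ vanishes i && ~~ same i]) => [/existsP[i /andP[nv ns]] | /existsPn dich].
  (* By Booleanity [d] is a relation of the slice at [i]; [ns] shows that it is not a relation of
     [Psi], hence outside [U], and [nv] that the slice is nonzero. *)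
  pose d : 'rV[K]_N.+1 := delta_mx 0 i - delta_mx 0 ord0.
  have sumd s : \sum_l d 0 l * Psi (l :: s) = Psi (i :: s) - Psi (ord0 :: s).
    under eq_bigr => l _ do rewrite !mxE eqxx !andTb mulrBl.
    rewrite sumrB (bigD1 i) //= eqxx mul1r big1 ?addr0; last first.
      by move=> j /negPf ->; rewrite mul0r.
    rewrite (bigD1 ord0) //= mul1r big1 ?addr0 // => j /negPf.
    by rewrite -!val_eqE /= => ->; rewrite mul0r.
  have dU : ~~ (d <= U)%MS.
    apply/negP => dU; case/negP: ns; apply/sameP => s ss.
    by apply/eqP; rewrite -subr_eq0 -sumd PU.
  apply: (IH (fun s => Psi (i :: s)) (U + d)%MS).
  - by move=> s1 a b s2 sz; apply: (Psym (i :: s1)); rewrite /= sz.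
  - move=> a s ss.
    have st x y : Psi (i :: x :: y :: s) = Psi (x :: y :: i :: s).
      by rewrite (swap i) /= ?ss // swap3.
    by rewrite !st Pbool //= ss.
  - move=> c s Ec ss; rewrite -[RHS](Peqs c (i :: s) Ec) /= ?ss //.
    apply: eq_bigr => a _; apply: eq_bigr => b _; congr (_ * _).
    by rewrite (swap i) /= ?ss // swap3.
  - move=> w s /sub_addsmxP[[u v] /= ->] ss.
    under eq_bigr => l _ do rewrite mxE mulrDl.
    rewrite big_split /= -[RHS]addr0; congr (_ + _).
      have := PU (u *m U) (i :: s) (submxMl _ _) (congr1 S ss).
      by move=> {2}<-; apply: eq_bigr => l _; rewrite swap.
    transitivity (v 0 0 * \sum_l d 0 l * Psi (i :: l :: s)).
      by rewrite mulr_sumr; apply: eq_bigr => l _; rewrite [(v *m d) 0 l]mxE big_ord1 mulrA.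
    under eq_bigr => l _ do rewrite swap //.
    by rewrite (sumd (i :: s)) Pbool // swap // subrr mulr0.
  - apply: leq_trans rkU _; rewrite addnS -addSn leq_add2r.
    suff: (U < U + d)%MS by rewrite ltmxErank => /andP[].
    by rewrite ltmxE addsmxSl /= addsmx_sub submx_refl.
  - by case/forallPn: nv => s ns0; exists (s : seq _); rewrite ?size_tuple.
pose b i := ~~ vanishes i.
have Pb i s : size s = r.+2 -> Psi (i :: s) = (b i)%:R * Psi (ord0 :: s).
  move=> ss; rewrite /b; case: (boolP (vanishes i)) => [/vanishesP v|nv] /=.
    by rewrite v ?mul0r.
  by move: (dich i); rewrite nv /= negbK => /sameP -> //; rewrite mul1r.
exists b => [|c Ec].
  apply/negP => /vanishesP v; move: ss0 Ps0; case: s0 => // l s [] ss.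
  by rewrite Pb // v // mulr0 eqxx.
(* Each of the first two indices contributes a Boolean factor, so the nonzero entry forces the one
   at two indices [ord0] to be nonzero; it can then be cancelled from the equations. *)
case: s0 ss0 Ps0 => // k [|l s] // [] ss.
rewrite Pb /= ?ss // swap // Pb /= ?ss // mulrA => P0.
have {P0}P00 : Psi (ord0 :: ord0 :: s) != 0.
  by apply: contraNneq P0 => ->; rewrite mulr0.
apply: (mulIf P00); rewrite mul0r -[RHS](Peqs c s Ec) // mulr_suml.
apply: eq_bigr => i _; rewrite mulr_suml; apply: eq_bigr => j _.
by rewrite [in RHS]Pb /= ?ss // [in RHS]swap // [in RHS]Pb /= ?ss // !mulrA.
Qed.

(** Reading [B al i l] as the moment of $b_i b_l$ against the monomial coded by [al], substitute
    $b_a=\sum_k c_{a,k}y_k$ for every index [a] of [s]; multiplying by $y_k$ adds [q k] to the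
    code. *)
Fixpoint contract (K : fieldType) (N R1 : nat) (c : 'I_N.+1 -> 'I_R1 -> K)
    (q : 'I_R1 -> nat) (B : nat -> 'I_N.+1 -> 'I_N.+1 -> K)
    (s : seq 'I_N.+1) (al : nat) (i l : 'I_N.+1) : K :=
  if s is a :: s' then \sum_k c a k * contract c q B s' (al + q k) i l
  else B al i l.

(** A word represents a product of [d] forms. Its code is a sum, so the order of the letters is
    forgotten and monomials commute automatically. *)
Definition word_code (R1 : nat) (q : 'I_R1 -> nat) (d al : nat) : Prop :=
  exists2 w : seq 'I_R1, size w = d & al = (\sum_(k <- w) q k)%N.

Lemma word_codeS R1 (q : 'I_R1 -> nat) d al k :
  word_code q d al -> word_code q d.+1 (al + q k).
Proof.
case=> w <- ->; exists (k :: w) => //.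
by rewrite big_cons addnC.
Qed.

(** Expanding [R.+1] indices from code 0 gives a tensor of order [R.+3], to which
    [boolean_point_of_tensor] applies. The issue is its symmetry: two expanded indices commute
    because codes add, the two free ones by [Bsym], and an expanded index trades places with a free
    one through the exchange relations. *)
Lemma boolean_point_of_moments (K : fieldType) (N R R1 : nat)
    (c : 'I_N.+1 -> 'I_R1 -> K) (q : 'I_R1 -> nat)
    (B : nat -> 'I_N.+1 -> 'I_N.+1 -> K) (g : 'I_R1 -> 'I_N.+1 -> K)
    (r : nat) (A : 'M[K]_(N.+1, r)) (Eqs : ('I_N.+1 -> 'I_N.+1 -> K) -> Prop) :
  (r <= R.+1)%N ->
  (forall al i l, word_code q R.+1 al -> B al i l = B al l i) ->
  (forall al i, word_code q R.+1 al -> B al i i = B al i ord0) ->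
  (forall e al, Eqs e -> word_code q R.+1 al ->
     \sum_i \sum_j e i j * B al i j = 0) ->
  (forall al j k i, word_code q R al ->
     \sum_m g j m * B (al + q k)%N i m = \sum_m g k m * B (al + q j)%N i m) ->
  (forall al i l, word_code q R.+1 al ->
     B al i l = \sum_k c l k * \sum_m g k m * B al i m) ->
  (forall (w : 'rV_N.+1) al i, w *m A = 0 -> word_code q R.+1 al ->
     \sum_l w 0 l * B al i l = 0) ->
  (exists al i l, word_code q R.+1 al /\ B al i l != 0) ->
  exists2 b : 'I_N.+1 -> bool, b ord0
    & forall e, Eqs e -> \sum_i \sum_j e i j * (b i)%:R * (b j)%:R = 0.
Proof.
move=> rR Bsym Bbool Beqs Bex Brel BA Bnz.
pose F := contract c q B.
have F0 al i l : F [::] al i l = B al i l by [].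
have FS a s al i l : F (a :: s) al i l = \sum_k c a k * F s (al + q k)%N i l by [].
clearbody F.
have Fex s : forall d al j k i, word_code q d al -> (d + size s = R)%N ->
    \sum_m g j m * F s (al + q k)%N i m = \sum_m g k m * F s (al + q j)%N i m.
  elim: s => [|a s IH] d al j k i va /=; first by rewrite addn0 => dR;
    under eq_bigr do rewrite F0; under [RHS]eq_bigr do rewrite F0; apply: Bex; rewrite -dR.
  rewrite addnS -addSn => dR.
  under eq_bigr => m _ do rewrite FS mulr_sumr.
  rewrite exchange_big /=; under [RHS]eq_bigr => m _ do rewrite FS mulr_sumr.
  rewrite [RHS]exchange_big /=; apply: eq_bigr => h _.
  have st x y : \sum_m g x m * (c a h * F s (al + q y + q h)%N i m)
              = c a h * \sum_m g x m * F s (al + q h + q y)%N i m.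
    by rewrite mulr_sumr addnAC; apply: eq_bigr => m _; rewrite mulrCA.
  by rewrite !st (IH d.+1) //; apply: word_codeS.
have Frel s : forall d al i l, word_code q d al -> (d + size s = R.+1)%N ->
    F s al i l = \sum_k c l k * \sum_m g k m * F s al i m.
  elim: s => [|a s IH] d al i l va /=; first by rewrite addn0 => dR;
    rewrite F0 (Brel al) -?dR //; do 2!(apply: eq_bigr => ? _; congr (_ * _)); rewrite F0.
  rewrite addnS -addSn => dR.
  have st k : \sum_m g k m * F (a :: s) al i m
       = \sum_h c a h * \sum_m g k m * F s (al + q h)%N i m.
    under eq_bigr => m _ do rewrite FS mulr_sumr.
    rewrite exchange_big /=; apply: eq_bigr => h _; rewrite mulr_sumr.
    by apply: eq_bigr => m _; rewrite mulrCA.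
  under [RHS]eq_bigr => k _ do rewrite st mulr_sumr.
  rewrite exchange_big FS /=; apply: eq_bigr => h _.
  rewrite (IH d.+1) ?dR //; last exact: word_codeS.
  by rewrite mulr_sumr; apply: eq_bigr => k _; rewrite mulrCA.
(* Expand the free index [l] as well, exchange the two forms that have appeared, and recombine: the
   roles of [a] and [l] are then interchanged. *)
have Fswap a s d al i l : word_code q d al -> (d + size s = R)%N ->
    F (a :: s) al i l = F (l :: s) al i a.
  move=> va dR; rewrite !FS.
  under eq_bigr => k _.
    rewrite (Frel _ d.+1) ?addSn ?dR //; last exact: word_codeS.
    rewrite mulr_sumr.
    under eq_bigr => h _ do rewrite (Fex _ d) // mulrCA.
    over.
  rewrite exchange_big /=; apply: eq_bigr => h _.
  rewrite -mulr_sumr; congr (_ * _).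
  by rewrite [RHS](Frel _ d.+1) ?addSn ?dR //; apply: word_codeS.
have Fsym s : forall d al i l, word_code q d al -> (d + size s = R.+1)%N ->
    F s al i l = F s al l i.
  elim: s => [|a s IH] d al i l va /=; first by rewrite addn0 => dR; rewrite ?F0; apply: Bsym; rewrite -dR.
  rewrite addnS -addSn => dR; rewrite !FS; apply: eq_bigr => k _.
  by rewrite (IH d.+1) //; apply: word_codeS.
have Fin s1 : forall a b s2 al i l,
    F (s1 ++ a :: b :: s2) al i l = F (s1 ++ b :: a :: s2) al i l.
  elim: s1 => [|x s1 IH] a b s2 al i l /=; rewrite !FS; last first.
    by apply: eq_bigr => k _; rewrite IH.
  under eq_bigr => k _ do rewrite FS mulr_sumr.
  rewrite exchange_big /=; apply: eq_bigr => h _.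
  by rewrite FS mulr_sumr; apply: eq_bigr => k _; rewrite mulrCA addnAC.
have Fbool s : forall d al i, word_code q d al -> (d + size s = R.+1)%N ->
    F s al i i = F s al i ord0.
  elim: s => [|a s IH] d al i va /=.
    by rewrite addn0 => dR; rewrite !F0 Bbool // -dR.
  rewrite addnS -addSn => dR; rewrite !FS; apply: eq_bigr => k _.
  by rewrite (IH d.+1) //; apply: word_codeS.
have Feqs e s : Eqs e -> forall d al, word_code q d al -> (d + size s = R.+1)%N ->
    \sum_i \sum_j e i j * F s al i j = 0.
  move=> Ee; elim: s => [|a s IH] d al va /=.
    rewrite addn0 => dR; under eq_bigr => i _ do under eq_bigr => j _ do rewrite F0.
    by apply: Beqs; rewrite -?dR.
  rewrite addnS -addSn => dR.
  transitivity (\sum_k c a k * \sum_i \sum_j e i j * F s (al + q k)%N i j); last first.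
    by apply: big1 => k _; rewrite (IH d.+1) ?mulr0 //; apply: word_codeS.
  under [RHS]eq_bigr => k _ do rewrite mulr_sumr.
  rewrite [RHS]exchange_big /=; apply: eq_bigr => i _.
  under [RHS]eq_bigr => k _ do rewrite mulr_sumr.
  rewrite [RHS]exchange_big /=; apply: eq_bigr => j _.
  by rewrite FS mulr_sumr; apply: eq_bigr => k _; rewrite mulrCA.
have FA (w : 'rV_N.+1) s : w *m A = 0 -> forall d al i, word_code q d al ->
    (d + size s = R.+1)%N -> \sum_l w 0 l * F s al i l = 0.
  move=> wA; elim: s => [|a s IH] d al i va /=.
    rewrite addn0 => dR; under eq_bigr => l _ do rewrite F0.
    by apply: BA; rewrite -?dR.
  rewrite addnS -addSn => dR.
  transitivity (\sum_k c a k * \sum_l w 0 l * F s (al + q k)%N i l); last first.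
    by apply: big1 => k _; rewrite (IH d.+1) ?mulr0 //; apply: word_codeS.
  under [RHS]eq_bigr => k _ do rewrite mulr_sumr.
  rewrite [RHS]exchange_big /=; apply: eq_bigr => l _.
  by rewrite FS mulr_sumr; apply: eq_bigr => k _; rewrite mulrCA.
have v0 : word_code q 0 0 by exists [::]; rewrite ?big_nil.
pose Psi (s : seq 'I_N.+1) := if s is l :: i :: s' then F s' 0%N i l else 0.
apply: (@boolean_point_of_tensor K N R.+1 Eqs Psi (kermx A)).
- case=> [|x [|y s1]] a b s2 /= [] sz.
  + by rewrite (Fsym _ 0%N).
  + move: sz => [] sz.
    by rewrite (Fswap _ _ 0%N) ?(Fsym _ 0%N _ a) ?(Fswap x _ 0%N) /= ?sz.
  + exact: Fin.
- by move=> i s sz /=; rewrite (Fbool _ 0%N) // (Fsym _ 0%N).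
- move=> e s Ee sz; rewrite -[RHS](Feqs e s Ee _ _ v0 sz).
  apply: eq_bigr => i _; apply: eq_bigr => j _; congr (_ * _).
  by rewrite /= (Fsym _ 0%N).
- by move=> w [|i s] // /sub_kermxP wA [] sz /=; apply: (FA _ _ wA 0%N).
- by rewrite mxrank_ker -leq_subLR subKn ?rank_leq_row // (leq_trans (rank_leq_col _)).
case: (boolP [exists s : R.+3.-tuple 'I_N.+1, Psi s != 0]) => [/existsP[s]|/existsPn none].
  by exists (s : seq _); rewrite ?size_tuple.
have {}none s i l : size s = R.+1 -> F s 0%N i l = 0.
  move=> /eqP sz; have sz' : size (l :: i :: s) == R.+3 by [].
  by have := none (Tuple sz'); rewrite negbK => /eqP.
(* If the tensor vanished, so would all moments. A letter of the word [w] is traded for one more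
   expanded index (expand [l], exchange, swap) until [w] is empty and [none] applies. *)
suff Fz w : forall s i l, (size w + size s)%N = R.+1 -> F s (\sum_(k <- w) q k)%N i l = 0.
  have [al [i [l [[w sw ->] /eqP[]]]]] := Bnz.
  by rewrite -F0 Fz // addn0.
elim: w => [|k w IH] s i l; first by rewrite big_nil; apply: none.
rewrite big_cons addSn => -[] sz; set al := (\sum_(_ <- _) _)%N.
have va : word_code q (size w) al by exists w.
rewrite addnC (Frel _ (size w).+1) ?addSn ?sz //; last exact: word_codeS.
under eq_bigr => h _ do rewrite (Fex _ (size w)) // mulr_sumr.
rewrite exchange_big /= big1 // => m _.
under eq_bigr => h _ do rewrite mulrCA.
rewrite -mulr_sumr -FS (Fswap _ _ (size w)) // IH ?mulr0 //= addnS sz //.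
Qed.

(** * Rank condensation by twisted moments *)

(** Vandermonde on a subset of the nodes: the polynomial vanishing at the nodes of [M] other than
    that of [m0] has degree below [r], so pairing it with the moments isolates [psi m0]. *)
Lemma vanishing_moments (F : fieldType) (n r : nat) (y psi : 'I_n -> F) (M : {set 'I_n}) :
  injective y -> (#|M| <= r)%N ->
  (forall k, (k < r)%N -> \sum_(m in M) y m ^+ k * psi m = 0) ->
  forall m, m \in M -> psi m = 0.
Proof.
move=> yinj Mr mom m0 m0M.
pose Q := \prod_(m <- enum (M :\ m0)) ('X - (y m)%:P).
have szQ : (size Q <= r)%N.
  by rewrite size_prod_XsubC -cardE (leq_trans _ Mr) // (cardsD1 m0 M) m0M.
have : \sum_(m in M) Q.[y m] * psi m = 0.
  under eq_bigr => m _ do rewrite (horner_coef_wide _ szQ) mulr_suml.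
  rewrite exchange_big big1 //= => k _.
  under eq_bigr => m _ do rewrite -mulrA.
  by rewrite -mulr_sumr mom ?mulr0.
rewrite (bigD1 m0) //= [X in _ + X]big1 ?addr0; last first.
  move=> m /andP[mM nm]; have mi : m \in enum (M :\ m0) by rewrite mem_enum in_setD1 nm.
  rewrite /Q (big_rem m mi) /=.
  by rewrite hornerM hornerXsubC subrr !mul0r.
move/eqP; rewrite mulf_eq0 => /orP[|/eqP //].
rewrite /Q horner_prod prodf_seq_eq0 => /hasP[m]; rewrite mem_enum => mM.
rewrite hornerXsubC subr_eq0 => /eqP/yinj e.
by move: mM; rewrite e in_setD1 eqxx.
Qed.

(** For [x = 2] column [k] is the form $y_{k+1}$ applied to the rows of [E], since
    $(2^m)^k=(2^k)^m$. Without the factor ['X^m] the determinant could vanish for some [E] of full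
    rank. *)
Definition twisted_moments (F : fieldType) (n r : nat) (x : F) (E : 'M[F]_(r, n)) :
    'M[{poly F}]_r :=
  \matrix_(i, k) \sum_m (E i m * (x ^+ m) ^+ k)%:P * 'X^m.

(* In a kernel vector v put f_m = v . (column m of E).  The columns m for which
   deg f_m + m is maximal have f_m of distinct degrees, hence are linearly
   independent, so there are at most r of them; the top coefficients of f at
   these columns have vanishing moments of order < r at the nodes x^m. *)
Lemma det_twisted_moments (F : fieldType) (n r : nat) (x : F) (E : 'M[F]_(r, n)) :
  injective (fun m : 'I_n => x ^+ m) -> row_free E ->
  \det (twisted_moments x E) != 0.
Proof.
move=> xinj Efree; apply/negP => /det0P[v vn0 vA].
pose f (m : 'I_n) := \sum_i v 0 i * (E i m)%:P.
have vAk (k : 'I_r) : \sum_m f m * (((x ^+ m) ^+ k)%:P * 'X^m) = 0.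
  have := congr1 (fun A : 'rV_r => A 0 k) vA; rewrite !mxE => {2}<-.
  under eq_bigr => m _ do rewrite mulr_suml.
  rewrite exchange_big /=; apply: eq_bigr => i _; rewrite mxE mulr_sumr.
  by apply: eq_bigr => m _; rewrite polyCM !mulrA.
have [m1 fm1] : exists m, f m != 0.
  apply/existsP; apply: contraNT vn0 => /existsPn f0.
  apply/eqP/rowP => i; rewrite mxE; apply/polyP => s; rewrite coef0.
  pose vs : 'rV[F]_r := \row_i (v 0 i)`_s.
  suff /(row_free_inj Efree)/rowP/(_ i) : mulmxr E vs = mulmxr E 0 by rewrite !mxE.
  rewrite /= mul0mx; apply/rowP => m; rewrite !mxE.
  have := f0 m; rewrite negbK => /eqP/(congr1 (fun P : {poly F} => P`_s)).
  rewrite coef0 coef_sum => {2}<-; apply: eq_bigr => j _.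
  by rewrite mxE coefMC.
have [mt fmt tmax] := @arg_maxnP _ m1 (fun m => f m != 0) (fun m => size (f m) + m)%N fm1.
set t := (size (f mt) + mt)%N in tmax.
pose M := [set m | (f m != 0) && ((size (f m) + m)%N == t)].
have szM m : m \in M -> ((size (f m)).-1 = t.-1 - m)%N /\ (m <= t.-1)%N.
  rewrite inE -size_poly_gt0 => /andP[fm /eqP <-].
  by case: (size (f m)) fm => // d _; rewrite addSn /= addnK leq_addl.
have cardM : (#|M| <= r)%N.
  rewrite leqNgt; apply/negP => rM.
  pose L : 'M[F]_(#|M|, r) := \matrix_(a, i) E i (enum_val a).
  have : kermx L != 0.
    rewrite -mxrank_eq0 mxrank_ker -lt0n subn_gt0.
    exact: leq_ltn_trans (rank_leq_col _) rM.
  case/rowV0Pn => la /sub_kermxP laL /rV0Pn[a1 la1].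
  have lf : \sum_a (la 0 a)%:P * f (enum_val a) = 0.
    under eq_bigr => a _ do rewrite mulr_sumr.
    rewrite exchange_big big1 //= => i _.
    have := congr1 (fun A : 'rV_r => A 0 i) laL; rewrite !mxE => e.
    transitivity (v 0 i * (\sum_a la 0 a * E i (enum_val a))%:P).
      rewrite raddf_sum mulr_sumr; apply: eq_bigr => a _.
      by rewrite /= polyCM mulrCA.
    suff -> : \sum_a la 0 a * E i (enum_val a) = 0 by rewrite mulr0.
    by rewrite -[RHS]e; apply: eq_bigr => a _; rewrite mxE.
  (* On [M] the degree of $f_m$ is $t-1-m$, so the smallest index in the relation has strictly the
     largest degree and its leading term cannot cancel. *)
  have [a0 la0 amin] := @arg_minnP _ a1 (fun a => la 0 a != 0) (fun a => enum_val a : nat) la1.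
  have := congr1 (fun P : {poly F} => P`_(size (f (enum_val a0))).-1) lf.
  rewrite coef0 coef_sum (bigD1 a0) //= coefCM big1 ?addr0.
    move/eqP; rewrite mulf_eq0 (negPf la0) /= -lead_coefE lead_coef_eq0.
    by have := enum_valP a0; rewrite inE => /andP[/negPf->].
  move=> a aa0; rewrite coefCM; have [->|la_a] := eqVneq (la 0 a) 0; first by rewrite mul0r.
  rewrite [X in _ * X]nth_default ?mulr0 //.
  have := amin _ la_a; rewrite leq_eqVlt => /orP[/eqP/val_inj/enum_val_inj e|].
    by rewrite e eqxx in aa0.
  have [-> l0] := szM _ (enum_valP a0); have [] := szM _ (enum_valP a).
  have : (0 < size (f (enum_val a)))%N.
    by have := enum_valP a; rewrite inE size_poly_gt0 => /andP[].
  by case: (size _) => // d _ /= -> l1 lt; rewrite ltn_sub2l // (leq_trans lt).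
have mt_M : mt \in M by rewrite inE fmt eqxx.
have lead0 := @vanishing_moments F n r (fun m => x ^+ m) (fun m => lead_coef (f m)) M xinj cardM _ mt mt_M.
case/eqP: fmt; apply/eqP; rewrite -lead_coef_eq0; apply/eqP; apply: lead0 => k kr.
(* In degree $t-1$ only the columns of [M] contribute, each with its leading coefficient; for the
   others $f_m\tau^m$, with $\tau$ the variable, is zero or of smaller degree. *)
have := congr1 (fun P : {poly F} => P`_t.-1) (vAk (Ordinal kr)).
rewrite coef0 coef_sum => {2}<- /=; rewrite big_mkcond /=; apply: eq_bigr => m _.
rewrite mulrA coefMXn coefMC; case: ifP => mM.
  have [e l] := szM _ mM; rewrite ltnNge l /= mulrC; congr (_ * _).
  by rewrite lead_coefE e.
case: ltnP => // mt1; have [->|fm0] := eqVneq (f m) 0; first by rewrite coef0 mul0r.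
rewrite nth_default ?mul0r //; have := tmax m fm0.
rewrite /geq /= leq_eqVlt => /orP[e|]; first by rewrite inE fm0 e in mM.
by case: (t) mt1 => // t'; rewrite ltnS /= => mt1; rewrite leq_subRL // addnC.
Qed.

(** The base-[N] digits of the code of a monomial are its exponents, as long as the degree is below
    [N]. The form $y_0$ gets code 0 because it stands for 1. *)
Definition var_code (N k : nat) : nat := if k is k'.+1 then (N ^ k')%N else 0%N.
(** With $0^0=1$ the node 0 turns $y_0$ into $b_0$. *)
Definition node (k : nat) : nat := if k is k'.+1 then (2 ^ k')%N else 0%N.

(** The table [L] over [F] is packed into polynomials, because the coefficients expressing
    coordinates through the forms exist only over the fraction field. Since [F] embeds in that
    field, a Boolean point found there satisfies the original equations. The monomials have degree
    [R.+1] here, and those at positions below [cp] have degree [R]. *)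
Lemma boolean_point_of_coefficients (F : fieldType) (N R cp Dn Ds : nat)
    (T : seq nat) (L : nat -> nat -> nat -> nat -> F)
    (rows : nat) (X : 'M[F]_(rows, N.+1)) (row_of : nat -> nat -> nat -> 'I_rows)
    (Eqs : ('I_N.+1 -> 'I_N.+1 -> F) -> Prop) :
  injective (fun m : 'I_N.+1 => (2 ^ m)%:R : F) ->
  (Dn + N <= Ds)%N ->
  (forall al, word_code (fun k : 'I_R.+2 => var_code N k) R.+1 al -> al \in T) ->
  (forall al, word_code (fun k : 'I_R.+2 => var_code N k) R al ->
     (index al T < cp)%N) ->
  (forall x s i l, (x < size T)%N -> (s < Dn)%N -> (i <= N)%N -> (l <= N)%N ->
     L x s i l = L x s l (if i == l then 0%N else i)) ->
  (forall e x s, Eqs e -> (x < size T)%N -> (s < Dn)%N ->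
     \sum_(i < N.+1) \sum_(j < N.+1) e i j * L x s i j = 0) ->
  (forall x s j k i, (x < cp)%N -> (s < Ds)%N -> (j < R.+2)%N -> (k < R.+2)%N ->
     (i <= N)%N ->
     let term a b m := if (m <= s)%N && (s - m < Dn)%N
       then (node a)%:R ^+ m
              * L (index (nth 0%N T x + var_code N b)%N T) (s - m)%N i m
       else 0 in
     \sum_(m < N.+1) term j k m = \sum_(m < N.+1) term k j m) ->
  (forall x s i (l : 'I_N.+1), (x < size T)%N -> (s < Dn)%N -> (i <= N)%N ->
     X (row_of x s i) l = L x s i l) ->
  (\rank X <= R.+1)%N ->
  (exists x s i l, [/\ (x < size T)%N, (s < Dn)%N, (i <= N)%N, (l <= N)%N
     & L x s i l != 0 /\ word_code (fun k : 'I_R.+2 => var_code N k) R.+1 (nth 0%N T x)]) ->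
  uniq T ->
  exists2 b : 'I_N.+1 -> bool, b ord0
    & forall e, Eqs e -> \sum_i \sum_j e i j * (b i)%:R * (b j)%:R = 0.
Proof.
move=> inj2 DsE Tall Tcp Lsym Leqs Lex LX rkX [x0 [s0 [i0 [l0 [x0T s0D i0N l0N [Lnz wx0]]]]]] uT.
pose q (k : 'I_R.+2) := var_code N k.
pose r := \rank X.
have [Cb [E [XE Efree]]] : exists (Cb : 'M_(rows, r)) (E : 'M_(r, N.+1)), X = Cb *m E /\ row_free E.
  by exists (col_base X), (row_base X); rewrite mulmx_base row_base_free.
pose phi (a : F) : {fraction {poly F}} := tofrac a%:P.
pose EK : 'M_(r, N.+1) := map_mx phi E.
pose TM := map_mx (@tofrac _) (twisted_moments 2%:R E).
have TMunit : TM \in unitmx.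
  rewrite unitmxE det_map_mx unitfE tofrac_eq0.
  apply: det_twisted_moments; last exact: Efree.
  by move=> a b /=; rewrite -!natrX; apply: inj2.
(* A row of moments is [D *m EK] for some [D], and its pairings with $y_1,\ldots,y_r$ form
   [D *m TM]; hence [G] recovers the row from the pairings. In [c], row [h] of [G] belongs to the
   form [h.+1], and all other forms get coefficient 0. *)
pose G := invmx TM *m EK.
pose c (l : 'I_N.+1) (k : 'I_R.+2) : {fraction {poly F}} :=
  \sum_(h < r | h.+1 == k) G h l.
pose P al i l : {poly F} := \poly_(s < Dn) L (index al T) s i l.
pose B al (i l : 'I_N.+1) : {fraction {poly F}} := tofrac (P al i l).
pose g (k : 'I_R.+2) (m : 'I_N.+1) : {fraction {poly F}} :=
  tofrac (((node k)%:R ^+ m)%:P * 'X^m).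
pose EqsK e := exists2 e0, Eqs e0 & forall i j, e i j = phi (e0 i j).
have idx al : word_code q R.+1 al -> (index al T < size T)%N.
  by move=> /Tall; rewrite index_mem.
have BE al i : word_code q R.+1 al ->
    exists D : 'rV_r, forall l, B al i l = (D *m EK) 0 l.
  move=> wal; exists (\row_t \sum_(s < Dn) phi (Cb (row_of (index al T) s i) t) * tofrac ('X^s)).
  move=> l; rewrite mxE /B /P poly_def raddf_sum.
  have LE (s : 'I_Dn) : tofrac (L (index al T) s i l *: 'X^s)
      = \sum_t tofrac ((Cb (row_of (index al T) s i) t * E t l) *: 'X^s).
    rewrite -LX ?idx ?leq_ord // -raddf_sum -scaler_suml; congr tofrac; congr (_ *: _).
    by rewrite [in LHS]XE mxE.
  rewrite (eq_bigr _ (fun s _ => LE s)).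
  rewrite exchange_big /=; apply: eq_bigr => t _; rewrite !mxE mulr_suml.
  apply: eq_bigr => s _.
  by rewrite -mul_polyC polyCM !tofracM mulrAC.
have [] := @boolean_point_of_moments _ N R R.+2 c q B g r EK^T EqsK.
- exact: rkX.
- move=> al i l wal; congr tofrac; apply/polyP => s; rewrite !coef_poly.
  case: ltnP => // sD; rewrite Lsym ?idx ?leq_ord //.
  by case: eqP => // e; rewrite [in RHS]Lsym ?idx ?leq_ord // -e eqxx.
- move=> al i wal; congr tofrac; apply/polyP => s; rewrite !coef_poly.
  by case: ltnP => // sD; rewrite Lsym ?idx ?leq_ord // eqxx.
- move=> e al [e0 Ee0 ee0] wal.
  transitivity (tofrac (\poly_(s < Dn) \sum_(i < N.+1) \sum_(j < N.+1) e0 i j * L (index al T) s i j)).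
    rewrite poly_def.
    transitivity (tofrac (\sum_i \sum_j (e0 i j)%:P * P al i j)).
      rewrite raddf_sum; apply: eq_bigr => i _; rewrite raddf_sum.
      by apply: eq_bigr => j _; rewrite ee0 /= tofracM.
    congr tofrac.
    under [RHS]eq_bigr => s _ do rewrite scaler_suml.
    rewrite [RHS]exchange_big /=; apply: eq_bigr => i _.
    under [RHS]eq_bigr => s _ do rewrite scaler_suml.
    rewrite [RHS]exchange_big /=; apply: eq_bigr => j _.
    rewrite /P poly_def mulr_sumr; apply: eq_bigr => s _.
    by rewrite -!mul_polyC polyCM mulrA.
  rewrite (_ : \poly_(s < Dn) _ = 0) ?raddf0 //; apply/polyP => s.
  by rewrite coef_poly coef0; case: ltnP => // sD; rewrite Leqs ?idx.
- move=> al j k i wal.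
  transitivity (tofrac (\sum_(m < N.+1) ((node j)%:R ^+ m)%:P * 'X^m * P (al + q k)%N i m)).
    by rewrite raddf_sum; apply: eq_bigr => m _; rewrite /g /B -tofracM.
  transitivity (tofrac (\sum_(m < N.+1) ((node k)%:R ^+ m)%:P * 'X^m * P (al + q j)%N i m)); last first.
    by rewrite raddf_sum; apply: eq_bigr => m _; rewrite /g /B -tofracM.
  congr tofrac; apply/polyP => s; rewrite !coef_sum.
  have cf (a b : 'I_R.+2) (m : 'I_N.+1) : (((node a)%:R ^+ m)%:P * 'X^m * P (al + q b)%N i m)`_s
    = if (m <= s)%N && (s - m < Dn)%N then (node a)%:R ^+ m
              * L (index (al + q b)%N T) (s - m)%N i m else 0.
    rewrite -mulrA coefCM coefXnM coef_poly; case: ltnP => ms; first by rewrite mulr0.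
    by rewrite /=; case: ltnP => //; rewrite mulr0.
  under eq_bigr => m _ do rewrite cf.
  under [RHS]eq_bigr => m _ do rewrite cf.
  case: (ltnP s Ds) => sD.
    have xc := Tcp _ wal.
    have alT : al \in T by apply: Tall; rewrite -[al]addn0; apply: (@word_codeS _ q _ _ ord0).
    have := Lex (index al T) s j k i xc sD (ltn_ord _) (ltn_ord _) (leq_ord _).
    by rewrite /= nth_index.
  (* From degree [Ds] on both sides are zero for degree reasons, so finitely many stored relations
     give an identity of polynomials. *)
  have far (m : 'I_N.+1) : (m <= s)%N && (s - m < Dn)%N = false.
    apply/negbTE; rewrite negb_and -leqNgt; case: leqP => //= ms.
    by rewrite leq_subRL // (leq_trans _ (leq_trans DsE sD)) // addnC leq_add2l leq_ord.
  by rewrite !big1 // => m _; rewrite far.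
- move=> al i l wal; have [D BD] := BE al i wal.
  have cols (h : 'I_r) (k : 'I_R.+2) : h.+1 == k ->
      \sum_m g k m * B al i m = (D *m TM) 0 h.
    move=> /eqP hk.
    transitivity (\sum_m \sum_t D 0 t * EK t m * g k m).
      by apply: eq_bigr => m _; rewrite BD mxE mulrC mulr_suml.
    rewrite exchange_big mxE /=; apply: eq_bigr => t _.
    rewrite !mxE raddf_sum mulr_sumr; apply: eq_bigr => m _.
    rewrite /g -hk /= !mxE -mulrA -tofracM; congr (_ * tofrac _).
    by rewrite natrX exprAC mulrA polyCM.
  transitivity (\sum_(h < r) (D *m TM) 0 h * G h l).
    have DG : D *m EK = D *m TM *m G by rewrite /G -[in RHS]mulmxA mulKVmx.
    by rewrite BD DG mxE.
  under [RHS]eq_bigr => k _ do rewrite mulr_suml.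
  rewrite (exchange_big_dep xpredT) //=; apply: eq_bigr => h _.
  have hR : (h.+1 < R.+2)%N by rewrite ltnS (leq_trans (ltn_ord h)).
  rewrite (bigD1 (Ordinal hR)) //= (cols h) // mulrC big1 ?addr0 // => k /andP[/eqP e].
  by case/eqP; apply: val_inj; rewrite /= e.
- move=> w al i wE wal; have [D BD] := BE al i wal.
  transitivity ((w *m EK^T *m D^T) 0 0); last by rewrite wE mul0mx mxE.
  rewrite -mulmxA -trmx_mul mxE; apply: eq_bigr => l _.
  by rewrite BD [in RHS]mxE.
- exists (nth 0%N T x0), (inord i0), (inord l0); split => //.
  rewrite tofrac_eq0; apply: contraNneq Lnz => /(congr1 (fun P : {poly F} => P`_s0)).
  by rewrite coef0 coef_poly s0D index_uniq // !inordK // => ->.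
move=> b b0 be; exists b => // e Ee.
have /be : EqsK (fun i j => phi (e i j)) by exists e.
move=> h; apply/eqP; rewrite -polyC_eq0 -tofrac_eq0 -[X in _ == X]h.
apply/eqP; rewrite raddf_sum raddf_sum; apply: eq_bigr => i _.
rewrite raddf_sum raddf_sum; apply: eq_bigr => j _.
by rewrite /= !polyCM !tofracM; case: (b i); case: (b j); rewrite ?tofrac1 ?tofrac0.
Qed.

(** * Polynomial time bounds and accumulators *)

Local Close Scope ring_scope.

Definition pb (I : Type) (D : I -> Prop) (X f : I -> nat) : Prop :=
  exists c d, forall i, D i -> f i <= c * (X i).+1 ^ d.

Lemma pb_le I D (X f g : I -> nat) :
  (forall i, D i -> f i <= g i) -> pb D X g -> pb D X f.
Proof. by move=> fg [c [d h]]; exists c, d => i Di; apply: leq_trans (fg i Di) (h i Di). Qed.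

Lemma pb_const I D (X : I -> nat) n : pb D X (fun=> n).
Proof. by exists n, 0 => i _; rewrite expn0 muln1. Qed.

Lemma pb_size I D (X : I -> nat) : pb D X X.
Proof. by exists 1, 1 => i _; rewrite mul1n expn1. Qed.

Lemma pb_add I D (X f g : I -> nat) : pb D X f -> pb D X g -> pb D X (fun i => f i + g i).
Proof.
move=> [c [d h]] [c' [d' h']]; exists (c + c'), (d + d') => i Di.
rewrite mulnDl leq_add //.
  by apply: leq_trans (h i Di) _; rewrite leq_mul2l leq_pexp2l ?leq_addr ?orbT.
by apply: leq_trans (h' i Di) _; rewrite leq_mul2l leq_pexp2l ?leq_addl ?orbT.
Qed.

Lemma pb_mul I D (X f g : I -> nat) : pb D X f -> pb D X g -> pb D X (fun i => f i * g i).
Proof.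
move=> [c [d h]] [c' [d' h']]; exists (c * c'), (d + d') => i Di.
by rewrite expnD mulnACA leq_mul ?h ?h'.
Qed.

Lemma pb_exp I D (X f : I -> nat) n : pb D X f -> pb D X (fun i => f i ^ n).
Proof.
move=> [c [d h]]; exists (c ^ n), (d * n) => i Di.
by rewrite expnM -expnMn; case: n => // n; rewrite leq_exp2r ?h.
Qed.

Lemma pb_S I D (X f : I -> nat) : pb D X f -> pb D X (fun i => (f i).+1).
Proof.
by move=> hf; apply: pb_le (pb_add hf (pb_const D X 1)) => i _; rewrite addn1.
Qed.

Definition pbounded (I : Type) (D : I -> Prop) (X : I -> nat) (s : I -> state) : Prop :=
  exists2 B, pb D X B & forall i, D i -> bounded (s i) (B i).

Definition pexec (I : Type) (D : I -> Prop) (X : I -> nat) (P : prog) (s s' : I -> state) : Prop :=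
  exists2 T, pb D X T
    & forall i, D i -> exists2 t, exec P (s i) (s' i) t & t <= T i.

Lemma pexec_seq I D (X : I -> nat) P Q s s' s'' :
  pexec D X P s s' -> pexec D X Q s' s'' -> pexec D X (Seq P Q) s s''.
Proof.
move=> [T pT hT] [T' pT' hT']; exists (fun i => T i + T' i); first exact: pb_add.
move=> i Di; have [t e l] := hT i Di; have [t' e' l'] := hT' i Di.
by exists (t + t'); [apply: ExecSeq e e'|apply: leq_add].
Qed.

Lemma pexec_compile ro c I D (X : I -> nat) s :
  wf ro c -> pbounded D X s -> pb D X (fun i => steps c (s i)) ->
  pbounded D X (fun i => run c (s i)) /\ pexec D X (compile c) s (fun i => run c (s i)).
Proof.
move=> /exec_compile[k hk] [B pB hB] pst.
have pBB : pb D X (fun i => B i + k * steps c (s i) * B i).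
  by apply: pb_add => //; apply: pb_mul => //; apply: pb_mul => //; apply: pb_const.
split.
  by eexists; first exact: pBB; move=> i Di; have [] := hk (s i) (s i) _ _ (fun _ _ _ => erefl) (hB i Di) (hB i Di).
exists (fun i => k * steps c (s i) * (B i + k * steps c (s i) * B i) ^ 2).
  by apply: pb_mul; [apply: pb_mul => //; apply: pb_const|apply: pb_exp].
by move=> i Di; have [_ [t e l]] := hk (s i) (s i) _ _ (fun _ _ _ => erefl) (hB i Di) (hB i Di); exists t.
Qed.

(** Commands whose only effect beside their loop counters is to add to output cells modulo p. They
    never look at the accumulated values, so such a command is described by the total that it adds
    to each cell. *)
Inductive acmd :=
  | AAcc (ad v : expr)
  | ASeq (c1 c2 : acmd)
  | AIf (e : expr) (c1 c2 : acmd)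
  | AFor (x : nat) (e : expr) (c : acmd)
  | ASkip.

(* 1 + (p - 1) makes it syntactically visible that the modulus is positive. *)
Definition modulus : expr :=
  Op Add (Const 1) (Op Defs.Sub (Get 0 (Const 2)) (Const 1)).

Fixpoint acc (c : acmd) : cmd :=
  match c with
  | AAcc ad v => CAssign 1 ad (Op Mod (Op Add (Get 1 ad) v) modulus)
  | ASeq c1 c2 => CSeq (acc c1) (acc c2)
  | AIf e c1 c2 => CIf e (acc c1) (acc c2)
  | AFor x e c => CFor x e (acc c)
  | ASkip => CSkip
  end.

Fixpoint accf (c : acmd) (s : state) (a : nat) : nat :=
  match c with
  | AAcc ad v => if eval ad s == a then eval v s else 0
  | ASeq c1 c2 => accf c1 s a + accf c2 s a
  | AIf e c1 c2 => if eval e s != 0 then accf c1 s a else accf c2 s a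
  | AFor x e c => \sum_(i < eval e s) accf c (update s x 0 i) a
  | ASkip => 0
  end.

(** Of a loop bank in [LV] only the counter in cell 0 may be read: [accf] does not model the loop
    bound kept in cell 1. *)
Fixpoint reads (V LV : seq nat) (e : expr) : bool :=
  match e with
  | Const _ => true
  | Get a e => ((a \in V) && reads V LV e)
      || ((a \in LV) && (if e is Const 0 then true else false))
  | Op _ e1 e2 => reads V LV e1 && reads V LV e2
  end.

Fixpoint asafe (V LV : seq nat) (c : acmd) : bool :=
  match c with
  | AAcc ad v => reads V LV ad && reads V LV v
  | ASeq c1 c2 => asafe V LV c1 && asafe V LV c2
  | AIf e c1 c2 => [&& reads V LV e, asafe V LV c1 & asafe V LV c2]
  | AFor x e c =>
      [&& reads V LV e, x \notin V, x \notin LV, x != 1 & asafe V (x :: LV) c]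
  | ASkip => true
  end.

Definition agree_vars (V LV : seq nat) (s s' : state) : Prop :=
  (forall a i, a \in V -> s a i = s' a i) /\ (forall a, a \in LV -> s a 0 = s' a 0).

Lemma eval_reads V LV e s s' : reads V LV e -> agree_vars V LV s s' -> eval e s = eval e s'.
Proof.
move=> + [ag agl]; elim: e => [n|a e IH|o e1 IH1 e2 IH2] //=.
  case/orP => /andP[aV]; first by move=> /IH ->; apply: ag.
  by case: e {IH} => // -[] // _ /=; apply: agl.
by case/andP => /IH1 -> /IH2 ->.
Qed.

Lemma acc_keeps V LV c s s' : 1 \notin V -> 1 \notin LV -> asafe V LV c ->
  agree_vars V LV s s' -> agree_vars V LV (run (acc c) s) s'.
Proof.
move=> V1.
elim: c LV s s' => [ad v|c1 IH1 c2 IH2|e c1 IH1 c2 IH2|x e c IH|] LV s s' L1 //=.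
- move=> _ [ag agl]; split=> [a i aV|a aL].
    by rewrite update_bank ?ag //; apply: contraNneq V1 => <-.
  by rewrite update_bank ?agl //; apply: contraNneq L1 => <-.
- by case/andP => s1 s2 h; apply: IH2 => //; apply: IH1.
- by case/and3P => _ s1 s2 h; case: ifP => _; [apply: IH1|apply: IH2].
case/and5P => _ xV xL x1 sc [ag agl].
elim: {1}(eval e s) => [|n IHn] /=.
  split=> [a i aV|a aL].
    have ax : a != x by apply: contraNneq xV => <-.
    by rewrite !update_bank ?ag.
  have ax : a != x by apply: contraNneq xL => <-.
  by rewrite !update_bank ?agl.
set t := iter _ _ _ in IHn *.
have [h1 h2] : agree_vars V (x :: LV) (run (acc c) t) (update s' x 0 (t x 0)).
  apply: IH => //; first by rewrite inE negb_or eq_sym x1.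
  split=> [a i aV|a].
    by rewrite update_bank ?IHn.1 //; apply: contraNneq xV => <-.
  rewrite inE; case: eqVneq => [-> _|ax /= aL]; first by rewrite updateE.
  by rewrite update_bank // IHn.2.
split=> [a i aV|a aL].
  have ax : a != x by apply: contraNneq xV => <-.
  by rewrite update_bank // h1 // update_bank.
have ax : a != x by apply: contraNneq xL => <-.
by rewrite update_bank // h2 ?inE ?aL ?orbT // update_bank.
Qed.

(** Nothing that [c] adds depends on bank 1, so the contributions may be summed as integers and
    reduced once. The state [s] is the actual one; [s'] only has to agree with it on the banks that
    [c] may read. *)
Lemma run_acc ro V LV c s s' a : 0 \in V -> 1 \notin V -> 1 \notin LV -> asafe V LV c ->
  wf ro (acc c) -> agree_vars V LV s s' -> 0 < s' 0 2 -> s 1 a < s' 0 2 ->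
  run (acc c) s 1 a = (s 1 a + accf c s' a) %% s' 0 2.
Proof.
move=> V0 V1.
elim: c LV s s' => [ad v|c1 IH1 c2 IH2|e c1 IH1 c2 IH2|x e c IH|] LV s s' L1 /=.
- case/andP => rad rv _ h p0 sp; rewrite /= (eval_reads rad h) (eval_reads rv h) (h.1 0 2) //.
  rewrite subnKC //; have [e|ne] := eqVneq (eval ad s') a; first by rewrite e updateE.
  by rewrite addn0 [RHS]modn_small // update_cell // eq_sym.
- case/andP => s1 s2 /andP[w1 w2] h p0 sp; rewrite (IH2 LV _ s') //.
  + by rewrite (IH1 LV _ s') // modnDml addnA.
  + exact: acc_keeps h.
  + by rewrite (IH1 LV _ s') // ltn_pmod.
- case/and3P => re s1 s2 /andP[w1 w2] h p0 sp; rewrite (eval_reads re h).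
  by case: ifP => _; [apply: IH1 h _ _|apply: IH2 h _ _].
- case/and5P => re xV xL x1 sc /and4P[_ xc _ wc] h p0 sp.
  rewrite (eval_reads re h); set n := eval e s'; set s1 := update _ _ _ _.
  set f := fun s => _.
  have K j : [/\ agree_vars V LV (iter j f s1) s', iter j f s1 x 0 = j
      & iter j f s1 1 a = (s 1 a + \sum_(i < j) accf c (update s' x 0 i) a) %% s' 0 2].
    elim: j => [|j [ag xj vj]] /=.
      split; last by rewrite big_ord0 addn0 /s1 !update_bank 1?eq_sym // modn_small.
        split=> [b i bV|b bL].
          have bx : b != x by apply: contraNneq xV => <-.
          by rewrite /s1 !update_bank ?h.1.
        have bx : b != x by apply: contraNneq xL => <-.
        by rewrite /s1 !update_bank ?h.2.
      by rewrite /s1 updateE.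
    set t := iter j f s1 in ag xj vj *.
    have x1L : 1 \notin x :: LV by rewrite inE negb_or eq_sym x1.
    have agx : agree_vars V (x :: LV) t (update s' x 0 j).
      split=> [b i bV|b].
        by rewrite update_bank ?ag.1 //; apply: contraNneq xV => <-.
      rewrite inE; case: eqVneq => [-> _|bx /= bL]; first by rewrite updateE.
      by rewrite update_bank // ag.2.
    have [h1 h2] := acc_keeps V1 x1L sc agx.
    have x0 : x != 0 by apply: contraNneq xV => ->.
    split.
    + split=> [b i bV|b bL].
        have bx : b != x by apply: contraNneq xV => <-.
        by rewrite /f update_bank // h1 // update_bank.
      have bx : b != x by apply: contraNneq xL => <-.
      by rewrite /f update_bank // h2 ?inE ?bL ?orbT // update_bank.
    + by rewrite /f updateE run_frame // xj addn1.
    rewrite /f update_bank 1?eq_sym // (IH _ _ (update s' x 0 j) x1L) //.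
    + by rewrite update_bank 1?eq_sym // vj modnDml -addnA big_ord_recr.
    + by rewrite update_bank 1?eq_sym.
    by rewrite update_bank 1?eq_sym // vj ltn_pmod.
  by have [] := K n.
by move=> _ _ _ p0 sp; rewrite addn0 modn_small.
Qed.

(** * Preparatory phases of the programs *)

Lemma radix_inj n a b x y : x < n -> y < n -> a * n + x = b * n + y -> a = b /\ x = y.
Proof.
move=> xn yn e; have n0 : 0 < n by apply: leq_ltn_trans xn.
have : (a * n + x) %/ n = (b * n + y) %/ n by rewrite e.
rewrite !divnMDl // !divn_small // !addn0 => ab; split=> //.
by move: e; rewrite ab => /addnI.
Qed.

Notation form_code N R := (word_code (fun k : 'I_R.+1 => var_code N k)).

(** The exponents of $y_1,\ldots,y_R$ are R numbers of sum at most R, and there are $\binom{2R}{R}$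
    such tuples; the exponent of $y_0$, which the code does not show, takes up the slack. *)
Lemma size_form_codes N R d (T : seq nat) : d <= R -> uniq T ->
  (forall al, al \in T -> form_code N R d al) -> size T <= 'C(2 * R, R).
Proof.
move=> dR uT TW; rewrite mul2n -addnn -card_partial_ord_partitions.
set A := [set t | _].
pose f (t : R.-tuple 'I_R.+1) := \sum_(k < R) tnth t k * N ^ k.
rewrite cardE -(size_map f); apply: uniq_leq_size => // al /TW[w sw ->].
pose n (k : 'I_R) := count (fun h : 'I_R.+1 => h == k.+1 :> nat) w.
have nR k : n k < R.+1 by rewrite ltnS (leq_trans (count_size _ _)) // sw.
apply/mapP; exists [tuple (Ordinal (nR k)) | k < R].
  rewrite mem_enum inE big_tuple; under eq_bigr => k _ do rewrite tnth_mktuple /=.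
  have -> : \sum_(k < R) n k = \sum_(h <- w) \sum_(k < R | h == k.+1 :> nat) 1.
    by rewrite (exchange_big_dep xpredT) //=; apply: eq_bigr => k _; rewrite sum1_count.
  apply: leq_trans dR; rewrite -sw -sum1_size; apply: leq_sum => h _.
  case: (posnP h) => [-> | hp]; first by rewrite big1.
  have hR : h.-1 < R by have := ltn_ord h; lia.
  rewrite (bigD1 (Ordinal hR)) /=; last by rewrite prednK.
  rewrite big1 // => k /andP[/eqP e /eqP[]]; apply: val_inj => /=.
  by rewrite e.
rewrite /f; under [RHS]eq_bigr => k _ do rewrite tnth_mktuple /=.
transitivity (\sum_(h <- w) \sum_(k < R | h == k.+1 :> nat) N ^ k).
  apply: eq_bigr => h _; rewrite /var_code.
  have := ltn_ord h; case: (nat_of_ord h) => [|h'] hR; first by rewrite big1.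
  rewrite (bigD1 (Ordinal (hR : h' < R))) //= big1 ?addn0 // => k /andP[/eqP[e] /eqP[]].
  by apply: val_inj.
rewrite (exchange_big_dep xpredT) //=; apply: eq_bigr => k _.
by rewrite big_const_seq iter_addn_0 mulnC.
Qed.

Lemma bin_double_le R : 'C(2 * R, R) <= 4 ^ R.
Proof.
have := expnDn 1 1 (2 * R); rewrite expnM => ->.
by rewrite (bigD1 (inord R)) //= !exp1n !muln1 inordK ?leq_addr //.
Qed.

Lemma log_floor_exp N : 0 < N -> 2 ^ log_floor N <= N.
Proof. exact: trunc_logP. Qed.

Lemma log_floor_le N : log_floor N <= N.
Proof.
case: (posnP N) => [->|N0]; first by rewrite /log_floor trunc_log0.
by apply: leq_trans (log_floor_exp N0); rewrite ltnW // ltn_expl.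
Qed.

Lemma log_floor_gt0 N : 1 < N -> 0 < log_floor N.
Proof. by rewrite /log_floor trunc_log_gt0 /= => ?; lia. Qed.

(** The point where R has to be logarithmic: $4^R\le N^2$ keeps the number of monomials
    polynomial. *)
Lemma bin_log_le N : 0 < N -> 'C(2 * log_floor N, log_floor N) <= N ^ 2.
Proof.
move=> N0; apply: leq_trans (bin_double_le _) _.
by rewrite (_ : 4 = 2 ^ 2) // -expnM mulnC expnM leq_exp2r // log_floor_exp.
Qed.

Declare Scope expr_scope.
Delimit Scope expr_scope with E.
Bind Scope expr_scope with expr.
Notation "x + y" := (Op Add x y) : expr_scope.
Notation "x - y" := (Op Defs.Sub x y) : expr_scope.
Notation "x * y" := (Op Mul x y) : expr_scope.
Notation "x / y" := (Op Div x y) : expr_scope.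
Notation "x %% y" := (Op Mod x y) : expr_scope.
Notation "# n" := (Const n) (at level 5, format "# n") : expr_scope.
Notation "$ a" := (cell a) (at level 5, a at level 5, format "$ a") : expr_scope.
Notation "a .@ e" := (Get a e) (at level 4, e at level 5, format "a .@ e") : expr_scope.
Notation "c1 ;; c2" := (CSeq c1 c2) (at level 70, right associativity).
Arguments CAssign a%_nat_scope i%_E e%_E.
Arguments CIf e%_E c1 c2.
Arguments CFor x%_nat_scope e%_E c.
(* Banks: 2 holds R, 4 the binomial coefficient 'C(2R, R), 5 the codes q_k of the
   forms y_k (a monomial is coded by the sum of the codes of its factors), 6
   the powers z_k^m mod p, 7 the nodes z_k, 8 the table of monomial codes, 9
   its inverse shifted by one, 10 its size, 11 the number of codes of degree
   R-1, 12 and 13 the parent of a monomial and the form leading to it, 14 the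
   values of the monomials at the witness, 15 the witness; 3 is scratch and the
   banks from 20 on are loop variables. *)
Notation vN := (Get 0 (Const 1)).
Notation vp := (Get 0 (Const 2)).

(** Bank 3 holds $2^R$ for the current R; by truncated subtraction the test is nonzero exactly when
    $2^{R+1}\le N$. *)
Definition log_body : cmd :=
  CIf (vN + #1 - ($3 + $3))
    (CAssign 3 #0 ($3 + $3) ;; CAssign 2 #0 ($2 + #1)) CSkip.

Definition log_phase : cmd := CAssign 3 #0 #1 ;; CFor 20 vN log_body.

Lemma run_log_phase s N : s 0 1 = N -> 0 < N -> s 2 0 = 0 ->
  run log_phase s 2 0 = log_floor N.
Proof.
move=> sN N0 s2.
set s1 := run (CAssign 3 #0 #1) s.
pose I (i : nat) (t : state) := [/\ t 0 1 = N, t 3 0 = 2 ^ t 2 0, 2 ^ t 2 0 <= N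
  & t 2 0 = i \/ N < 2 ^ (t 2 0).+1].
have [] : I (eval vN s1) (run (CFor 20 vN log_body) s1).
  apply: (@run_for I 20 vN log_body s1) => //; rewrite /s1 /=.
    by split; rewrite /update /= ?sN ?s2 //; left.
  rewrite -[update _ _ _ _ 0 1]/(s 0 1) sN => i t iN t20 [tN t3 tle tor].
  rewrite /= tN t3 addnn -mul2n -expnS.
  case: ifPn => [|]; rewrite -lt0n subn_gt0 addn1 ltnS => h.
    split; rewrite /update /= ?tN ?t3 ?addn1 ?mul2n ?addnn // -?mul2n -?expnS //.
    by case: tor => [->|]; [left|rewrite ltnNge h].
  by split; rewrite /update /= ?tN ?t3 //; right; rewrite ltnNge.
rewrite [eval _ _]sN => tN t3 tle tor; symmetry; apply: trunc_log_eq => //.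
rewrite tle /=; case: tor => // e.
by move: tle; rewrite e leqNgt ltn_expl.
Qed.

(** Implements $\binom{R+i+1}{i+1}=\binom{R+i}{i}(R+i+1)/(i+1)$. The reduction modulo [#1 + $2] does
    not change the counter, which is below R; it makes the factor visibly bounded by read-only
    banks, as [tame] requires. *)
Definition bin_body : cmd :=
  CAssign 4 #0 (($4 * ($2 + #1 + $20 %% (#1 + $2))) / ($20 + #1)).

Definition bin_phase : cmd := CAssign 4 #0 #1 ;; CFor 20 $2 bin_body.

Lemma run_bin_phase s : run bin_phase s 4 0 = 'C(2 * s 2 0, s 2 0).
Proof.
set s1 := run (CAssign 4 #0 #1) s.
pose I (i : nat) (t : state) := t 2 0 = s 2 0 /\ t 4 0 = 'C(s 2 0 + i, i).
have [] : I (eval $2 s1) (run (CFor 20 $2 bin_body) s1).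
  apply: (@run_for I 20 $2 bin_body s1) => //; rewrite /s1 /=.
    by split; rewrite /update /= ?addn0 ?bin0.
  rewrite -[update _ _ _ _ 2 0]/(s 2 0) => i t iN t20 [t2 t4].
  split; rewrite /update /= ?t2 ?t4 ?t20 //.
  rewrite modn_small; last by rewrite add1n ltnS ltnW.
  have -> : s 2 0 + 1 + i = (s 2 0 + i).+1 by lia.
  by rewrite mulnC (mul_bin_diag (s 2 0 + i).+1) addn1 mulKn // addnS.
by change (eval $2 s1) with (s 2 0); rewrite mul2n addnn.
Qed.

Definition form_body : cmd :=
  CAssign 5 ($20 + #2) (5.@($20 + #1) * vN) ;;
  CAssign 7 ($20 + #2) (7.@($20 + #1) + 7.@($20 + #1)).

Definition form_phase : cmd :=
  CAssign 5 #1 #1 ;; CAssign 7 #1 #1 ;; CFor 20 $2 form_body.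

Lemma run_form_phase s k : s 5 0 = 0 -> s 7 0 = 0 -> k <= s 2 0 ->
  run form_phase s 5 k = var_code (s 0 1) k /\ run form_phase s 7 k = node k.
Proof.
move=> s5 s7.
set s1 := run (CAssign 5 #1 #1 ;; CAssign 7 #1 #1) s.
pose I (i : nat) (t : state) := [/\ t 2 0 = s 2 0, t 0 1 = s 0 1,
  forall k, k <= i.+1 -> t 5 k = var_code (s 0 1) k
  & forall k, k <= i.+1 -> t 7 k = node k].
have [] : I (eval $2 s1) (run (CFor 20 $2 form_body) s1).
  apply: (@run_for I 20 $2 form_body s1) => //; rewrite /s1 /=.
    by split; rewrite /update //= => -[|[|k']].
  rewrite -[update _ _ _ _ 2 0]/(s 2 0) => i t iN t20 [t2 tN t5 t7].
  split; rewrite /update /= ?t2 ?tN ?t20 // => k' ki; rewrite addn1 addn2.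
    rewrite t5 //; case: eqP => [->|/eqP ne]; last by apply: t5; rewrite -ltnS ltn_neqAle ne.
    by rewrite /= expnSr.
  rewrite t7 //; case: eqP => [->|/eqP ne]; last by apply: t7; rewrite -ltnS ltn_neqAle ne.
  by rewrite /= addnn -mul2n -expnS.
change (eval $2 s1) with (s 2 0) => _ _ h5 h7 kR.
by rewrite -h5 ?(leqW kR) // -h7 ?(leqW kR).
Qed.

Definition node_power_step : cmd :=
  CAssign 6 ($20 * (vN + #1) + $21 + #1)
    ((6.@($20 * (vN + #1) + $21) * 7.@($20)) %% modulus).

Definition node_power_body : cmd :=
  CAssign 6 ($20 * (vN + #1)) #1 ;; CFor 21 vN node_power_step.

Definition node_power_phase : cmd := CFor 20 ($2 + #1) node_power_body.

Lemma run_node_power_phase s k m (n1 := (s 0 1).+1) : 1 < s 0 2 ->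
  (forall k, k <= s 2 0 -> s 7 k = node k) -> k <= s 2 0 -> m < n1 ->
  run node_power_phase s 6 (k * n1 + m) = node k ^ m %% s 0 2.
Proof.
move=> p1 s7 kR mN.
pose J (t : state) := [/\ t 0 1 = s 0 1, t 0 2 = s 0 2, t 2 0 = s 2 0
  & forall k, t 7 k = s 7 k].
pose I i (t : state) := J t /\ forall k m, k < i -> m < n1 ->
   t 6 (k * n1 + m) = node k ^ m %% s 0 2.
suff [_ h] : I (eval ($2 + #1) s) (run node_power_phase s).
  by apply: h => //; rewrite /= addn1 ltnS.
apply: (@run_for I 20 ($2 + #1)%E node_power_body s) => //.
move=> i t /=; rewrite addn1 ltnS => iR t20 [[tN tp tR t7] It].
set t1 := run (CAssign 6 ($20 * (vN + #1)) #1) t.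
pose I' j (t' : state) := [/\ J t', t' 20 0 = i, I i t'
  & forall m, m < j.+1 -> t' 6 (i * n1 + m) = node i ^ m %% s 0 2].
have [] : I' (eval vN t1) (run (CFor 21 vN node_power_step) t1).
  apply: (@run_for I' 21 vN node_power_step t1) => //; rewrite /t1 /=.
    split=> //.
    - split=> // k' m' k'i m'n; rewrite /update /= tN addn1 -/n1 t20.
      case: eqP => [e|_]; last exact: It.
      have [] := @radix_inj n1 k' i m' 0 m'n isT; first by rewrite addn0.
      by move=> e'; rewrite e' ltnn in k'i.
    - by move=> [] // _; rewrite /update /= tN addn1 -/n1 t20 addn0 eqxx expn0 modn_small.
  rewrite -[update _ _ _ _ 0 1]/(t 0 1) tN => j t' jN t'21 [[t'N t'p t'R t'7] t'20 [_ It'] It'2].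
  split=> //=.
  - split; first by split.
    move=> k' m' k'i m'n; rewrite /update /= t'20 t'N t'21 !addn1 -/n1 -addnS.
    case: eqP => [e|_]; last exact: It'.
    have [] := radix_inj m'n (jN : j.+1 < n1) e.
    by move=> e'; rewrite e' ltnn in k'i.
  move=> m' m'j; rewrite /update /= t'20 t'N t'21 !addn1 -/n1 -addnS eqn_add2l.
  case: eqP => [->|ne]; last by apply: It'2; rewrite ltn_neqAle -ltnS m'j andbT; apply/eqP => -[].
  by rewrite t'p subnKC ?(ltnW p1) // It'2 // t'7 s7 // modnMml expnSr.
move=> [rN rp rR r7] r20 [_ rI] rI'; set r := run _ _ in rN rp rR r7 r20 rI rI'.
have -> : update (run node_power_body t) 20 0 i.+1 = update r 20 0 i.+1 by [].
split; first by split.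
move=> k' m'; rewrite ltnS leq_eqVlt /update /= => /orP[/eqP->|k'i] m'n; last exact: rI.
by apply: rI'; rewrite [eval _ _]tN.
Qed.

Definition table_new : expr := (8.@($21) + 5.@($22 + #1))%E.

Definition table_insert : cmd :=
  CIf (9.@table_new) CSkip
    (CAssign 9 table_new ($10 + #1) ;; CAssign 8 $10 table_new ;;
     CAssign 12 $10 $21 ;; CAssign 13 $10 ($22 + #1) ;; CAssign 10 #0 ($10 + #1)).

Definition table_multiply : cmd := CIf ($11 - $21) (CFor 22 $2 table_insert) CSkip.

(** A loop bound must be read-only, so the loop runs to the binomial coefficient, an upper bound on
    the table size, and [table_multiply] skips positions from [$11] on. Cell 11 freezes the size at
    the start of the round, hence after the last round it counts the codes of degree R-1. *)
Definition table_round : cmd := CAssign 11 #0 $10 ;; CFor 21 $4 table_multiply.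

Definition table_phase : cmd :=
  CAssign 10 #0 #1 ;; CAssign 9 #0 #1 ;; CFor 20 $2 table_round.

(** In [tab_parent] the parent precedes its child, so values can be computed in table order; being
    below [s 11 0] it is finally a product of R-1 forms, which leaves room for one more. *)
Record tabulates (N R : nat) (s : state) (T : seq nat) : Prop := Tabulates {
  tab_size : s 10 0 = size T;
  tab_nth : forall i, i < size T -> s 8 i = nth 0 T i;
  tab_index : forall v, s 9 v = if v \in T then (index v T).+1 else 0;
  tab_uniq : uniq T;
  tab_head : nth 0 T 0 = 0;
  tab_pos : 0 < size T;
  tab_parent : forall y, 0 < y < size T -> [/\ s 12 y < y, s 12 y < s 11 0, 0 < s 13 y <= R
    & nth 0 T y = nth 0 T (s 12 y) + var_code N (s 13 y)]
}.

Lemma run_table_insert N R s T x k :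
  tabulates N R s T -> s 21 0 = x -> s 22 0 = k -> x < size T -> x < s 11 0 -> k < R ->
  s 5 k.+1 = var_code N k.+1 ->
  let v := nth 0 T x + var_code N k.+1 in
  tabulates N R (run table_insert s) (if v \in T then T else rcons T v).
Proof.
move=> [t10 t8 t9 uT T0 Tp tpar] s21 s22 xT x11 kR s5 v.
have newE : s 8 (s 21 0) + s 5 (s 22 0 + 1) = v by rewrite s21 s22 addn1 s5 t8.
rewrite /table_insert /= newE t9; case: (boolP (v \in T)) => vT /=; first by split.
have sz : size (rcons T v) = (size T).+1 by rewrite size_rcons.
have nthr i : i < size T -> nth 0 (rcons T v) i = nth 0 T i by rewrite nth_rcons => ->.
split.
- by rewrite sz /update /= t10 addn1.
- move=> i; rewrite sz ltnS leq_eqVlt /update /= t10 => /orP[/eqP->|iT].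
    by rewrite eqxx nth_rcons ltnn eqxx -newE /= s21.
  by rewrite nthr // ltn_eqF // t8.
- move=> w; rewrite /update /= t10 addn1 mem_rcons inE t9 -cats1 index_cat /=.
  case: (eqVneq w v) => [->|ne] /=; first by rewrite (negPf vT) ?eqxx addn0.
  by case: ifP.
- by rewrite rcons_uniq vT.
- by rewrite nthr.
- by rewrite sz.
move=> y /andP[y0]; rewrite sz ltnS leq_eqVlt /update /= t10 => /orP[/eqP ey|yT].
  rewrite ey eqxx s21 s22 addn1 /= [nth 0 (rcons T v) (size T)]nth_rcons ltnn eqxx nthr //; split=> //.
have [h1 h1' h2 h3] := tpar y (introT andP (conj y0 yT)).
by rewrite ltn_eqF // !nthr // (ltn_trans h1).
Qed.

Lemma tabulates_update N R s T b i v : b \notin [:: 8; 9; 10; 11; 12; 13] ->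
  tabulates N R s T -> tabulates N R (update s b i v) T.
Proof.
rewrite !inE !negb_or => /and5P[b8 b9 b10 b11 /andP[b12 b13]] [t10 t8 t9 uT T0 Tp tpar].
have K c j : c != b -> update s b i v c j = s c j by exact: update_bank.
split=> //.
- by rewrite K // eq_sym.
- by move=> j jT; rewrite K ?t8 // eq_sym.
- by move=> w; rewrite K ?t9 // eq_sym.
by move=> y yT; rewrite !K 1?eq_sym //; apply: tpar.
Qed.

Definition table_env (N R C : nat) (s : state) : Prop :=
  [/\ s 2 0 = R, s 4 0 = C & forall k, k <= R -> s 5 k = var_code N k].

Lemma table_env_run N R C c s : table_env N R C s ->
  all (fun a => a \notin writes c) [:: 2; 4; 5] -> table_env N R C (run c s).
Proof.
move=> [e2 e4 e5] /and4P[h2 h4 h5 _]; split; rewrite ?run_frame //.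
by move=> k kR; rewrite run_frame // e5.
Qed.

Lemma run_table_multiply N R C s T x : table_env N R C s -> tabulates N R s T ->
  s 21 0 = x -> x < s 11 0 <= size T ->
  exists E, [/\ tabulates N R (run table_multiply s) (T ++ E),
    forall v, v \in E -> exists2 k, k < R & v = nth 0 T x + var_code N k.+1
    & forall k, k < R -> nth 0 T x + var_code N k.+1 \in T ++ E].
Proof.
move=> [e2 e4 e5] tT s21 /andP[x11 s11].
rewrite /table_multiply /= s21 -lt0n subn_gt0 x11.
change (run _ s) with (run (CFor 22 $2 table_insert) s).
pose I k (t : state) := [/\ table_env N R C t, t 21 0 = x, t 11 0 = s 11 0 & exists E,
  [/\ tabulates N R t (T ++ E),
    forall v, v \in E -> exists2 k, k < R & v = nth 0 T x + var_code N k.+1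
    & forall k', k' < k -> nth 0 T x + var_code N k'.+1 \in T ++ E]].
have [_ _ _] : I (eval $2 s) (run (CFor 22 $2 table_insert) s).
  apply: (@run_for I 22 $2 table_insert s) => //.
    split=> //; exists [::]; split=> //; rewrite cats0.
    by do 2!(apply: tabulates_update => //).
  move=> k t; rewrite [eval _ _]e2 => kR t22 [[h2 h4 h5] t21 t11 [E [tE Einv Eall]]].
  split=> //.
  - by case: (@table_env_run N R C table_insert t).
  - by rewrite update_bank // run_frame.
  - by rewrite update_bank // run_frame.
  have xT : x < size T by apply: leq_trans s11.
  have xTE : x < size (T ++ E) by rewrite size_cat (leq_trans xT) ?leq_addr.
  have x11' : x < t 11 0 by rewrite t11.
  have := run_table_insert tE t21 t22 xTE x11' kR (h5 _ kR).
  rewrite nth_cat xT; set v := nth 0 T x + _; move: (run table_insert t) => t' tab.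
  exists (if v \in T ++ E then E else rcons E v); split.
  - apply: tabulates_update => //; move: tab; cbv zeta.
    by case: ifP => //; rewrite rcons_cat.
  - move=> w; case: ifP => _; first exact: Einv.
    by rewrite mem_rcons inE => /orP[/eqP->|/Einv//]; exists k.
  move=> k'; rewrite ltnS leq_eqVlt => /orP[/eqP->|/Eall h].
    by case: ifPn => //; rewrite -rcons_cat mem_rcons inE eqxx.
  by case: ifP => // _; rewrite -rcons_cat mem_rcons inE h orbT.
by rewrite [eval _ _]e2 => -[E hE]; exists E.
Qed.

(** Since $y_0$ has code 0, codes of degree d are also codes of degree d+1: a round only appends,
    and the previous table survives as a prefix. *)
Lemma run_table_phase s N (R := log_floor N) : 0 < N ->
  table_env N R 'C(2 * R, R) s ->
  (forall i, s 8 i = 0) -> (forall i, s 9 i = 0) ->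
  exists T, [/\ tabulates N R (run table_phase s) T,
    forall al, al \in T <-> form_code N R R al
    & 0 < R -> run table_phase s 11 0 <= size T
       /\ forall al, al \in take (run table_phase s 11 0) T <-> form_code N R R.-1 al].
Proof.
move=> N0 env s8 s9.
set s1 := run (CAssign 10 #0 #1 ;; CAssign 9 #0 #1) s.
change (run table_phase s) with (run (CFor 20 $2 table_round) s1).
have env1 : table_env N R 'C(2 * R, R) s1 by apply: table_env_run.
pose I d (t : state) := table_env N R 'C(2 * R, R) t /\ exists T,
  [/\ tabulates N R t T, forall al, al \in T <-> form_code N R d al
    & 0 < d -> t 11 0 <= size T
       /\ forall al, al \in take (t 11 0) T <-> form_code N R d.-1 al].
have [_] : I (eval $2 s1) (run (CFor 20 $2 table_round) s1); last first.
  by rewrite [eval _ _](let: And3 h _ _ := env1 in h).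
apply: (@run_for I 20 $2 table_round s1) => //.
  split; first by case: env1.
  exists [:: 0]; split=> //.
    do 2!(apply: tabulates_update => //); split=> //=.
    - by case=> // _; rewrite /s1 /= /update /= ?s8.
    - by move=> v; rewrite /s1 /= /update /= s9 inE; case: v.
    - by case=> // y; rewrite andbF.
  move=> al; rewrite inE; split=> [/eqP->|[[|]// _ ->]]; last by rewrite big_nil.
  by exists [::]; rewrite ?big_nil.
move=> d t; rewrite [eval _ _](let: And3 h _ _ := env1 in h) => dR t20 [envt [T [tT TW _]]].
(* Guarantees that the loop of fixed length [$4] visits the whole table. *)
have szT : size T <= 'C(2 * R, R).
  apply: (@size_form_codes N R d T (ltnW dR)); first exact: tab_uniq tT.
  by move=> al alT; apply/TW.
set t1 := run (CAssign 11 #0 $10) t.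
have r1 : run table_round t = run (CFor 21 $4 table_multiply) t1 by [].
pose J x (t' : state) := [/\ table_env N R 'C(2 * R, R) t', t' 11 0 = size T & exists E,
  [/\ tabulates N R t' (T ++ E), forall al, al \in E -> form_code N R d.+1 al
    & forall y k, y < x -> y < size T -> k < R -> nth 0 T y + var_code N k.+1 \in T ++ E]].
have envt1 : table_env N R 'C(2 * R, R) t1 by apply: table_env_run.
have [envr r11 [E [tE EW Eall]]] : J (eval $4 t1) (run (CFor 21 $4 table_multiply) t1).
  apply: (@run_for J 21 $4 table_multiply t1) => //.
    split; first by case: envt1.
      by rewrite /t1 /= /update /= (tab_size tT).
    exists [::]; split=> //; rewrite cats0; do 2!(apply: tabulates_update => //).
    case: tT => t10 t8 t9 uT T0 Tp tpar; split=> // y /[dup] /andP[_ yT] /tpar[h1 _ h2 h3].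
    by split=> //; rewrite /t1 /= /update /= t10 (ltn_trans h1).
  move=> x t' _ t'21 [envt' t'11 [E [tE EW Eall]]].
  have W1 k al : k < R.+1 -> form_code N R d al -> form_code N R d.+1 (al + var_code N k).
    by move=> kR; apply: (@word_codeS _ (fun k : 'I_R.+1 => var_code N k) _ _ (Ordinal kR)).
  case: (ltnP x (size T)) => xT.
    have xle : x < t' 11 0 <= size (T ++ E) by rewrite t'11 xT size_cat leq_addr.
    have [E' [tE' E'v E'all]] := run_table_multiply envt' tE t'21 xle.
    rewrite nth_cat xT in E'v E'all.
    split.
    - by case: (@table_env_run N R 'C(2 * R, R) table_multiply t').
    - by rewrite update_bank // run_frame.
    exists (E ++ E'); split.
    - by rewrite catA; apply: tabulates_update.
    - move=> al; rewrite mem_cat => /orP[/EW//|/E'v[k kR ->]].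
      by apply: W1 => //; apply/TW/mem_nth.
    move=> y k; rewrite ltnS leq_eqVlt catA => /orP[/eqP->|yx] yT kR; first exact: E'all.
    by rewrite mem_cat Eall.
  rewrite /table_multiply /= t'21 t'11 (eqP (_ : size T - x == 0)) ?subn_eq0 //=.
  split=> //; exists E; split=> //; first exact: tabulates_update.
  by move=> y k _ yT; apply: Eall => //; apply: leq_trans yT xT.
rewrite r1; set r := run _ t1 in envr r11 tE *; rewrite [eval _ _](let: And3 _ h _ := envt1 in h) in Eall.
split; first by case: envr.
exists (T ++ E); split; first exact: tabulates_update.
  move=> al; split.
    rewrite mem_cat => /orP[/TW h|/EW//].
    by rewrite -[al]addn0; apply: (@word_codeS _ (fun k : 'I_R.+1 => var_code N k) _ _ ord0).
  case=> [[|k w] // [sw] ->]; rewrite big_cons.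
  have wT : \sum_(j <- w) var_code N j \in T by apply/TW; exists w.
  case: (posnP k) => [->|k0]; first by rewrite add0n mem_cat wT.
  rewrite -(nth_index 0 wT) addnC -(prednK k0); apply: Eall; rewrite ?index_mem //.
    by apply: leq_trans szT; rewrite index_mem.
  by have := ltn_ord k; lia.
move=> _; rewrite update_bank // r11 size_cat leq_addr; split=> // al.
by rewrite take_size_cat //; apply: TW.
Qed.

(** * The basis matrices *)

Arguments AAcc ad%_E v%_E.
Arguments AIf e%_E c1 c2.
Arguments AFor x%_nat_scope e%_E c.
Notation vDn := (vN * $2 + #1)%E.
Notation vDs := (#2 * vN * $2 + #1)%E.
Notation vn1 := (vN + #1)%E.
Notation vm := (vn1 * vDs * $4)%E.
Notation vk := ($10 * vDn * vn1 * vn1)%E.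

Definition param_expr (x s i l : expr) : expr := (((x * vDn + s) * vn1 + i) * vn1 + l)%E.

(** The 2 skips the output length in cell 0 and the number of matrices in cell 1. *)
Definition entry_expr (par row col : expr) : expr := (#2 + (par * vm + row) * vm + col)%E.

Definition main_emit : acmd :=
  AFor 20 $10 (AFor 21 vDn (AFor 22 vn1 (AFor 23 vn1
    (AAcc (entry_expr (param_expr $20 $21 $22 $23) (($20 * vDs + $21) * vn1 + $22) $23) #1)))).

(* Adds v times the unknown of index par to constraint q of row group
   (x, s): the value of constraint q is spread along the q-th diagonal of an
   (R+1)-row Toeplitz band. *)
Definition emit (par q v : expr) : acmd :=
  AFor 27 ($2 + #1)
    (AAcc (entry_expr par (($20 * vDs + $21) * vn1 + $27) (vn1 + q + $27)) v).

Definition minus_one : expr := (vp - #1)%E.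

Definition unknown (i l : expr) : expr := param_expr $20 $21 i l.

(** For $i\ne l$ constraint $(i,l)$ is symmetry. The diagonal, where symmetry says nothing, carries
    Booleanity in the homogeneous form $b_l b_l=b_l b_0$. *)
Definition sym_emit : acmd :=
  AFor 22 vn1 (AFor 23 vn1
    (ASeq (emit (unknown $22 $23) ($22 * vn1 + $23) #1)
       (AIf (($22 - $23) + ($23 - $22))
          (emit (unknown $23 $22) ($22 * vn1 + $23) minus_one)
          (emit (unknown $23 #0) ($22 * vn1 + $23) minus_one)))).

Definition circuit_base : expr := (vn1 * vn1)%E.

Definition gate_field (j : nat) : expr := 0.@(#6 + #3 * $28 + #j).

(** Wire k is coordinate k+1. Gate equations are homogenised by $b_0$: a linear term $b_k$ is read
    as $b_k b_0$ and the constant 1 as $b_0 b_0$. Offset [circuit_base] itself is left to the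
    acceptance equation. *)
Definition gate_emit : acmd :=
  let q := (circuit_base + #1 + $28)%E in
  ASeq (emit (unknown (0.@#3 + $28 + #1) #0) q #1)
    (AIf (gate_field 0)
       (ASeq (emit (unknown (gate_field 1 + #1) #0) q #1) (emit (unknown #0 #0) q minus_one))
       (emit (unknown (gate_field 1 + #1) (gate_field 2 + #1)) q minus_one)).

Definition circuit_emit : acmd :=
  ASeq (AFor 28 (0.@#5) gate_emit)
    (ASeq (emit (unknown (0.@#4 + #1) #0) circuit_base #1)
       (emit (unknown #0 #0) circuit_base minus_one)).

Definition shifted_unknown (k : expr) : expr :=
  param_expr (9.@(8.@($20) + 5.@k) - #1) ($21 - $26) $22 $26.

(** The coordinate $b_m$ in $y_j=\sum_m z_j^m t^m b_m$ becomes the second index of the unknown, so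
    the relation is linear in the stored table. Here [$20] runs over monomials of degree R-1, [$26]
    is m, and the two tests discard powers of t outside the table, where truncated subtraction would
    address a wrong cell. *)
Definition exchange_emit : acmd :=
  let q := (circuit_base + vn1 + ($24 * ($2 + #1) + $25) * vn1 + $22)%E in
  AFor 24 ($2 + #1) (AFor 25 ($2 + #1) (AFor 22 vn1 (AFor 26 vn1
    (AIf ($21 + #1 - $26) (AIf (vDn - ($21 - $26))
       (ASeq (emit (shifted_unknown $25) q (6.@($24 * vn1 + $26)))
             (emit (shifted_unknown $24) q (vp - 6.@($25 * vn1 + $26))))
       ASkip) ASkip)))).

Definition matrix_emit : acmd :=
  ASeq main_emit
    (ASeq (AFor 20 $10 (AFor 21 vDn (ASeq sym_emit circuit_emit)))
       (AFor 20 $11 (AFor 21 vDs exchange_emit))).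

(** * Entries of a combination as linear forms in its coefficients *)

Local Open Scope ring_scope.

(* The coefficient of the linear combination sum_J a_J M_J at (row, col). *)
Definition Lam (F : fieldType) (m k : nat) (a : nat -> F) (c : acmd) (s : state)
    (row col : nat) : F :=
  \sum_(J < k) a J * (accf c s (2 + (J * m + row) * m + col)%N)%:R.

Lemma Lam_seq (F : fieldType) m k (a : nat -> F) c1 c2 s row col :
  Lam m k a (ASeq c1 c2) s row col = Lam m k a c1 s row col + Lam m k a c2 s row col.
Proof. by rewrite -big_split; apply: eq_bigr => J _; rewrite /= natrD mulrDr. Qed.

Lemma Lam_if (F : fieldType) m k (a : nat -> F) e c1 c2 s row col :
  Lam m k a (AIf e c1 c2) s row col
  = if eval e s != 0%N then Lam m k a c1 s row col else Lam m k a c2 s row col.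
Proof. by rewrite /Lam /=; case: ifP. Qed.

Lemma Lam_for (F : fieldType) m k (a : nat -> F) x e c s row col :
  Lam m k a (AFor x e c) s row col
  = \sum_(i < eval e s) Lam m k a c (update s x 0 i) row col.
Proof.
rewrite exchange_big; apply: eq_bigr => J _.
by rewrite -mulr_sumr /= natr_sum.
Qed.

Lemma Lam_skip (F : fieldType) m k (a : nat -> F) s row col :
  Lam m k a ASkip s row col = 0.
Proof. by apply: big1 => J _; rewrite mulr0. Qed.

Lemma Lam_acc (F : fieldType) m k (a : nat -> F) ad v s row col par r cl :
  eval ad s = (2 + (par * m + r) * m + cl)%N -> (par < k)%N -> (r < m)%N -> (cl < m)%N ->
  (row < m)%N -> (col < m)%N ->
  Lam m k a (AAcc ad v) s row col
  = if (row == r) && (col == cl) then a par * (eval v s)%:R else 0.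
Proof.
move=> ead park rm clm rowm colm; rewrite /Lam /= ead.
have E (J : nat) : ((2 + (par * m + r) * m + cl)%N == (2 + (J * m + row) * m + col)%N)
   = [&& J == par, row == r & col == cl].
  apply/eqP/and3P => [|[/eqP-> /eqP-> /eqP-> //]].
  rewrite -!addnA => /addnI /radix_inj [] // /radix_inj [] // -> -> ->.
  by rewrite !eqxx.
rewrite (bigD1 (Ordinal park)) //= E eqxx /= big1 ?addr0; last first.
  move=> J; rewrite E -val_eqE /= => /negPf -> /=; exact: mulr0.
by case: ifP => _ //; rewrite mulr0.
Qed.

Local Close Scope ring_scope.

Lemma bin_double_ge2 R : 0 < R -> 2 <= 'C(2 * R, R).
Proof.
case: R => // R _; rewrite mulnS binS -[2]/(1 + 1) leq_add // bin_gt0; lia.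
Qed.

(** The columns needed: N+1 for the blocks, one for each constraint, and R more so that the last
    diagonal fits. The factor ['C(2 * R, R)] of the order, at least 2, is needed to make room for
    them. *)
Lemma toeplitz_band_fits N (R := log_floor N) : 1 < N ->
  N.+1 + (N.+1 * N.+1 + N.+1 + R.+1 * R.+1 * N.+1) + R <= mx_order N.
Proof.
move=> N1; rewrite /mx_order -/R.
have R0 : 0 < R by apply: log_floor_gt0.
have RN : R < N by apply: leq_trans (log_floor_exp (ltnW N1)); rewrite ltn_expl.
have R1N : R <= N.+1 by rewrite ltnW // ltnW.
clearbody R.
apply: (@leq_trans (N.+1 * (N + 4 + R.+1 * R.+1))).
  by move: (R.+1 * R.+1) => A; nia.
rewrite -mulnA leq_mul2l /=; apply: (@leq_trans ((2 * N * R).+1 * 2)).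
  nia.
by rewrite leq_mul2l bin_double_ge2.
Qed.

(** Banks from 20 on hold the loop variables, the only cells that change while contributions are
    evaluated. *)
Definition extends (s t : state) : Prop := forall b i, b < 20 -> t b i = s b i.

Lemma extends_update s t x v : 20 <= x -> extends s t -> extends s (update t x 0 v).
Proof.
move=> x20 st b i b20; rewrite update_bank ?st //.
by apply: contraTneq b20 => ->; rewrite -leqNgt.
Qed.

Lemma extends_refl s : extends s s. Proof. by []. Qed.

Record ready (N p : nat) (phi : circuit) (T : seq nat) (cp : nat) (s : state) : Prop := Ready {
  ready_N : s 0 1 = N;
  ready_p : s 0 2 = p;
  ready_inputs : s 0 3 = ninputs phi;
  ready_out : s 0 4 = out phi;
  ready_size : s 0 5 = size (gates phi);
  ready_gate : forall g j, g < size (gates phi) ->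
    s 0 (6 + 3 * g + j) = nth 0 (code_gate (nth (NOT 0) (gates phi) g)) j \/ 2 < j;
  ready_R : s 2 0 = log_floor N;
  ready_C : s 4 0 = 'C(2 * log_floor N, log_floor N);
  ready_code : forall k, k <= log_floor N -> s 5 k = var_code N k;
  ready_node : forall k m, k <= log_floor N -> m <= N ->
    s 6 (k * N.+1 + m) = node k ^ m %% p;
  ready_table : tabulates N (log_floor N) s T;
  ready_codes : forall al, al \in T <-> form_code N (log_floor N) (log_floor N) al;
  ready_cp : s 11 0 = cp;
  ready_cp_le : cp <= size T;
  ready_cp_codes : forall al,
    al \in take cp T <-> form_code N (log_floor N) (log_floor N).-1 al
}.

(** A product of R forms of degree N in t has NR+1 coefficients. An exchange relation has one more
    form and reaches degree NR+N; the bound [Ds] covers it because R is positive. *)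
Definition Dn (N : nat) : nat := (N * log_floor N).+1.
Definition Ds (N : nat) : nat := (2 * N * log_floor N).+1.

Definition param (N x s i l : nat) : nat := ((x * Dn N + s) * N.+1 + i) * N.+1 + l.
Definition group_row (N x s i : nat) : nat := (x * Ds N + s) * N.+1 + i.

Lemma radix_lt A n a b : a < A -> b < n -> a * n + b < A * n.
Proof. by move=> aA bn; rewrite -(ltn_add2l (a * n)) in bn; apply: leq_trans bn _; rewrite -mulSnr leq_mul2r aA orbT. Qed.

Lemma param_lt N cnt x s i l : x < cnt -> s < Dn N -> i <= N -> l <= N ->
  param N x s i l < cnt * Dn N * N.+1 * N.+1.
Proof. by move=> xc sD iN lN; do 3!(apply: radix_lt => //). Qed.

Lemma group_row_lt N x s i : x < 'C(2 * log_floor N, log_floor N) -> s < Ds N -> i <= N ->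
  group_row N x s i < mx_order N.
Proof.
rewrite /group_row /mx_order -/(Ds N) => xC sD iN.
by rewrite -mulnA [X in _ < X]mulnC [X in _ < X * _]mulnC; do 2!(apply: radix_lt => //).
Qed.

Lemma eval_vDn N p phi T cp s t : ready N p phi T cp s -> extends s t -> eval vDn t = Dn N.
Proof. by move=> r e; rewrite /= !e // (ready_N r) (ready_R r) addn1. Qed.

Lemma eval_vDs N p phi T cp s t : ready N p phi T cp s -> extends s t -> eval vDs t = Ds N.
Proof. by move=> r e; rewrite /= !e // (ready_N r) (ready_R r) addn1. Qed.

Lemma eval_vn1 N p phi T cp s t : ready N p phi T cp s -> extends s t -> eval vn1 t = N.+1.
Proof. by move=> r e; rewrite /= !e // (ready_N r) addn1. Qed.

Lemma eval_vm N p phi T cp s t : ready N p phi T cp s -> extends s t -> eval vm t = mx_order N.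
Proof. by move=> r e; rewrite /= !e // (ready_N r) (ready_R r) (ready_C r) !addn1. Qed.

Lemma eval_param N p phi T cp s t x u i l : ready N p phi T cp s -> extends s t ->
  eval (param_expr x u i l) t = param N (eval x t) (eval u t) (eval i t) (eval l t).
Proof.
by move=> r e; rewrite /param -(eval_vDn r e) -(eval_vn1 r e).
Qed.

Lemma eval_entry N p phi T cp s t par row col : ready N p phi T cp s -> extends s t ->
  eval (entry_expr par row col) t
  = 2 + (eval par t * mx_order N + eval row t) * mx_order N + eval col t.
Proof. by move=> r e; rewrite -(eval_vm r e). Qed.

Local Open Scope ring_scope.

Lemma Lam_emit (F : fieldType) N p phi T cp s (a : nat -> F) k t par q v par0 q0 (v0 : nat)
    row col : ready N p phi T cp s -> extends s t ->
  (forall d, eval par (update t 27 0 d) = par0) ->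
  (forall d, eval q (update t 27 0 d) = q0) ->
  (forall d, eval v (update t 27 0 d) = v0) ->
  (t 20 0 < 'C(2 * log_floor N, log_floor N))%N -> (t 21 0 < Ds N)%N ->
  (par0 < k)%N -> (N.+1 + q0 + log_floor N < mx_order N)%N -> (log_floor N <= N)%N ->
  (row < mx_order N)%N -> (col < mx_order N)%N ->
  Lam (mx_order N) k a (emit par q v) t row col
  = if [&& (row %/ N.+1 == t 20 0 * Ds N + t 21 0)%N, (row %% N.+1 <= log_floor N)%N
        & (col == N.+1 + q0 + row %% N.+1)%N]
    then a par0 * v0%:R else 0.
Proof.
move=> r e hpar hq hv xC sD park qm RN rowm colm; rewrite Lam_for.
have -> : eval ($2 + #1)%E t = (log_floor N).+1 by rewrite /= e // (ready_R r) addn1.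
have term (d : 'I_(log_floor N).+1) :
    Lam (mx_order N) k a (AAcc (entry_expr par (($20 * vDs + $21) * vn1 + $27)%E
       (vn1 + q + $27)%E) v) (update t 27 0 d) row col
    = if (row == group_row N (t 20 0%N) (t 21 0%N) d) && (col == N.+1 + q0 + d)%N
      then a par0 * v0%:R else 0.
  have e' : extends s (update t 27 0 d) by apply: extends_update.
  rewrite (@Lam_acc _ _ _ _ _ _ _ _ _ par0 (group_row N (t 20 0%N) (t 21 0%N) d) (N.+1 + q0 + d)) ?hv //.
  - rewrite (eval_entry _ _ _ r e') hpar.
    have -> : eval (($20 * vDs + $21) * vn1 + $27)%E (update t 27 0 d)
        = group_row N (t 20 0%N) (t 21 0%N) d.
      by rewrite /group_row -(eval_vDs r e') -(eval_vn1 r e').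
    by congr (_ + _)%N; rewrite -(eval_vn1 r e') -(hq d).
  - by apply: group_row_lt => //; apply: leq_trans (leq_ord d) RN.
  - by apply: leq_ltn_trans qm; rewrite leq_add2l leq_ord.
rewrite (eq_bigr _ (fun d _ => term d)).
have dN (d : 'I_(log_floor N).+1) : (d < N.+1)%N.
  by rewrite ltnS (leq_trans (leq_ord d)).
have rowE (d : 'I_(log_floor N).+1) : (row == group_row N (t 20 0%N) (t 21 0%N) d)
   = (row %/ N.+1 == t 20 0%N * Ds N + t 21 0%N)%N && (row %% N.+1 == d)%N.
  rewrite /group_row {1}(divn_eq row N.+1); apply/eqP/andP => [|[/eqP-> /eqP->] //].
  by move/radix_inj => [] //; rewrite ?ltn_mod // => -> ->; rewrite !eqxx.
case: ifP => [/and3P[h1 h2 h3]|hn].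
  pose d0 := Ordinal (h2 : (row %% N.+1 < (log_floor N).+1)%N).
  rewrite (bigD1 d0) //= (rowE d0) h1 eqxx h3 /=.
  rewrite big1 ?addr0 // => d; rewrite rowE -val_eqE /= eq_sym => /negPf ->.
  by rewrite andbF.
rewrite big1 // => d _; rewrite rowE; case: ifP => // /andP[/andP[h1 /eqP h2] h3].
by move: hn; rewrite h1 h2 h3 leq_ord.
Qed.

Local Close Scope ring_scope.

Definition band (N x s q row col : nat) : bool :=
  [&& row %/ N.+1 == x * Ds N + s, row %% N.+1 <= log_floor N
    & col == N.+1 + q + row %% N.+1].

Definition circuit_offset (N : nat) : nat := N.+1 * N.+1.
Definition exchange_offset (N j k i : nat) : nat :=
  N.+1 * N.+1 + N.+1 + (j * (log_floor N).+1 + k) * N.+1 + i.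

Lemma gates_wf_nth w gs g : gates_wf w gs -> g < size gs ->
  gate_wf (w + g) (nth (NOT 0) gs g).
Proof.
elim: gs w g => [|h gs IH] w [|g] //= /andP[hw gw]; first by rewrite addn0.
by rewrite ltnS -addSnnS; apply: IH.
Qed.

Lemma size_table N p phi T cp s : ready N p phi T cp s ->
  size T <= 'C(2 * log_floor N, log_floor N).
Proof.
move=> r; apply: (@size_form_codes N _ (log_floor N)) => //.
  exact: tab_uniq (ready_table r).
by move=> al; apply: (ready_codes r al).1.
Qed.

Lemma Dn_le_Ds N : Dn N <= Ds N.
Proof. by rewrite /Dn /Ds ltnS leq_mul2r leq_pmull ?orbT. Qed.

Local Open Scope ring_scope.

Lemma natr_mod (F : fieldType) p n : p%:R = 0 :> F -> (n %% p)%:R = n%:R :> F.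
Proof. by move=> p0; rewrite {2}(divn_eq n p) natrD natrM p0 mulr0 add0r. Qed.

(** The homogenised equation of gate [g], linear in the table [L] of products of two coordinates;
    coordinate 0 is the constant and wire k is coordinate k+1. *)
Definition circuit_form (F : fieldType) (phi : circuit) (L : nat -> nat -> F) (g : nat) : F :=
  match nth (NOT 0) (gates phi) g with
  | AND i j => L (ninputs phi + g).+1 0%N - L i.+1 j.+1
  | NOT i => L (ninputs phi + g).+1 0%N + L i.+1 0%N - L 0%N 0%N
  end.

Lemma emit_unknown (F : fieldType) N p phi T cp s (a : nat -> F) t ie le q v i l q0 (v0 : nat)
    row col (k := (size T * Dn N * N.+1 * N.+1)%N) : (1 < N)%N ->
  ready N p phi T cp s -> extends s t ->
  (forall d, eval ie (update t 27 0 d) = i) -> (forall d, eval le (update t 27 0 d) = l) ->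
  (forall d, eval q (update t 27 0 d) = q0) -> (forall d, eval v (update t 27 0 d) = v0) ->
  (t 20 0 < size T)%N -> (t 21 0 < Dn N)%N -> (i <= N)%N -> (l <= N)%N ->
  (q0 < N.+1 * N.+1 + N.+1 + (log_floor N).+1 * (log_floor N).+1 * N.+1)%N ->
  (row < mx_order N)%N -> (col < mx_order N)%N ->
  Lam (mx_order N) k a (emit (unknown ie le) q v) t row col
  = if band N (t 20 0%N) (t 21 0%N) q0 row col
    then a (param N (t 20 0%N) (t 21 0%N) i l) * v0%:R else 0.
Proof.
move=> N1 r e hi hl hq hv xT sD iN lN qb rowm colm.
apply: (Lam_emit _ r) => //.
- move=> d; have e' : extends s (update t 27 0 d) by apply: extends_update.
  by rewrite (eval_param _ _ _ _ r e') hi hl.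
- exact: leq_trans xT (size_table r).
- exact: leq_trans sD (Dn_le_Ds N).
- exact: param_lt.
- apply: leq_trans (toeplitz_band_fits N1); rewrite -addSn leq_add2r -addnS.
  by rewrite leq_add2l.
- exact: log_floor_le.
Qed.

Lemma Lam_sym (F : fieldType) N p phi T cp s (a : nat -> F) t row col
    (k := (size T * Dn N * N.+1 * N.+1)%N) (L := fun i l => a (param N (t 20 0%N) (t 21 0%N) i l)) :
  (1 < N)%N -> (0 < p)%N -> p%:R = 0 :> F ->
  ready N p phi T cp s -> extends s t ->
  (t 20 0 < size T)%N -> (t 21 0 < Dn N)%N ->
  (row < mx_order N)%N -> (col < mx_order N)%N ->
  Lam (mx_order N) k a sym_emit t row col
  = \sum_(i < N.+1) \sum_(l < N.+1)
      if band N (t 20 0%N) (t 21 0%N) (i * N.+1 + l) row col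
      then L i l - L l (if i == l then 0%N else i) else 0.
Proof.
move=> N1 p0 pF r e xT sD rowm colm; rewrite Lam_for (eval_vn1 r e).
apply: eq_bigr => i _.
have e1 : extends s (update t 22 0 i) by apply: extends_update.
rewrite Lam_for (eval_vn1 r e1); apply: eq_bigr => l _.
set t2 := update _ 23 0 l.
have e2 : extends s t2 by apply: extends_update.
have qb : (i * N.+1 + l < N.+1 * N.+1 + N.+1 + (log_floor N).+1 * (log_floor N).+1 * N.+1)%N.
  by rewrite -addnA; apply: ltn_addr; apply: radix_lt.
have qv d : eval ($22 * vn1 + $23)%E (update t2 27 0 d) = (i * N.+1 + l)%N.
  have e3 : extends s (update t2 27 0 d) by apply: extends_update.
  by transitivity (i * eval vn1 (update t2 27 0 d) + l)%N; last rewrite (eval_vn1 r e3).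
have mv d : eval minus_one (update t2 27 0 d) = (p - 1)%N.
  by rewrite -(ready_p r) -[s 0 2](e2 0%N 2%N isT).
have m1 : (p - 1)%:R = -1 :> F by rewrite natrB // pF sub0r.
rewrite Lam_seq Lam_if.
rewrite (@emit_unknown _ _ _ _ _ _ _ _ _ _ _ _ _ i l _ 1%N _ _ N1 r e2 _ _ qv) ?leq_ord //.
have -> : (eval ($22 - $23 + ($23 - $22))%E t2 != 0%N) = (i != l :> nat).
  by rewrite /t2 /update /= addn_eq0 !subn_eq0 -eqn_leq.
have [il|il] := eqVneq (i : nat) l; rewrite /=.
  rewrite (@emit_unknown _ _ _ _ _ _ _ _ _ _ _ _ _ l 0%N _ _ _ _ N1 r e2 _ _ qv mv) ?leq_ord //.
  rewrite (_ : (t2 20 0) = t 20 0)%N // (_ : (t2 21 0) = t 21 0)%N // mulr1 m1 mulrN1.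
  by case: ifP => _; rewrite ?addr0 // -val_eqE /= il eqxx.
rewrite (@emit_unknown _ _ _ _ _ _ _ _ _ _ _ _ _ l i _ _ _ _ N1 r e2 _ _ qv mv) ?leq_ord //.
rewrite (_ : (t2 20 0) = t 20 0)%N // (_ : (t2 21 0) = t 21 0)%N // mulr1 m1 mulrN1.
by case: ifP => _; rewrite ?addr0 // -val_eqE /= (negPf il).
Qed.

Lemma Lam_circuit (F : fieldType) N p phi T cp s (a : nat -> F) t row col
    (k := (size T * Dn N * N.+1 * N.+1)%N) (L := fun i l => a (param N (t 20 0%N) (t 21 0%N) i l)) :
  (1 < N)%N -> (0 < p)%N -> p%:R = 0 :> F -> (circuit_size phi <= N)%N ->
  ready N p phi T cp s -> extends s t ->
  (t 20 0 < size T)%N -> (t 21 0 < Dn N)%N ->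
  (row < mx_order N)%N -> (col < mx_order N)%N ->
  Lam (mx_order N) k a circuit_emit t row col
  = \sum_(g < size (gates phi))
      (if band N (t 20 0%N) (t 21 0%N) (circuit_offset N + 1 + g) row col
       then circuit_form phi L g else 0)
    + (if band N (t 20 0%N) (t 21 0%N) (circuit_offset N) row col
       then L (out phi).+1 0%N - L 0%N 0%N else 0).
Proof.
move=> N1 p0 pF phiN r e xT sD rowm colm; rewrite Lam_seq.
have m1 : (p - 1)%:R = -1 :> F by rewrite natrB // pF sub0r.
have circ_lt g : (g <= N)%N ->
    (circuit_offset N + g < N.+1 * N.+1 + N.+1 + (log_floor N).+1 * (log_floor N).+1 * N.+1)%N.
  by move=> gN; rewrite -addnA ltn_add2l ltn_addr.
have outN : ((out phi).+1 <= N)%N by apply: leq_trans (out_ok phi) phiN.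
congr (_ + _).
  rewrite Lam_for.
  have -> : eval (0.@#5) t = size (gates phi) by rewrite /= e // (ready_size r).
  apply: eq_bigr => g _; set t1 := update _ _ _ _.
  have e1 : extends s t1 by apply: extends_update.
  have gN : (1 + g <= N)%N.
    by rewrite add1n (leq_trans (ltn_ord g)) // (leq_trans _ phiN) // leq_addl.
  have wN : ((ninputs phi + g).+1 <= N)%N.
    by apply: leq_trans phiN; rewrite ltn_add2l.
  have readN h : (h < ninputs phi + g)%N -> (h.+1 <= N)%N.
    by move=> hw; apply: leq_trans wN; apply: leqW.
  have qv d : eval (circuit_base + #1 + $28)%E (update t1 27 0 d) = (circuit_offset N + 1 + g)%N.
    have e2 : extends s (update t1 27 0 d) by apply: extends_update.
    by rewrite /circuit_offset -(eval_vn1 r e2).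
  have mv d : eval minus_one (update t1 27 0 d) = (p - 1)%N.
    by rewrite -(ready_p r) -[s 0 2](e1 0%N 2%N isT).
  have gf j d : (j <= 2)%N -> eval (gate_field j) (update t1 27 0 d)
      = nth 0%N (code_gate (nth (NOT 0) (gates phi) g)) j.
    move=> j2; rewrite -[LHS]/(t1 0 (6 + 3 * g + j))%N e1 //.
    by have [//|] := ready_gate r j (ltn_ord g); rewrite ltnNge j2.
  have kv d : eval (0.@#3 + $28 + #1)%E (update t1 27 0 d) = (ninputs phi + g).+1.
    rewrite -[LHS]/(t1 0 3 + g + 1)%N e1 // (ready_inputs r) addn1 //.
  have qlt := circ_lt _ gN; rewrite addnA in qlt.
  have gw := gates_wf_nth (gates_ok phi) (ltn_ord g).
  have tx : (t1 20 0 = t 20 0)%N by [].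
  have ts : (t1 21 0 = t 21 0)%N by [].
  rewrite Lam_seq Lam_if.
  rewrite (@emit_unknown _ _ _ _ _ _ _ _ _ _ _ _ _ (ninputs phi + g).+1 0%N _ 1%N _ _ N1 r e1 kv _ qv) //.
  have -> : eval (gate_field 0) t1 = nth 0%N (code_gate (nth (NOT 0) (gates phi) g)) 0.
    exact: (gf 0%N 0%N isT).
  rewrite /circuit_form; move: (gf 1%N ^~ isT) (gf 2%N ^~ isT) gw.
  case: (nth _ _ g) => [i j|i] /= gf1 gf2.
    case/andP => iw jw.
    have iv d : eval (gate_field 1 + #1)%E (update t1 27 0 d) = i.+1 by rewrite -(gf1 d) /= addn1.
    have jv d : eval (gate_field 2 + #1)%E (update t1 27 0 d) = j.+1 by rewrite -(gf2 d) /= addn1.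
    rewrite (@emit_unknown _ _ _ _ _ _ _ _ _ _ _ _ _ i.+1 j.+1 _ _ _ _ N1 r e1 iv jv qv mv) ?readN //.
    by rewrite tx ts; case: ifP => _; rewrite ?addr0 // mulr1 m1 mulrN1.
  move=> iw.
  have iv d : eval (gate_field 1 + #1)%E (update t1 27 0 d) = i.+1 by rewrite -(gf1 d) /= addn1.
  rewrite Lam_seq (@emit_unknown _ _ _ _ _ _ _ _ _ _ _ _ _ i.+1 0%N _ 1%N _ _ N1 r e1 iv _ qv) ?readN //.
  rewrite (@emit_unknown _ _ _ _ _ _ _ _ _ _ _ _ _ 0%N 0%N _ _ _ _ N1 r e1 _ _ qv mv) //.
  by rewrite tx ts; case: ifP => _; rewrite ?addr0 // !mulr1 m1 mulrN1 addrA.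
have qv d : eval circuit_base (update t 27 0 d) = circuit_offset N.
  have e2 : extends s (update t 27 0 d) by apply: extends_update.
  by rewrite /circuit_offset -(eval_vn1 r e2).
have mv d : eval minus_one (update t 27 0 d) = (p - 1)%N.
  by rewrite -(ready_p r) -[s 0 2](e 0%N 2%N isT).
have ov d : eval (0.@#4 + #1)%E (update t 27 0 d) = (out phi).+1.
  by rewrite -[LHS]/(t 0 4 + 1)%N e // (ready_out r) addn1.
have qlt := circ_lt _ (leq0n N); rewrite addn0 in qlt.
rewrite Lam_seq (@emit_unknown _ _ _ _ _ _ _ _ _ _ _ _ _ (out phi).+1 0%N _ 1%N _ _ N1 r e ov _ qv) //.
rewrite (@emit_unknown _ _ _ _ _ _ _ _ _ _ _ _ _ 0%N 0%N _ _ _ _ N1 r e _ _ qv mv) //.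
by case: ifP => _; rewrite ?addr0 // mulr1 m1 mulrN1.
Qed.

Local Close Scope ring_scope.

Lemma shifted_code_in N p phi T cp s x k : 1 < N -> ready N p phi T cp s ->
  x < cp -> k <= log_floor N -> nth 0 T x + var_code N k \in T.
Proof.
move=> N1 r xcp kR; apply/(ready_codes r).
have R0 := log_floor_gt0 N1.
suff H : form_code N (log_floor N) (log_floor N).-1 (nth 0 T x).
  by have := word_codeS (Ordinal (kR : k < (log_floor N).+1)) H; rewrite (prednK R0).
apply/(ready_cp_codes r); rewrite -(nth_take 0 xcp) mem_nth // size_take_min.
by rewrite (minn_idPl (ready_cp_le r)).
Qed.

Local Open Scope ring_scope.

Definition exchange_term (F : fieldType) (N : nat) (T : seq nat) (a : nat -> F)
    (x s j k i m : nat) : F :=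
  if (m <= s)%N && (s - m < Dn N)%N then
    (node j)%:R ^+ m * a (param N (index (nth 0%N T x + var_code N k)%N T) (s - m) i m)
    - (node k)%:R ^+ m * a (param N (index (nth 0%N T x + var_code N j)%N T) (s - m) i m)
  else 0.

Lemma Lam_exchange (F : fieldType) N p phi T cp s (a : nat -> F) t row col
    (k := (size T * Dn N * N.+1 * N.+1)%N) (R1 := (log_floor N).+1) :
  (1 < N)%N -> (0 < p)%N -> p%:R = 0 :> F ->
  ready N p phi T cp s -> extends s t ->
  (t 20 0 < cp)%N -> (t 21 0 < Ds N)%N ->
  (row < mx_order N)%N -> (col < mx_order N)%N ->
  Lam (mx_order N) k a exchange_emit t row col
  = \sum_(j < R1) \sum_(h < R1) \sum_(i < N.+1) \sum_(m < N.+1)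
      if band N (t 20 0%N) (t 21 0%N) (exchange_offset N j h i) row col
      then exchange_term N T a (t 20 0%N) (t 21 0%N) j h i m else 0.
Proof.
move=> N1 p0 pF r e xcp sD rowm colm.
have R1E t' : extends s t' -> eval ($2 + #1)%E t' = R1.
  by move=> e'; rewrite /= e' // (ready_R r) addn1.
rewrite Lam_for (R1E _ e); apply: eq_bigr => j _.
set t1 := update _ _ _ _; have e1 : extends s t1 by apply: extends_update.
rewrite Lam_for (R1E _ e1); apply: eq_bigr => h _.
set t2 := update _ _ _ _; have e2 : extends s t2 by apply: extends_update.
rewrite Lam_for (eval_vn1 r e2); apply: eq_bigr => i _.
set t3 := update _ _ _ _; have e3 : extends s t3 by apply: extends_update.
rewrite Lam_for (eval_vn1 r e3); apply: eq_bigr => m _.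
set t4 := update _ _ _ _; have e4 : extends s t4 by apply: extends_update.
set x := t 20 0%N; set sg := t 21 0%N.
rewrite Lam_if.
have -> : (eval ($21 + #1 - $26)%E t4 != 0%N) = (m <= sg)%N.
  by rewrite -lt0n -[eval _ _]/(sg + 1 - m)%N subn_gt0 addn1 ltnS.
rewrite Lam_if Lam_skip.
have -> : (eval (vDn - ($21 - $26))%E t4 != 0%N) = (sg - m < Dn N)%N.
  by rewrite -lt0n -(eval_vDn r e4) -[RHS]subn_gt0.
rewrite /exchange_term; case: (leqP m sg) => ms /=; last by case: ifP.
case: ifP => sD'; last by case: ifP.
set q := (circuit_base + vn1 + ($24 * ($2 + #1) + $25) * vn1 + $22)%E.
have qv d : eval q (update t4 27 0 d) = exchange_offset N j h i.
  have e5 : extends s (update t4 27 0 d) by apply: extends_update.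
  transitivity (let n := eval vn1 (update t4 27 0 d) in
    n * n + n + (j * eval ($2 + #1)%E (update t4 27 0 d) + h) * n + i)%N; first by [].
  by rewrite (R1E _ e5) (eval_vn1 r e5).
have qlt : (N.+1 + exchange_offset N j h i + log_floor N < mx_order N)%N.
  apply: leq_trans (toeplitz_band_fits N1); rewrite -addSn leq_add2r -addnS leq_add2l.
  rewrite /exchange_offset -addnA -addnS leq_add2l.
  by apply: radix_lt => //; apply: radix_lt.
have xC : (x < 'C(2 * log_floor N, log_floor N))%N.
  by apply: leq_trans (size_table r); apply: leq_trans (ready_cp_le r).
have idx (b : nat) d ke : (b <= log_floor N)%N -> eval ke (update t4 27 0 d) = b ->
    eval (shifted_unknown ke) (update t4 27 0 d)
    = param N (index (nth 0%N T x + var_code N b)%N T) (sg - m) i m.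
  move=> bR kb; have e5 : extends s (update t4 27 0 d) by apply: extends_update.
  rewrite /shifted_unknown (eval_param _ _ _ _ r e5).
  have -> : eval (9.@(8.@($20) + 5.@ke) - #1)%E (update t4 27 0 d)
     = index (nth 0%N T x + var_code N b)%N T.
    transitivity (t4 9 (t4 8 x + t4 5 b) - 1)%N; first by rewrite -kb.
    rewrite !e4 // (ready_code r bR) (tab_nth (ready_table r)); last first.
      by apply: leq_trans xcp (ready_cp_le r).
    by rewrite (tab_index (ready_table r)) (shifted_code_in N1 r xcp bR) subn1.
  by [].
have par_lt (b : nat) : (b <= log_floor N)%N ->
    (param N (index (nth 0%N T x + var_code N b)%N T) (sg - m) i m < k)%N.
  move=> bR; apply: param_lt; rewrite ?leq_ord // index_mem.
  exact: (shifted_code_in N1 r xcp bR).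
have nodeE (b : 'I_R1) : (node b ^ m %% p)%:R = (node b)%:R ^+ m :> F.
  by rewrite natr_mod // natrX.
have jR : (j <= log_floor N)%N by rewrite -ltnS.
have hR : (h <= log_floor N)%N by rewrite -ltnS.
have gv d : eval (6.@($24 * vn1 + $26))%E (update t4 27 0 d) = (node j ^ m %% p)%N.
  have e5 : extends s (update t4 27 0 d) by apply: extends_update.
  transitivity (t4 6 (j * eval vn1 (update t4 27 0 d) + m))%N; first by [].
  by rewrite (eval_vn1 r e5) e4 // (ready_node r jR) ?leq_ord.
have gv' d : eval (vp - 6.@($25 * vn1 + $26))%E (update t4 27 0 d) = (p - node h ^ m %% p)%N.
  have e5 : extends s (update t4 27 0 d) by apply: extends_update.
  transitivity (t4 0 2 - t4 6 (h * eval vn1 (update t4 27 0 d) + m))%N; first by [].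
  by rewrite (eval_vn1 r e5) !e4 // (ready_node r hR) ?leq_ord // (ready_p r).
rewrite Lam_seq.
rewrite (Lam_emit a r e4 (fun d => idx h d (cell 25) hR erefl) qv gv) ?par_lt ?log_floor_le //.
rewrite (Lam_emit a r e4 (fun d => idx j d (cell 24) jR erefl) qv gv') ?par_lt ?log_floor_le //.
rewrite -/(band N x sg (exchange_offset N j h i) row col).
case: ifP => _; rewrite ?addr0 // nodeE natrB ?nodeE ?pF; last by rewrite ltnW // ltn_pmod.
by rewrite sub0r mulrN mulrC [X in _ - X]mulrC.
Qed.

(** * Toeplitz bands and the constraints that they carry *)

Lemma mxrank_mxsub_le (F : fieldType) m n m' n' (A : 'M[F]_(m, n))
    (f : 'I_m' -> 'I_m) (g : 'I_n' -> 'I_n) : (\rank (mxsub f g A) <= \rank A)%N.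
Proof.
have -> : mxsub f g A = rowsub f (colsub g A) by apply/matrixP => i j; rewrite !mxE.
apply: leq_trans (mxrankS (rowsub_sub _ _)) _.
rewrite -mxrank_tr -[X in (_ <= X)%N]mxrank_tr.
have -> : (colsub g A)^T = rowsub g A^T by apply/matrixP => i j; rewrite !mxE.
exact: mxrankS (rowsub_sub _ _).
Qed.

(** Take the least q with [e q != 0]. The R+1 columns from q on cut a triangular square out of the
    band, with [e q] along its diagonal, so it is invertible whatever the later values are. *)
Lemma toeplitz_rank (F : fieldType) m n R (A : 'M[F]_(m, n))
    (f : 'I_R.+1 -> 'I_m) (e : nat -> F) (Q : nat) (g : nat -> 'I_n) :
  (forall d c, (c < Q + R)%N -> A (f d) (g c) = if (d <= c)%N then e (c - d)%N else 0) ->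
  (exists2 q, (q < Q)%N & e q != 0) -> (R < \rank A)%N.
Proof.
move=> Afg [q0 q0Q eq0].
have ex : exists q, (q < Q)%N && (e q != 0) by exists q0; rewrite q0Q.
case: (ex_minnP ex) => q /andP[qQ eq] qmin.
apply: leq_trans (mxrank_mxsub_le A f (fun d : 'I_R.+1 => g (q + d)%N)).
set Y := mxsub _ _ _; rewrite -mxrank_tr.
have YE i j : Y i j = if (i <= q + j)%N then e (q + j - i)%N else 0.
  by rewrite mxE Afg //; have := ltn_ord j; lia.
suff : Y^T \in unitmx by move=> u; rewrite mxrank_unit.
rewrite unitmxE det_trig; last first.
  apply/is_trig_mxP => i j ij; rewrite mxE YE; case: leqP => // h.
  have [//|nz] := eqVneq (e (q + i - j)%N) 0.
  have : (q <= q + i - j)%N by apply: qmin; rewrite nz andbT; lia.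
  lia.
rewrite unitfE; apply/prodf_neq0 => i _.
by rewrite mxE YE leq_addl addnK.
Qed.

Lemma sum_pick (F : fieldType) n (G : nat -> F) i :
  (forall j, (j < n)%N -> j != i -> G j = 0) ->
  \sum_(j < n) G j = if (i < n)%N then G i else 0.
Proof.
move=> H; case: ltnP => iN; last first.
  by apply: big1 => j _; apply: H => //; rewrite neq_ltn (leq_trans (ltn_ord j)).
rewrite (bigD1 (Ordinal iN)) //= big1 ?addr0 // => j /negPf nj.
by apply: H; rewrite // -val_eqE /= in nj *; rewrite nj.
Qed.

Lemma sum_pick2 (F : fieldType) n1 n2 (G : nat -> nat -> F) i1 i2 :
  (forall j1 j2, (j1 < n1)%N -> (j2 < n2)%N -> ~~ ((j1 == i1) && (j2 == i2)) -> G j1 j2 = 0) ->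
  \sum_(j1 < n1) \sum_(j2 < n2) G j1 j2 = if (i1 < n1)%N && (i2 < n2)%N then G i1 i2 else 0.
Proof.
move=> H; rewrite (@sum_pick _ n1 (fun j1 => \sum_(j2 < n2) G j1 j2) i1).
  case: ltnP => //= h1; rewrite (@sum_pick _ n2 (G i1) i2) // => j2 j2n ne.
  by apply: H; rewrite ?negb_and ?ne ?orbT.
by move=> j1 j1n ne; apply: big1 => j2 _; apply: H => //; rewrite (negPf ne).
Qed.

Definition sym_constraint (F : fieldType) (N : nat) (L : nat -> nat -> F) (q : nat) : F :=
  \sum_(i < N.+1) \sum_(l < N.+1)
     if q == (i * N.+1 + l)%N then L i l - L l (if i == l then 0%N else i) else 0.

Definition circuit_constraint (F : fieldType) (N : nat) (phi : circuit)
    (L : nat -> nat -> F) (q : nat) : F :=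
  \sum_(g < size (gates phi))
      (if q == (circuit_offset N + 1 + g)%N then circuit_form phi L g else 0)
  + (if q == circuit_offset N then L (out phi).+1 0%N - L 0%N 0%N else 0).

Definition exchange_constraint (F : fieldType) (N : nat) (T : seq nat) (a : nat -> F)
    (x s q : nat) : F :=
  \sum_(j < (log_floor N).+1) \sum_(h < (log_floor N).+1) \sum_(i < N.+1) \sum_(m < N.+1)
     if q == exchange_offset N j h i then exchange_term N T a x s j h i m else 0.

(** The three families share one band and are told apart by offsets alone: symmetry and Booleanity
    below $(N+1)^2$, the circuit in the next N+1 places, exchange above. *)
Definition constraint (F : fieldType) (N : nat) (phi : circuit) (T : seq nat) (cp : nat)
    (a : nat -> F) (x s q : nat) : F :=
  (if (x < size T)%N && (s < Dn N)%N then
     sym_constraint N (fun i l => a (param N x s i l)) q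
     + circuit_constraint N phi (fun i l => a (param N x s i l)) q
   else 0)
  + (if (x < cp)%N && (s < Ds N)%N then exchange_constraint N T a x s q else 0).

Definition main_part (F : fieldType) (N : nat) (T : seq nat) (a : nat -> F) (row col : nat) : F :=
  \sum_(x < size T) \sum_(s < Dn N) \sum_(i < N.+1) \sum_(l < N.+1)
    if (row == group_row N x s i) && (col == l) then a (param N x s i l) else 0.

Lemma sum_if_distr (F : fieldType) (I : finType) (b : bool) (G : I -> F) :
  (if b then \sum_i G i else 0) = \sum_i (if b then G i else 0).
Proof. by case: b; rewrite // big1. Qed.

Lemma add_if_distr (F : fieldType) (b : bool) (u v : F) :
  (if b then u + v else 0) = (if b then u else 0) + (if b then v else 0).
Proof. by case: b; rewrite // addr0. Qed.

Lemma nested_if (F : fieldType) (b c : bool) (u : F) :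
  (if b then (if c then u else 0) else 0) = (if b && c then u else 0).
Proof. by case: b. Qed.

(** The condition for a cell to lie on some diagonal of the group; which one is then read off as the
    column minus [N.+1 + row %% N.+1]. *)
Definition in_band (N x s row col : nat) : bool :=
  [&& row %/ N.+1 == x * Ds N + s, row %% N.+1 <= log_floor N & N.+1 + row %% N.+1 <= col]%N.

Lemma bandE N x s q row col :
  band N x s q row col = in_band N x s row col && (col - (N.+1 + row %% N.+1) == q)%N.
Proof.
rewrite /band /in_band -!andbA; do 2!congr (_ && _).
apply/eqP/andP => [->|[h /eqP<-]]; last lia.
by split; last apply/eqP; lia.
Qed.

Lemma Lam_matrix (F : fieldType) N p phi T cp s (a : nat -> F) row col
    (k := (size T * Dn N * N.+1 * N.+1)%N) :
  (1 < N)%N -> (0 < p)%N -> p%:R = 0 :> F -> (circuit_size phi <= N)%N ->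
  ready N p phi T cp s ->
  (row < mx_order N)%N -> (col < mx_order N)%N ->
  Lam (mx_order N) k a matrix_emit s row col
  = main_part N T a row col
    + ((\sum_(x < size T) \sum_(t < Dn N) if in_band N x t row col then
          sym_constraint N (fun i l => a (param N x t i l)) (col - (N.+1 + row %% N.+1))%N
          + circuit_constraint N phi (fun i l => a (param N x t i l)) (col - (N.+1 + row %% N.+1))%N
        else 0)
      + \sum_(x < cp) \sum_(t < Ds N) if in_band N x t row col then
          exchange_constraint N T a x t (col - (N.+1 + row %% N.+1))%N else 0).
Proof.
move=> N1 p0 pF phiN r rowm colm; have e := extends_refl s.
have cntE t : extends s t -> eval $10 t = size T.
  by move=> e'; rewrite /= e' // (tab_size (ready_table r)).
rewrite !Lam_seq; congr (_ + (_ + _)).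
- rewrite Lam_for cntE //; apply: eq_bigr => x _.
  set t1 := update _ _ _ _; have e1 : extends s t1 by apply: extends_update.
  rewrite Lam_for (eval_vDn r e1); apply: eq_bigr => u _.
  set t2 := update _ _ _ _; have e2 : extends s t2 by apply: extends_update.
  rewrite Lam_for (eval_vn1 r e2); apply: eq_bigr => i _.
  set t3 := update _ _ _ _; have e3 : extends s t3 by apply: extends_update.
  rewrite Lam_for (eval_vn1 r e3); apply: eq_bigr => l _.
  set t4 := update _ _ _ _; have e4 : extends s t4 by apply: extends_update.
  have xC : (x < 'C(2 * log_floor N, log_floor N))%N by apply: leq_trans (size_table r).
  rewrite (@Lam_acc _ _ _ _ _ _ _ _ _ (param N x u i l) (group_row N x u i) l) //.
  + by rewrite mulr1.
  + rewrite (eval_entry _ _ _ r e4) (eval_param _ _ _ _ r e4).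
    have -> // : eval (($20 * vDs + $21) * vn1 + $22)%E t4 = group_row N x u i.
    by rewrite /group_row -(eval_vDs r e4); transitivity ((x * eval vDs t4 + u) * eval vn1 t4 + i)%N;
      last rewrite (eval_vn1 r e4).
  + by apply: param_lt; rewrite ?leq_ord.
  + apply: group_row_lt; rewrite ?leq_ord //; exact: leq_trans (Dn_le_Ds N).
  + apply: leq_trans (toeplitz_band_fits N1); rewrite -addnA.
    by apply: leq_trans (leq_addr _ _).
- rewrite Lam_for cntE //; apply: eq_bigr => x _.
  set t1 := update _ _ _ _; have e1 : extends s t1 by apply: extends_update.
  rewrite Lam_for (eval_vDn r e1); apply: eq_bigr => u _.
  set t2 := update _ _ _ _; have e2 : extends s t2 by apply: extends_update.
  have xT : (t2 20 0 < size T)%N by exact: ltn_ord x.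
  have uD : (t2 21 0 < Dn N)%N by exact: ltn_ord u.
  rewrite Lam_seq (Lam_sym a N1 p0 pF r e2 xT uD) //.
  rewrite (Lam_circuit a N1 p0 pF phiN r e2 xT uD) //.
  rewrite (_ : (t2 20 0) = x)%N // (_ : (t2 21 0) = u)%N // /circuit_constraint [RHS]add_if_distr [X in _ = _ + X]add_if_distr; congr (_ + (_ + _)).
  + rewrite sum_if_distr; apply: eq_bigr => i _; rewrite sum_if_distr; apply: eq_bigr => l _.
    by rewrite nested_if bandE.
  + by rewrite sum_if_distr; apply: eq_bigr => g _; rewrite nested_if bandE.
  + by rewrite nested_if bandE.
rewrite Lam_for (_ : eval $11 s = cp); last exact: (ready_cp r).
apply: eq_bigr => x _.
set t1 := update _ _ _ _; have e1 : extends s t1 by apply: extends_update.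
rewrite Lam_for (eval_vDs r e1); apply: eq_bigr => u _.
set t2 := update _ _ _ _; have e2 : extends s t2 by apply: extends_update.
have xc : (t2 20 0 < cp)%N by exact: ltn_ord x.
have uD : (t2 21 0 < Ds N)%N by exact: ltn_ord u.
rewrite (Lam_exchange a N1 p0 pF r e2 xc uD) //.
rewrite (_ : (t2 20 0) = x)%N // (_ : (t2 21 0) = u)%N //.
rewrite /exchange_constraint; do 4!(rewrite sum_if_distr; apply: eq_bigr => ? _).
by rewrite nested_if bandE.
Qed.

(** * Soundness *)

Lemma group_row_inj N x s i x' s' i' : (s < Ds N)%N -> (s' < Ds N)%N ->
  (i <= N)%N -> (i' <= N)%N -> group_row N x s i = group_row N x' s' i' ->
  [/\ x = x', s = s' & i = i'].
Proof. by move=> sD sD' iN iN' /radix_inj[] // /radix_inj[] // -> -> ->. Qed.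

Lemma main_part_out (F : fieldType) N T (a : nat -> F) row col : (N < col)%N ->
  main_part N T a row col = 0.
Proof.
move=> colN; do 3!(apply: big1 => ? _); apply: big1 => l _; rewrite ifF //.
by apply/negP => /andP[_ /eqP e]; rewrite e leqNgt ltnS leq_ord in colN.
Qed.

Lemma in_band_left N x s row col : (col <= N)%N -> in_band N x s row col = false.
Proof.
move=> colN; apply/negP => /and3P[_ _ h].
by have := leq_trans (leq_trans (leq_addr _ _) h) colN; rewrite ltnn.
Qed.

Lemma main_part_entry (F : fieldType) N T (a : nat -> F) x s i l :
  (s < Ds N)%N -> (i <= N)%N -> (l <= N)%N ->
  main_part N T a (group_row N x s i) l
  = if (x < size T)%N && (s < Dn N)%N then a (param N x s i l) else 0.
Proof.
move=> sD iN lN; rewrite /main_part.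
rewrite (@sum_pick2 _ (size T) (Dn N) (fun x' s' => \sum_(i' < N.+1) \sum_(l' < N.+1)
    if (group_row N x s i == group_row N x' s' i') && (l == l') then a (param N x' s' i' l') else 0) x s).
  case: ifP => // _.
  rewrite (@sum_pick2 _ N.+1 N.+1 (fun i' l' =>
    if (group_row N x s i == group_row N x s i') && (l == l') then a (param N x s i' l') else 0) i l).
    by rewrite !ltnS iN lN !eqxx.
  move=> i' l' iN' lN' ne; rewrite ifF //; apply: contraNF ne => /andP[/eqP e /eqP->].
  by have [] := group_row_inj sD sD iN iN' e => _ _ ->; rewrite !eqxx.
move=> x' s' xT' sD' ne; apply: big1 => i' _; apply: big1 => l' _.
rewrite ifF //; apply: contraNF ne => /andP[/eqP e _].
have [] := group_row_inj sD _ iN (leq_ord i') e; first exact: leq_trans (Dn_le_Ds N).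
by move=> -> -> _; rewrite !eqxx.
Qed.

Lemma in_band_cell N x s d c x' s' : (s < Ds N)%N -> (s' < Ds N)%N -> (d <= N)%N ->
  in_band N x' s' (group_row N x s d) (N.+1 + c)
  = [&& (x' == x) && (s' == s), d <= log_floor N & d <= c]%N.
Proof.
move=> sD sD' dN; rewrite /in_band /group_row divnMDl // divn_small ?ltnS // addn0.
rewrite modnMDl modn_small ?ltnS // leq_add2l; congr (_ && _).
apply/eqP/andP => [/radix_inj[] // -> -> //|[/eqP-> /eqP-> //]].
Qed.

Lemma Lam_entry (F : fieldType) N p phi T cp s (a : nat -> F) x u i l
    (k := (size T * Dn N * N.+1 * N.+1)%N) :
  (1 < N)%N -> (0 < p)%N -> p%:R = 0 :> F -> (circuit_size phi <= N)%N ->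
  ready N p phi T cp s -> (x < 'C(2 * log_floor N, log_floor N))%N -> (u < Ds N)%N ->
  (i <= N)%N -> (l <= N)%N ->
  Lam (mx_order N) k a matrix_emit s (group_row N x u i) l
  = if (x < size T)%N && (u < Dn N)%N then a (param N x u i l) else 0.
Proof.
move=> N1 p0 pF phiN r xC uD iN lN.
have lm : (l < mx_order N)%N.
  by apply: leq_trans (toeplitz_band_fits N1); rewrite -addnA ltnS (leq_trans lN) // leq_addr.
rewrite (Lam_matrix a N1 p0 pF phiN r) ?group_row_lt // main_part_entry //.
rewrite [X in _ + (X + _)]big1 ?[X in _ + (_ + X)]big1 ?addr0 // => y _; apply: big1 => t _;
  by rewrite in_band_left.
Qed.

Lemma Lam_cell (F : fieldType) N p phi T cp s (a : nat -> F) x u d c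
    (k := (size T * Dn N * N.+1 * N.+1)%N) :
  (1 < N)%N -> (0 < p)%N -> p%:R = 0 :> F -> (circuit_size phi <= N)%N ->
  ready N p phi T cp s -> (x < 'C(2 * log_floor N, log_floor N))%N -> (u < Ds N)%N ->
  (d <= N)%N -> (N.+1 + c < mx_order N)%N ->
  Lam (mx_order N) k a matrix_emit s (group_row N x u d) (N.+1 + c)
  = if (d <= log_floor N)%N && (d <= c)%N then constraint N phi T cp a x u (c - d) else 0.
Proof.
move=> N1 p0 pF phiN r xC uD dN cm.
rewrite (Lam_matrix a N1 p0 pF phiN r) ?group_row_lt // main_part_out ?leq_addr // add0r.
have -> : (N.+1 + c - (N.+1 + group_row N x u d %% N.+1) = c - d)%N.
  by rewrite /group_row modnMDl modn_small ?ltnS // subnDl.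
rewrite /constraint [RHS]add_if_distr; congr (_ + _).
  rewrite (@sum_pick2 _ (size T) (Dn N) (fun x' t => if in_band N x' t (group_row N x u d) (N.+1 + c)
    then sym_constraint N (fun i l => a (param N x' t i l)) (c - d)
      + circuit_constraint N phi (fun i l => a (param N x' t i l)) (c - d) else 0) x u).
    case: ifP => h; last by case: ifP.
    by rewrite in_band_cell // !eqxx.
  move=> x' u' x'T u'D ne; rewrite in_band_cell ?(negPf ne) //.
  exact: leq_trans u'D (Dn_le_Ds N).
rewrite (@sum_pick2 _ cp (Ds N) (fun x' t => if in_band N x' t (group_row N x u d) (N.+1 + c)
    then exchange_constraint N T a x' t (c - d) else 0) x u).
  case: ifP => h; last by case: ifP.
  by rewrite in_band_cell // !eqxx.
by move=> x' u' x'T u'D ne; rewrite in_band_cell ?(negPf ne).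
Qed.

Definition constraint_count (N : nat) : nat :=
  N.+1 * N.+1 + N.+1 + (log_floor N).+1 * (log_floor N).+1 * N.+1.

Definition basis_mx (p N : nat) (s : state) (J : nat) : 'M['F_p]_(mx_order N) :=
  \matrix_(row, col) (accf matrix_emit s (2 + (J * mx_order N + row) * mx_order N + col)%N)%:R.

Definition combination (p N : nat) (s : state) k (a : nat -> 'F_p) : 'M['F_p]_(mx_order N) :=
  \sum_(J < k) a J *: basis_mx p N s J.

Lemma combinationE p N s k (a : nat -> 'F_p) row col :
  combination N s k a row col = Lam (mx_order N) k a matrix_emit s row col.
Proof. by rewrite summxE; apply: eq_bigr => J _; rewrite !mxE. Qed.

Lemma constraint_rank p N phi T cp s (a : nat -> 'F_p) x u q
    (k := (size T * Dn N * N.+1 * N.+1)%N) :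
  (1 < N)%N -> prime p -> (circuit_size phi <= N)%N ->
  ready N p phi T cp s -> (x < 'C(2 * log_floor N, log_floor N))%N -> (u < Ds N)%N ->
  (q < constraint_count N)%N -> constraint N phi T cp a x u q != 0 ->
  (log_floor N < \rank (combination N s k a))%N.
Proof.
move=> N1 pp phiN r xC uD qQ nz.
have pF : p%:R = 0 :> 'F_p by apply: pchar_Fp_0.
have RN (d : 'I_(log_floor N).+1) : (d <= N)%N by apply: leq_trans (leq_ord d) (log_floor_le N).
have colm c : (c < constraint_count N + log_floor N)%N -> (N.+1 + c < mx_order N)%N.
  move=> h; apply: leq_trans (toeplitz_band_fits N1).
  by rewrite -addnA -addnS leq_add2l.
have m0 : (0 < mx_order N)%N by apply: leq_trans (toeplitz_band_fits N1).
pose f (d : 'I_(log_floor N).+1) : 'I_(mx_order N) := Ordinal (group_row_lt xC uD (RN d)).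
pose g c : 'I_(mx_order N) := insubd (Ordinal m0) (N.+1 + c)%N.
apply: (@toeplitz_rank _ _ _ _ _ f (constraint N phi T cp a x u) (constraint_count N) g).
  move=> d c cQ; rewrite combinationE /f /g val_insubd colm //.
  rewrite (Lam_cell a N1 (prime_gt0 pp) pF phiN r) ?colm //.
  by rewrite leq_ord.
by exists q.
Qed.

Lemma sym_constraint_out (F : fieldType) N (L : nat -> nat -> F) q :
  (circuit_offset N <= q)%N -> sym_constraint N L q = 0.
Proof.
move=> h; apply: big1 => i _; apply: big1 => l _; rewrite ifF //.
by apply: contraTF h => /eqP->; rewrite -ltnNge radix_lt.
Qed.

Lemma sym_constraint_at (F : fieldType) N (L : nat -> nat -> F) i l :
  (i <= N)%N -> (l <= N)%N ->
  sym_constraint N L (i * N.+1 + l) = L i l - L l (if i == l then 0%N else i).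
Proof.
move=> iN lN; rewrite /sym_constraint.
rewrite (@sum_pick2 _ N.+1 N.+1 (fun i' l' => if (i * N.+1 + l == i' * N.+1 + l')%N
  then L i' l' - L l' (if i' == l' then 0%N else i') else 0) i l).
  by rewrite !ltnS iN lN eqxx.
move=> i' l' iN' lN' ne; rewrite ifF //; apply: contraNF ne => /eqP/radix_inj[] // -> ->.
by rewrite !eqxx.
Qed.

Lemma circuit_constraint_out (F : fieldType) N phi (L : nat -> nat -> F) q :
  (circuit_size phi <= N)%N ->
  (q < circuit_offset N)%N || (circuit_offset N + N.+1 <= q)%N ->
  circuit_constraint N phi L q = 0.
Proof.
move=> phiN h; have GN : (size (gates phi) <= N)%N by apply: leq_trans phiN; apply: leq_addl.
rewrite /circuit_constraint ifF ?addr0; last by apply/negP => /eqP e; move: h; rewrite e; lia.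
apply: big1 => g _; rewrite ifF //; apply/negP => /eqP e.
by move: h; have := ltn_ord g; rewrite e; lia.
Qed.

Lemma circuit_constraint_gate (F : fieldType) N phi (L : nat -> nat -> F) g :
  (g < size (gates phi))%N ->
  circuit_constraint N phi L (circuit_offset N + 1 + g) = circuit_form phi L g.
Proof.
move=> gG; rewrite /circuit_constraint ifF ?addr0; last by apply/negP => /eqP; lia.
rewrite (@sum_pick _ _ (fun g' => if (circuit_offset N + 1 + g == circuit_offset N + 1 + g')%N
  then circuit_form phi L g' else 0) g) ?gG ?eqxx // => g' _ ne.
by rewrite eqn_add2l eq_sym (negPf ne).
Qed.

Lemma circuit_constraint_accept (F : fieldType) N phi (L : nat -> nat -> F) :
  circuit_constraint N phi L (circuit_offset N) = L (out phi).+1 0%N - L 0%N 0%N.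
Proof.
rewrite /circuit_constraint eqxx big1 ?add0r // => g _.
by rewrite ifF //; apply/negP => /eqP; lia.
Qed.

Lemma exchange_constraint_out (F : fieldType) N T (a : nat -> F) x s q :
  (q < circuit_offset N + N.+1)%N -> exchange_constraint N T a x s q = 0.
Proof.
move=> h; do 4!(apply: big1 => ? _); rewrite ifF //; apply/negP => /eqP e.
by move: h; rewrite e /exchange_offset /circuit_offset -addnA ltnNge leq_addr.
Qed.

Lemma exchange_constraint_at (F : fieldType) N T (a : nat -> F) x s j h i :
  (j <= log_floor N)%N -> (h <= log_floor N)%N -> (i <= N)%N ->
  exchange_constraint N T a x s (exchange_offset N j h i)
  = \sum_(m < N.+1) exchange_term N T a x s j h i m.
Proof.
move=> jR hR iN; rewrite /exchange_constraint.
have inj j' h' i' : (h' < (log_floor N).+1)%N -> (i' < N.+1)%N ->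
    exchange_offset N j h i = exchange_offset N j' h' i' -> [/\ j = j', h = h' & i = i'].
  move=> hR' iN'; rewrite /exchange_offset -!addnA => /addnI/addnI.
  by move=> /radix_inj[] // /radix_inj[] // -> -> ->.
rewrite (@sum_pick2 _ _ _ (fun j' h' => \sum_(i' < N.+1) \sum_(m < N.+1)
  if exchange_offset N j h i == exchange_offset N j' h' i'
  then exchange_term N T a x s j' h' i' m else 0) j h).
  rewrite !ltnS jR hR /= (@sum_pick _ _ (fun i' => \sum_(m < N.+1)
    if exchange_offset N j h i == exchange_offset N j h i'
    then exchange_term N T a x s j h i' m else 0) i).
    by rewrite ltnS iN eqxx.
  move=> i' iN' ne; apply: big1 => m _; rewrite ifF //.
  by apply: contraNF ne => /eqP/inj[] // _ _ ->.
move=> j' h' _ hR' ne; apply: big1 => i' _; apply: big1 => m _; rewrite ifF //.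
by apply: contraNF ne => /eqP/inj[] // -> -> _; rewrite !eqxx.
Qed.

Lemma circuit_form_ext (F : fieldType) phi (L L' : nat -> nat -> F) g :
  (g < size (gates phi))%N ->
  (forall i j, (i <= circuit_size phi)%N -> (j <= circuit_size phi)%N -> L i j = L' i j) ->
  circuit_form phi L g = circuit_form phi L' g.
Proof.
move=> gG LL; have gw := gates_wf_nth (gates_ok phi) gG.
have kN : ((ninputs phi + g).+1 <= circuit_size phi)%N by rewrite ltn_add2l.
have rN h : (h < ninputs phi + g)%N -> (h.+1 <= circuit_size phi)%N.
  by move=> hw; apply: leq_trans kN; apply: leqW.
rewrite /circuit_form; move: gw; case: (nth _ _ g) => [i j /andP[iw jw]|i iw] /=.
  by rewrite (LL _ 0%N) // (LL i.+1) ?rN.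
by rewrite (LL _.+1 0%N) // (LL i.+1) ?rN // (LL 0%N).
Qed.

(** Gates read earlier wires only, so the gate equations determine the wires one after another and
    every solution is the computation on its own inputs. *)
Lemma wires_mkseq (W : nat -> bool) n gs :
  gates_wf n gs ->
  (forall g, (g < size gs)%N ->
     W (n + g)%N = gate_value (mkseq W (n + g)) (nth (NOT 0) gs g)) ->
  wires (mkseq W n) gs = mkseq W (n + size gs).
Proof.
elim: gs n => [|h gs IH] n /=; first by rewrite addn0.
case/andP => _ gw H; have := H 0%N isT; rewrite addn0 /= => Wn.
rewrite /wires /= -Wn -mkseqS addnS -addSn; apply: IH => // g gG.
by rewrite addSnnS; apply: (H g.+1).
Qed.

Lemma satisfiable_of_point (F : fieldType) phi (w : nat -> bool) :
  w 0%N -> (forall g, (g < size (gates phi))%N ->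
     circuit_form phi (fun i j => (w i)%:R * (w j)%:R : F) g = 0) ->
  (w (out phi).+1)%:R - 1 = 0 :> F -> satisfiable phi.
Proof.
move=> w0 wg wout.
pose W i := w i.+1.
have sz : size (mkseq W (ninputs phi)) == ninputs phi by rewrite size_mkseq.
exists (Tuple sz); rewrite /satisfies /=.
have b1 (b : bool) : b%:R - 1 = 0 :> F -> b.
  by case: b => //; rewrite sub0r => /eqP; rewrite oppr_eq0 oner_eq0.
rewrite wires_mkseq ?gates_ok //.
  by rewrite nth_mkseq ?(out_ok phi) //; apply: b1.
move=> g gG; have gw := gates_wf_nth (gates_ok phi) gG.
have := wg g gG; rewrite /circuit_form; move: gw.
have one : (w 0%N)%:R = 1 :> F by rewrite w0.
case: (nth _ _ g) => [i j|i] /=.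
  move=> /andP[iw jw]; rewrite one mulr1 !nth_mkseq // -/(W i) -/(W j) -/(W (ninputs phi + g)%N).
  case: (W i); case: (W j); rewrite ?mulr1 ?mulr0 ?mul0r ?subr0; case: (W _) => //= /eqP;
  by rewrite ?sub0r ?oppr_eq0 ?oner_eq0.
move=> iw; rewrite one !mulr1 nth_mkseq // -/(W i) -/(W (ninputs phi + g)%N).
case: (W i); case: (W _) => //= /eqP; rewrite ?addrK ?addr0 ?add0r ?sub0r ?oppr_eq0 ?oner_eq0 //.
Qed.

(** Applying a linear form to these unit tables yields its coefficient matrix, the shape in which
    [boolean_point_of_coefficients] expects equations. *)
Definition indicator (F : fieldType) (i j i0 j0 : nat) : F := ((i == i0) && (j == j0))%:R.

Lemma sum_indicator (F : fieldType) N (L : nat -> nat -> F) i0 j0 :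
  (i0 <= N)%N -> (j0 <= N)%N ->
  \sum_(i < N.+1) \sum_(j < N.+1) indicator F i j i0 j0 * L i j = L i0 j0.
Proof.
move=> iN jN; rewrite (@sum_pick2 _ _ _ (fun i j => indicator F i j i0 j0 * L i j) i0 j0).
  by rewrite !ltnS iN jN /indicator !eqxx mul1r.
by move=> i j _ _ /negPf h; rewrite /indicator h mul0r.
Qed.

Lemma circuit_form_sum (F : fieldType) N phi (L : nat -> nat -> F) g :
  (circuit_size phi <= N)%N -> (g < size (gates phi))%N ->
  \sum_(i < N.+1) \sum_(j < N.+1) circuit_form phi (indicator F i j) g * L i j
  = circuit_form phi L g.
Proof.
move=> phiN gG; have gw := gates_wf_nth (gates_ok phi) gG.
have kN : ((ninputs phi + g).+1 <= N)%N by apply: leq_trans phiN; rewrite ltn_add2l.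
have rN h : (h < ninputs phi + g)%N -> (h.+1 <= N)%N.
  by move=> hw; apply: leq_trans kN; apply: leqW.
rewrite /circuit_form; move: gw; case: (nth _ _ g) => [i j /andP[iw jw]|i iw] /=.
  under eq_bigr => i' _ do under eq_bigr => j' _ do rewrite mulrBl.
  under eq_bigr => i' _ do rewrite sumrB.
  by rewrite sumrB !sum_indicator ?kN ?rN.
under eq_bigr => i' _ do under eq_bigr => j' _ do rewrite mulrBl mulrDl.
under eq_bigr => i' _ do rewrite sumrB big_split /=.
by rewrite sumrB big_split /= !sum_indicator ?kN ?rN.
Qed.

Lemma accept_form_sum (F : fieldType) N (L : nat -> nat -> F) o :
  (o <= N)%N ->
  \sum_(i < N.+1) \sum_(j < N.+1) (indicator F i j o 0%N - indicator F i j 0%N 0%N) * L i j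
  = L o 0%N - L 0%N 0%N.
Proof.
move=> oN; under eq_bigr => i' _ do under eq_bigr => j' _ do rewrite mulrBl.
under eq_bigr => i' _ do rewrite sumrB.
by rewrite sumrB !sum_indicator.
Qed.

Lemma param_surj N cnt J : (J < cnt * Dn N * N.+1 * N.+1)%N ->
  exists x s i l, [/\ (x < cnt)%N, (s < Dn N)%N, (i <= N)%N, (l <= N)%N & J = param N x s i l].
Proof.
move=> Jk; pose y := (J %/ N.+1 %/ N.+1)%N.
exists (y %/ Dn N)%N, (y %% Dn N)%N, (J %/ N.+1 %% N.+1)%N, (J %% N.+1)%N.
split; [by rewrite !ltn_divLR|exact: ltn_pmod|by rewrite -ltnS ltn_mod|by rewrite -ltnS ltn_mod|].
by rewrite /param -!divn_eq.
Qed.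

Lemma pow2_inj p N : prime p -> (2 ^ N < p)%N ->
  injective (fun m : 'I_N.+1 => (2 ^ m)%:R : 'F_p).
Proof.
move=> pp Np m m' /(congr1 (@nat_of_ord _)); rewrite !val_Fp_nat // !modn_small.
- by move/eqP; rewrite eqn_exp2l // => /eqP/val_inj.
- by apply: leq_ltn_trans Np; rewrite leq_exp2l // leq_ord.
by apply: leq_ltn_trans Np; rewrite leq_exp2l // leq_ord.
Qed.

Lemma combination_rank p N phi T cp s (a : nat -> 'F_p)
    (k := (size T * Dn N * N.+1 * N.+1)%N) :
  (1 < N)%N -> prime p -> (2 ^ N < p)%N -> (circuit_size phi <= N)%N ->
  ready N p phi T cp s -> ~ satisfiable phi -> combination N s k a != 0 ->
  (log_floor N < \rank (combination N s k a))%N.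
Proof.
move=> N1 pp Np phiN r unsat nz; rewrite ltnNge; apply/negP => rk; apply: unsat.
(* Rank at most R leaves no violated constraint; the offsets then separate the sums of [constraint]
   into the individual equations. *)
have cz x u q : (x < size T)%N -> (u < Ds N)%N -> (q < constraint_count N)%N ->
    constraint N phi T cp a x u q = 0.
  move=> xT uD qQ; apply/eqP; apply: contraLR rk => h; rewrite -ltnNge.
  by apply: (constraint_rank N1 pp phiN r _ uD qQ h); apply: leq_trans xT (size_table r).
have pF : p%:R = 0 :> 'F_p by apply: pchar_Fp_0.
have R0 := log_floor_gt0 N1.
have exb q : (q < circuit_offset N + N.+1)%N -> (q < constraint_count N)%N.
  by move=> h; apply: leq_trans h (leq_addr _ _).
have czL x u q : (x < size T)%N -> (u < Dn N)%N -> (q < circuit_offset N + N.+1)%N ->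
    sym_constraint N (fun i l => a (param N x u i l)) q
     + circuit_constraint N phi (fun i l => a (param N x u i l)) q = 0.
  move=> xT uD qQ; have := cz x u q xT (leq_trans uD (Dn_le_Ds N)) (exb _ qQ).
  by rewrite /constraint xT uD /= exchange_constraint_out // if_same addr0.
have czC x u q : (x < size T)%N -> (u < Dn N)%N -> (circuit_offset N <= q)%N ->
    (q < circuit_offset N + N.+1)%N ->
    circuit_constraint N phi (fun i l => a (param N x u i l)) q = 0.
  by move=> xT uD q1 q2; have := czL x u q xT uD q2; rewrite sym_constraint_out // add0r.
have GN : (size (gates phi) <= N)%N by apply: leq_trans phiN; apply: leq_addl.
have oN : ((out phi).+1 <= N)%N by apply: leq_trans (out_ok phi) phiN.
have m0 : (0 < mx_order N)%N by apply: leq_trans (toeplitz_band_fits N1).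
have n1m : (N.+1 <= mx_order N)%N.
  by apply: leq_trans (toeplitz_band_fits N1); rewrite -addnA leq_addr.
pose X := colsub (widen_ord n1m) (combination N s k a).
pose row_of x u i : 'I_(mx_order N) := insubd (Ordinal m0) (group_row N x u i).
pose Eqs (e : 'I_N.+1 -> 'I_N.+1 -> 'F_p) :=
  (exists2 g, (g < size (gates phi))%N & forall i j, e i j = circuit_form phi (indicator _ i j) g)
  \/ forall i j, e i j = indicator _ i j (out phi).+1 0%N - indicator _ i j 0%N 0%N.
have LX x u i (l : 'I_N.+1) : (x < size T)%N -> (u < Dn N)%N -> (i <= N)%N ->
    X (row_of x u i) l = a (param N x u i l).
  move=> xT uD iN; have xC := leq_trans xT (size_table r).
  have uDs := leq_trans uD (Dn_le_Ds N).
  rewrite mxE combinationE val_insubd group_row_lt //=.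
  by rewrite (Lam_entry a N1 (prime_gt0 pp) pF phiN r) ?leq_ord // xT uD.
have rkX : (\rank X <= log_floor N)%N.
  by apply: leq_trans rk; apply: (mxrank_mxsub_le _ id).
have [J Jk aJ] : exists2 J, (J < k)%N & a J != 0.
  have [[J aJ]|none] := altP (@existsP _ (fun J : 'I_k => a J != 0)); first by exists J.
  case/eqP: nz; apply: big1 => J _; move/existsPn: none => /(_ J).
  by rewrite negbK => /eqP->; rewrite scale0r.
have [x0 [s0 [i0 [l0 [x0T s0D i0N l0N JE]]]]] := param_surj Jk.
have codes := ready_codes r; have cpcodes := ready_cp_codes r.
have TDs : (Dn N + N <= Ds N)%N by rewrite /Dn /Ds; move: R0; clear; nia.
have Tex : forall x u j h i, (x < cp)%N -> (u < Ds N)%N -> (j <= log_floor N)%N ->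
   (h <= log_floor N)%N -> (i <= N)%N -> \sum_(m < N.+1) exchange_term N T a x u j h i m = 0.
  move=> x u j h i xcp uD jR hR iN.
  have qlt : (exchange_offset N j h i < constraint_count N)%N.
    by rewrite /exchange_offset /constraint_count -addnA -addnS leq_add2l; do 2!(apply: radix_lt => //).
  have xT := leq_trans xcp (ready_cp_le r).
  have qge : (circuit_offset N + N.+1 <= exchange_offset N j h i)%N.
    by rewrite /exchange_offset -addnA leq_addr.
  have := cz x u _ xT uD qlt; rewrite /constraint xcp uD exchange_constraint_at //.
  rewrite sym_constraint_out ?circuit_constraint_out ?qge ?orbT //; last first.
    by apply: leq_trans qge; apply: leq_addr.
  by rewrite addr0 if_same add0r.
(* Exchange relations multiply monomials of degree one below the logarithm, so the logarithm is
   written as a successor to match [boolean_point_of_coefficients]. *)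
move: codes cpcodes rkX Tex R0; case: (log_floor N) => [//|R] codes cpcodes rkX Tex _.
have inT al : form_code N R.+1 R al -> al \in T.
  by move=> h; apply/codes; rewrite -[al]addn0; apply: (word_codeS ord0).
have [||||||b b0 be] := @boolean_point_of_coefficients 'F_p N R cp (Dn N) (Ds N) T
  (fun x u i l => a (param N x u i l)) _ X row_of Eqs (pow2_inj pp Np) TDs
  (fun al h => (codes al).2 h) _ _ _ _ LX rkX _ _.
- by move=> al h; rewrite -in_take ?inT //; apply/cpcodes.
- move=> x u i l xT uD iN lN.
  have h : (i * N.+1 + l < circuit_offset N)%N by apply: radix_lt.
  have := czL x u (i * N.+1 + l)%N xT uD (leq_trans h (leq_addr _ _)).
  rewrite circuit_constraint_out ?h // addr0 sym_constraint_at //.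
  by move/eqP; rewrite subr_eq0 => /eqP.
- move=> e x u + xT uD => -[[g gG eE]|eE].
    under eq_bigr => i _ do under eq_bigr => j _ do rewrite eE.
    rewrite (circuit_form_sum (fun i j => a (param N x u i j)) phiN gG).
    rewrite -(@circuit_constraint_gate _ N) // (czC x u) // -addnA ?leq_addr // ltn_add2l.
    by rewrite add1n ltnS (leq_trans gG).
  under eq_bigr => i _ do under eq_bigr => j _ do rewrite eE.
  rewrite (accept_form_sum (fun i j => a (param N x u i j)) oN).
  by rewrite -(circuit_constraint_accept N phi (fun i j => a (param N x u i j))) (czC x u) // addnS leq_addr.
- move=> x u j h i xcp uD jR hR iN /=; apply/eqP; rewrite -subr_eq0 -sumrB.
  rewrite -[X in _ == X](Tex x u j h i xcp uD jR hR iN); apply/eqP; apply: eq_bigr => m _.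
  by rewrite /exchange_term; case: ifP; rewrite ?subrr.
- exists x0, s0, i0, l0; split=> //; split; first by rewrite -JE.
  by apply/codes; apply: mem_nth.
- exact: tab_uniq (ready_table r).
pose w i := b (inord i).
have w0 : w 0%N by rewrite /w (_ : inord 0 = ord0) //; apply: val_inj; rewrite /= inordK.
have sumw (e : 'I_N.+1 -> 'I_N.+1 -> 'F_p) : \sum_i \sum_j e i j * (b i)%:R * (b j)%:R
    = \sum_(i < N.+1) \sum_(j < N.+1) e i j * ((w i)%:R * (w j)%:R).
  by apply: eq_bigr => i _; apply: eq_bigr => j _; rewrite /w !inord_val mulrA.
apply: (@satisfiable_of_point 'F_p _ w w0).
  move=> g gG; rewrite -(circuit_form_sum (fun i j => (w i)%:R * (w j)%:R : 'F_p) phiN gG) -sumw.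
  by apply: be; left; exists g.
have := be (fun i j => indicator _ i j (out phi).+1 0%N - indicator _ i j 0%N 0%N).
rewrite sumw (accept_form_sum (fun i j => (w i)%:R * (w j)%:R : 'F_p) oN) w0 !mulr1.
by apply; right.
Qed.

(** * Completeness *)

(** Each coefficient stands alone in a cell of the block columns, which the bands do not reach, so
    the combination displays all of them. *)
Lemma combination_free p N phi T cp s (a : nat -> 'F_p)
    (k := (size T * Dn N * N.+1 * N.+1)%N) J :
  (1 < N)%N -> prime p -> (circuit_size phi <= N)%N ->
  ready N p phi T cp s -> combination N s k a = 0 -> (J < k)%N -> a J = 0.
Proof.
move=> N1 pp phiN r c0 Jk.
have [x [u [i [l [xT uD iN lN JE]]]]] := param_surj Jk.
have pF : p%:R = 0 :> 'F_p by apply: pchar_Fp_0.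
have xC := leq_trans xT (size_table r).
have uDs := leq_trans uD (Dn_le_Ds N).
have lm : (l < mx_order N)%N.
  by apply: leq_trans (toeplitz_band_fits N1); rewrite -addnA ltnS (leq_trans lN) // leq_addr.
have rm := group_row_lt xC uDs iN.
have := Lam_entry a N1 (prime_gt0 pp) pF phiN r xC uDs iN lN.
rewrite xT uD /= -JE => <-.
by rewrite -(combinationE _ _ _ (Ordinal rm) (Ordinal lm)) c0 mxE.
Qed.

Lemma radix_digits N n (c c' : nat -> nat) :
  (forall k, (k < n)%N -> (c k < N)%N) -> (forall k, (k < n)%N -> (c' k < N)%N) ->
  (\sum_(k < n) c k * N ^ k = \sum_(k < n) c' k * N ^ k)%N ->
  forall k, (k < n)%N -> c k = c' k.
Proof.
elim: n c c' => [//|n IH] c c' cN cN'; rewrite !big_ord_recl !expn0 !muln1.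
have st (d : nat -> nat) : (\sum_(i < n) d (lift ord0 i) * N ^ lift ord0 i
    = (\sum_(i < n) d i.+1 * N ^ i) * N)%N.
  by rewrite big_distrl; apply: eq_bigr => i _; rewrite /= expnSr mulnA.
rewrite !st ![(_ 0 + _)%N]addnC => /radix_inj[]; rewrite ?cN ?cN' // => e e0.
case=> [//|k] kn; apply: (IH (fun i => c i.+1) (fun i => c' i.+1)) => // i iN.
  exact: cN.
exact: cN'.
Qed.

Lemma code_counts N R (w : seq 'I_R.+1) :
  (\sum_(k <- w) var_code N k
   = \sum_(k < R) count (fun h : 'I_R.+1 => h == k.+1 :> nat) w * N ^ k)%N.
Proof.
transitivity (\sum_(h <- w) \sum_(k < R | h == k.+1 :> nat) N ^ k)%N; last first.
  rewrite (exchange_big_dep xpredT) //=; apply: eq_bigr => k _.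
  by rewrite big_const_seq iter_addn_0 mulnC.
apply: eq_bigr => h _; rewrite /var_code.
have := ltn_ord h; case: (nat_of_ord h) => [|h'] hR; first by rewrite big1.
rewrite (bigD1 (Ordinal (hR : (h' < R)%N))) //= big1 ?addn0 // => k /andP[/eqP[e] /eqP[]].
by apply: val_inj.
Qed.

(** With R below N no exponent overflows its base-N digit, so the code fixes the exponents of
    $y_1,\ldots,y_R$. That of $y_0$ stays invisible and is harmless because [f 0 = 1]. *)
Lemma word_prod (K : comPzRingType) N R (f : nat -> K) (w w' : seq 'I_R.+1) :
  (R < N)%N -> f 0%N = 1 -> (size w <= R)%N -> (size w' <= R)%N ->
  (\sum_(k <- w) var_code N k = \sum_(k <- w') var_code N k)%N ->
  \prod_(k <- w) f k = \prod_(k <- w') f k.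
Proof.
move=> RN f0 sw sw'; rewrite !code_counts => e.
pose cnt (v : seq 'I_R.+1) (k : nat) := count (fun h : 'I_R.+1 => h == k.+1 :> nat) v.
have cN v k : (size v <= R)%N -> (cnt v k < N)%N.
  by move=> sv; apply: leq_ltn_trans RN; apply: leq_trans sv; apply: count_size.
have E (v : seq 'I_R.+1) : \prod_(k <- v) f k = \prod_(k < R) f k.+1 ^+ cnt v k.
  transitivity (\prod_(h <- v) \prod_(k < R | h == k.+1 :> nat) f k.+1).
    apply: eq_bigr => h _.
    have := ltn_ord h; case: (nat_of_ord h) => [|h'] hR; first by rewrite f0 big1.
    rewrite (bigD1 (Ordinal (hR : (h' < R)%N))) //= big1 ?mulr1 // => k /andP[/eqP[h1] /eqP[]].
    by apply: val_inj.
  rewrite (exchange_big_dep xpredT) //=; apply: eq_bigr => k _.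
  by rewrite big_const_seq iter_mulr_1.
rewrite !E; apply: eq_bigr => k _; congr (_ ^+ _).
by apply: (@radix_digits N R (cnt w) (cnt w')) => // i iR; apply: cN.
Qed.

Definition form_poly (F : fieldType) (N : nat) (b : nat -> bool) (k : nat) : {poly F} :=
  \poly_(m < N.+1) ((node k)%:R ^+ m * (b m)%:R).

Lemma form_poly0 (F : fieldType) N (b : nat -> bool) : b 0%N -> form_poly F N b 0 = 1.
Proof.
move=> b0; apply/polyP => -[|m]; rewrite coef_poly coef1 /=; first by rewrite b0 mulr1.
by case: ifP => // _; rewrite expr0n mul0r.
Qed.

Lemma size_form_prod (F : fieldType) N b R (w : seq 'I_R) :
  (size (\prod_(k <- w) form_poly F N b k)%R <= (size w * N).+1)%N.
Proof.
elim: w => [|k w IH]; first by rewrite big_nil size_poly1.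
rewrite big_cons /= mulSn; apply: leq_trans (size_polyMleq _ _) _.
have := size_poly N.+1 (fun m => (node k)%:R ^+ m * (b m)%:R : F).
move: IH; rewrite -/(form_poly F N b k) /=.
move: (size (form_poly _ _ _ _)) (size _) => u v h1 h2; lia.
Qed.

(* pc (y * Dn + t) is the coefficient of tau^t in the value of the y-th monomial
   in the forms at the Boolean point b. *)
Definition monomial_values (F : fieldType) (N : nat) (b : nat -> bool) (T : seq nat)
    (pc : nat -> F) : Prop :=
  forall y t (w : seq 'I_(log_floor N).+1), (y < size T)%N -> (t < Dn N)%N ->
    (size w <= log_floor N)%N -> (\sum_(k <- w) var_code N k)%N = nth 0%N T y ->
    pc (y * Dn N + t)%N = (\prod_(k <- w) form_poly F N b k)`_t.

(** At most one term survives. Writing a sum with an address test, instead of decoding [J], mirrors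
    the way the accumulating loops produce the value. *)
Definition honest (F : fieldType) (N : nat) (b : nat -> bool) (T : seq nat) (pc : nat -> F)
    (J : nat) : F :=
  \sum_(x < size T) \sum_(t < Dn N) \sum_(i < N.+1) \sum_(l < N.+1)
    if J == param N x t i l then pc (x * Dn N + t)%N * (b i)%:R * (b l)%:R else 0.

Definition honest_left (F : fieldType) (N : nat) (b : nat -> bool) (T : seq nat) (pc : nat -> F)
    (row : nat) : F :=
  \sum_(x < size T) \sum_(t < Dn N) \sum_(i < N.+1)
    if row == group_row N x t i then pc (x * Dn N + t)%N * (b i)%:R else 0.

Definition honest_right (F : fieldType) (N : nat) (b : nat -> bool) (col : nat) : F :=
  \sum_(l < N.+1) if col == l then (b l)%:R else 0.

Lemma param_inj N x t i l x' t' i' l' : (t < Dn N)%N -> (t' < Dn N)%N ->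
  (i <= N)%N -> (i' <= N)%N -> (l <= N)%N -> (l' <= N)%N ->
  param N x t i l = param N x' t' i' l' -> [/\ x = x', t = t', i = i' & l = l'].
Proof.
by move=> tD tD' iN iN' lN lN' /radix_inj[] // /radix_inj[] // /radix_inj[] // -> -> -> ->.
Qed.

Lemma honest_param (F : fieldType) N b T (pc : nat -> F) x t i l :
  (x < size T)%N -> (t < Dn N)%N -> (i <= N)%N -> (l <= N)%N ->
  honest N b T pc (param N x t i l) = pc (x * Dn N + t)%N * (b i)%:R * (b l)%:R.
Proof.
move=> xT tD iN lN; rewrite /honest.
rewrite (@sum_pick2 _ (size T) (Dn N) (fun x' t' => \sum_(i' < N.+1) \sum_(l' < N.+1)
  if param N x t i l == param N x' t' i' l' then pc (x' * Dn N + t')%N * (b i')%:R * (b l')%:R else 0) x t).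
  rewrite xT tD (@sum_pick2 _ N.+1 N.+1 (fun i' l' =>
    if param N x t i l == param N x t i' l' then pc (x * Dn N + t)%N * (b i')%:R * (b l')%:R else 0) i l).
    by rewrite !ltnS iN lN eqxx.
  move=> i' l' iN' lN' ne; rewrite ifF //; apply: contraNF ne => /eqP e.
  by have [_ _ -> ->] := param_inj tD tD iN iN' lN lN' e; rewrite !eqxx.
move=> x' t' _ tD' ne; apply: big1 => i' _; apply: big1 => l' _; rewrite ifF //.
apply: contraNF ne => /eqP e.
by have [-> -> _ _] := param_inj tD tD' iN (leq_ord i') lN (leq_ord l') e; rewrite !eqxx.
Qed.

Lemma main_part_honest (F : fieldType) N b T (pc : nat -> F) row col :
  main_part N T (honest N b T pc) row col = honest_left N b T pc row * honest_right F N b col.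
Proof.
rewrite /honest_left mulr_suml; apply: eq_bigr => x _.
rewrite mulr_suml; apply: eq_bigr => t _.
rewrite mulr_suml; apply: eq_bigr => i _.
rewrite mulr_sumr; apply: eq_bigr => l _.
rewrite honest_param ?leq_ord //.
by case: eqP => //= _; case: eqP; rewrite ?mulr0 ?mul0r.
Qed.

Lemma circuit_form_scale (F : fieldType) phi (L : nat -> nat -> F) c g :
  circuit_form phi (fun i j => c * L i j) g = c * circuit_form phi L g.
Proof. by rewrite /circuit_form; case: (nth _ _ g) => [i j|i]; rewrite ?mulrBr ?mulrDr. Qed.

Lemma coef_form_mul (F : fieldType) N b j (A : {poly F}) u :
  (form_poly F N b j * A)`_u
  = \sum_(m < N.+1) if (m <= u)%N then (node j)%:R ^+ m * (b m)%:R * A`_(u - m) else 0.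
Proof.
rewrite /form_poly poly_def mulr_suml coef_sum; apply: eq_bigr => m _.
by rewrite -scalerAl coefZ coefXnM; case: leqP; rewrite ?mulr0.
Qed.

(** Both halves of the relation are $b_i$ times a coefficient of a product of the same forms, so
    they agree by commutativity. *)
Lemma exchange_honest (F : fieldType) N p phi T cp s b (pc : nat -> F) x u j h i :
  (1 < N)%N -> ready N p phi T cp s -> monomial_values N b T pc ->
  (x < cp)%N -> (j <= log_floor N)%N -> (h <= log_floor N)%N -> (i <= N)%N ->
  \sum_(m < N.+1) exchange_term N T (honest N b T pc) x u j h i m = 0.
Proof.
move=> N1 r mv xcp jR hR iN.
have R0 := log_floor_gt0 N1.
have [w sw Tx] : form_code N (log_floor N) (log_floor N).-1 (nth 0%N T x).
  apply/(ready_cp_codes r); rewrite -(nth_take 0%N xcp) mem_nth // size_take_min.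
  by rewrite (minn_idPl (ready_cp_le r)).
pose f := form_poly F N b; pose A := \prod_(k <- w) f k.
have pcE k t : (k <= log_floor N)%N -> (t < Dn N)%N ->
    pc (index (nth 0%N T x + var_code N k)%N T * Dn N + t)%N = (f k * A)`_t.
  move=> kR tD; have kT := shifted_code_in N1 r xcp kR.
  rewrite (mv _ t (Ordinal (kR : (k < (log_floor N).+1)%N) :: w)) ?index_mem //.
  - by rewrite big_cons.
  - by rewrite /= sw prednK.
  by rewrite big_cons /= nth_index // Tx addnC.
(* The table omits powers of t from [Dn N] on; by degree nothing nonzero is lost. *)
have fA k t : (k <= log_floor N)%N -> (Dn N <= t)%N -> (f k * A)`_t = 0.
  move=> kR tD; apply: nth_default; apply: leq_trans tD.
  have := size_form_prod F N b (Ordinal (kR : (k < (log_floor N).+1)%N) :: w).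
  by rewrite big_cons /= sw prednK // /Dn mulnC.
have half k k' : (k <= log_floor N)%N -> (k' <= log_floor N)%N ->
    \sum_(m < N.+1) (if (m <= u)%N && (u - m < Dn N)%N then
      (node k)%:R ^+ m * honest N b T pc
        (param N (index (nth 0%N T x + var_code N k')%N T) (u - m) i m) else 0)
    = (b i)%:R * (f k * (f k' * A))`_u.
  move=> kR kR'; rewrite coef_form_mul mulr_sumr; apply: eq_bigr => m _.
  case: (leqP m u) => mu; rewrite /= ?mulr0 //.
  case: (ltnP (u - m) (Dn N)) => tD; last by rewrite fA // !mulr0.
  rewrite honest_param ?leq_ord // ?pcE // ?index_mem ?(shifted_code_in N1 r) //.
  by ring.
transitivity ((b i)%:R * (f j * (f h * A))`_u - (b i)%:R * (f h * (f j * A))`_u).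
  rewrite -!half // -sumrB; apply: eq_bigr => m _; rewrite /exchange_term.
  by case: ifP; rewrite ?subr0.
by rewrite mulrCA subrr.
Qed.

Lemma constraint_honest (F : fieldType) N p phi T cp s b (pc : nat -> F) x u q :
  (1 < N)%N -> (circuit_size phi <= N)%N -> ready N p phi T cp s ->
  monomial_values N b T pc -> b 0%N ->
  (forall g, (g < size (gates phi))%N ->
     circuit_form phi (fun i j => (b i)%:R * (b j)%:R : F) g = 0) ->
  b (out phi).+1 ->
  constraint N phi T cp (honest N b T pc) x u q = 0.
Proof.
move=> N1 phiN r mv b0 bg bout; rewrite /constraint.
have oN : ((out phi).+1 <= N)%N by apply: leq_trans (out_ok phi) phiN.
case: ifP => [/andP[xT uD]|_]; last first.
  rewrite add0r; case: ifP => [/andP[xcp _]|//].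
  apply: big1 => j _; apply: big1 => h _; apply: big1 => i _; rewrite -sum_if_distr.
  by rewrite (exchange_honest _ N1 r mv xcp) ?leq_ord ?if_same.
have -> : sym_constraint N (fun i l => honest N b T pc (param N x u i l)) q = 0.
  apply: big1 => i _; apply: big1 => l _; case: ifP => // _.
  have ilN : ((if (i : nat) == l then 0 else i) <= N)%N by case: ifP => // _; rewrite leq_ord.
  rewrite !honest_param ?leq_ord // -val_eqE /=.
  case: eqP => [->|_]; last by rewrite mulrAC subrr.
  by rewrite b0; case: (b l); rewrite ?mulr1 ?mulr0 ?mul0r ?subrr.
have -> : circuit_constraint N phi (fun i l => honest N b T pc (param N x u i l)) q = 0.
  rewrite /circuit_constraint !honest_param // bout b0 !mulr1 subrr if_same addr0.
  apply: big1 => g _; case: ifP => // _.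
  rewrite (@circuit_form_ext _ _ _ (fun i j => pc (x * Dn N + u)%N * ((b i)%:R * (b j)%:R))) //.
    by rewrite circuit_form_scale bg // mulr0.
  by move=> i j iN jN; rewrite honest_param ?mulrA // (leq_trans _ phiN).
rewrite !add0r; case: ifP => [/andP[xcp _]|//].
apply: big1 => j _; apply: big1 => h _; apply: big1 => i _; rewrite -sum_if_distr.
by rewrite (exchange_honest _ N1 r mv xcp) ?leq_ord ?if_same.
Qed.

(** At a satisfying point all bands vanish, and the blocks are $b_i b_l$ scaled by monomial
    coefficients, which factor into a part depending on the row and a part depending on the
    column. *)
Lemma combination_honest p N phi T cp s b (pc : nat -> 'F_p)
    (k := (size T * Dn N * N.+1 * N.+1)%N) :
  (1 < N)%N -> prime p -> (circuit_size phi <= N)%N -> ready N p phi T cp s ->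
  monomial_values N b T pc -> b 0%N ->
  (forall g, (g < size (gates phi))%N ->
     circuit_form phi (fun i j => (b i)%:R * (b j)%:R : 'F_p) g = 0) ->
  b (out phi).+1 ->
  combination N s k (honest N b T pc)
  = (\col_(row < mx_order N) honest_left N b T pc row)
      *m (\col_(col < mx_order N) honest_right 'F_p N b col)^T.
Proof.
move=> N1 pp phiN r mv b0 bg bout; have pF : p%:R = 0 :> 'F_p by apply: pchar_Fp_0.
apply/matrixP => row col; rewrite combinationE mxE big_ord1 !mxE -main_part_honest.
rewrite (Lam_matrix _ N1 (prime_gt0 pp) pF phiN r) //.
case: (leqP col N) => colN.
  rewrite [X in _ + (X + _)]big1 ?[X in _ + (_ + X)]big1 ?addr0 // => y _; apply: big1 => t _;
    by rewrite in_band_left.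
have [x [u [d [xC uD dN rowE]]]] : exists x u d, [/\ (x < 'C(2 * log_floor N, log_floor N))%N,
    (u < Ds N)%N, (d <= N)%N & row = group_row N x u d :> nat].
  exists (row %/ N.+1 %/ Ds N)%N, (row %/ N.+1 %% Ds N)%N, (row %% N.+1)%N.
  split; [|exact: ltn_pmod|by rewrite -ltnS ltn_mod|by rewrite /group_row -!divn_eq].
  by rewrite !ltn_divLR //; have := ltn_ord row; rewrite /mx_order -/(Ds N); lia.
rewrite -(Lam_matrix _ N1 (prime_gt0 pp) pF phiN r) // rowE main_part_out //.
rewrite -(subnKC colN) (Lam_cell _ N1 (prime_gt0 pp) pF phiN r) // ?subnKC //.
by rewrite (constraint_honest _ _ _ N1 phiN r) // if_same.
Qed.

(** * The witness program *)

Local Close Scope ring_scope.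

Definition wire_gate_field (j : nat) : expr := 0.@(#6 + #3 * $20 + #j).

Definition wire_input : cmd :=
  CAssign 15 ($20 + #1) (0.@(#6 + #3 * (0.@#5) + $20)).

(** Reducing modulo [#1 + #1] does not alter a product of bits; it keeps the assignment tame, which
    a bare product of two writable cells is not. *)
Definition wire_gate : cmd :=
  CIf (wire_gate_field 0)
    (CAssign 15 (0.@#3 + $20 + #1) (#1 - 15.@(wire_gate_field 1 + #1)))
    (CAssign 15 (0.@#3 + $20 + #1)
       ((15.@(wire_gate_field 1 + #1) * 15.@(wire_gate_field 2 + #1)) %% (#1 + #1))).

Definition wire_phase : cmd :=
  CAssign 15 #0 #1 ;; CFor 20 (0.@#3) wire_input ;; CFor 20 (0.@#5) wire_gate.

Definition wire_value (x : seq bool) (gs : seq gate) (i : nat) : bool :=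
  if i is i'.+1 then nth false (wires x gs) i' else true.

Lemma size_wires x gs : size (wires x gs) = size x + size gs.
Proof.
rewrite /wires; elim: gs x => [|g gs IH] x /=; first by rewrite addn0.
by rewrite IH size_rcons addSnnS.
Qed.

Lemma wires_rcons x gs g :
  wires x (rcons gs g) = rcons (wires x gs) (gate_value (wires x gs) g).
Proof. by rewrite /wires -cats1 foldl_cat. Qed.

Lemma run_wire_phase s phi (x : (ninputs phi).-tuple bool) i :
  s 0 3 = ninputs phi -> s 0 5 = size (gates phi) ->
  (forall g j, g < size (gates phi) ->
    s 0 (6 + 3 * g + j) = nth 0 (code_gate (nth (NOT 0) (gates phi) g)) j \/ 2 < j) ->
  (forall t, t < ninputs phi -> s 0 (6 + 3 * size (gates phi) + t) = nth false x t) ->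
  (forall i, s 15 i = 0) ->
  run wire_phase s 15 i = wire_value x (gates phi) i.
Proof.
move=> s3 s5 sg sx s15.
set s1 := run (CAssign 15 #0 #1) s.
set s2 := run (CFor 20 (0.@#3) wire_input) s1.
pose I j (t : state) := (forall c, t 0 c = s 0 c) /\
  forall i, t 15 i = if i is i'.+1 then (if i' < j then nth false x i' else false) : nat else 1.
have [s20 s215] : I (eval (0.@#3) s1) s2.
  apply: (@run_for I 20 (0.@#3)%E wire_input s1) => //.
    by split=> //= -[|j]; rewrite /s1 /= /update //= s15.
  move=> j t jn t20 [t0 t15]; split=> //= i'; rewrite /update /= t20 !t0 s5 addn1.
  have jn' : j < ninputs phi by rewrite -s3.
  rewrite t15; case: i' => [|i'] //; rewrite eqSS.
  case: eqP => [->|/eqP ne]; first by rewrite sx // ltnSn.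
  by rewrite (ltnS i' j) (leq_eqVlt i' j) (negPf ne).
rewrite [eval _ _]s3 in s215.
pose I' g (t : state) := (forall c, t 0 c = s 0 c) /\
  forall i, t 15 i = wire_value x (take g (gates phi)) i.
have [_ h] : I' (eval (0.@#5) s2) (run (CFor 20 (0.@#5) wire_gate) s2).
  apply: (@run_for I' 20 (0.@#5)%E wire_gate s2) => //.
    split=> [c|j]; first by rewrite /= /update /= s20.
    rewrite /= /update /= s215 take0; case: j => // j /=.
    by case: ltnP => // jn; rewrite nth_default // size_tuple.
  move=> g t gG t20 [t0 t15]; have gG' : g < size (gates phi) by rewrite -s5 -s20.
  split=> [c|j]; first by rewrite update_bank // run_frame // t0.
  have gf j' : j' <= 2 -> eval (wire_gate_field j') t
      = nth 0 (code_gate (nth (NOT 0) (gates phi) g)) j'.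
    move=> j2; rewrite -[LHS]/(t 0 (6 + 3 * t 20 0 + j')) t0 t20.
    by have [//|] := sg g j' gG'; rewrite ltnNge j2.
  have ad : eval (0.@#3 + $20 + #1)%E t = (ninputs phi + g).+1.
    by rewrite -[LHS]/(t 0 3 + t 20 0 + 1) t0 t20 s3 addn1.
  rewrite (take_nth (NOT 0) gG').
  have sw : size (wires x (take g (gates phi))) = ninputs phi + g.
    by rewrite size_wires size_tuple size_take gG'.
  have upd (v : bool) : v = gate_value (wires x (take g (gates phi))) (nth (NOT 0) (gates phi) g) ->
      update t 15 (ninputs phi + g).+1 v 15 j
      = wire_value x (rcons (take g (gates phi)) (nth (NOT 0) (gates phi) g)) j.
    move=> ->; rewrite /update /= t15; case: j => [|j] //=.
    rewrite eqSS wires_rcons nth_rcons sw; case: ltngtP => // jw.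
    by rewrite nth_default // sw ltnW.
  rewrite update_bank // /wire_gate /= -[t 0 _]/(eval (wire_gate_field 0) t) gf //.
  rewrite -[t 0 3 + _ + 1]/(eval (0.@#3 + $20 + #1)%E t) ad.
  rewrite -[t 0 (_ + 1)]/(eval (wire_gate_field 1) t) -[t 0 (_ + 2)]/(eval (wire_gate_field 2) t) !gf //.
  move: upd; case: (nth _ _ g) => [i1 j1|i1] /= upd; rewrite !t15 !addn1 /=.
    rewrite -(upd _ erefl); congr (update _ _ _ _ _ _).
    by case: (nth _ _ i1); case: (nth _ _ j1).
  by rewrite -(upd _ erefl); congr (update _ _ _ _ _ _); case: (nth _ _ i1).
have -> : run wire_phase s = run (CFor 20 (0.@#5) wire_gate) s2 by [].
by rewrite h [eval _ _]/= s20 s5 take_size.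
Qed.

Definition value_cell : expr := (($20 + #1) * vDn + $21)%E.

(** One term of a convolution: the polynomial of a monomial is that of its parent times a form,
    whose m-th coefficient is $z_k^m b_m$. Row [$20 + #1] is meant because position 0, the monomial
    1, is set directly. *)
Definition value_step : cmd :=
  CIf ($21 + #1 - $22)
    (CAssign 14 value_cell
      ((14.@value_cell + 14.@(12.@($20 + #1) * vDn + ($21 - $22))
          * (6.@(13.@($20 + #1) * vn1 + $22) * 15.@($22))) %% modulus))
    CSkip.

Definition value_coef : cmd := CFor 22 vn1 value_step.
Definition value_row : cmd := CFor 21 vDn value_coef.
Definition value_phase : cmd := CAssign 14 #0 #1 ;; CFor 20 ($10 - #1) value_row.

Lemma ready_run N p phi T cp s c : ready N p phi T cp s ->
  all (fun a => a \notin writes c) [:: 0; 2; 4; 5; 6; 8; 9; 10; 11; 12; 13] ->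
  ready N p phi T cp (run c s).
Proof.
case=> r1 r2 r3 r4 r5 r6 r7 r8 r9 r10 [t1 t2 t3 t4 t5 t6 t7] r12 r13 r14 r15 W.
have K b i : b \in [:: 0; 2; 4; 5; 6; 8; 9; 10; 11; 12; 13] -> run c s b i = s b i.
  by move=> h; apply: run_frame; apply: (allP W).
split; rewrite ?K //.
- by move=> g j gG; rewrite K //; apply: r6.
- by move=> k kR; rewrite K ?r9.
- by move=> k m kR mN; rewrite K ?r10.
split; rewrite ?K //.
- by move=> i iT; rewrite K ?t2.
- by move=> v; rewrite K.
by move=> y yT; rewrite !K //; apply: t7.
Qed.

Definition same_but_values (s t : state) : Prop :=
  forall b i, b < 20 -> b != 14 -> t b i = s b i.

Lemma same_update s t x i v : (20 <= x) || (x == 14) ->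
  same_but_values s t -> same_but_values s (update t x i v).
Proof.
move=> hx st b j b20 b14; rewrite update_bank ?st //.
by apply: contraTneq hx => <-; rewrite negb_or b14 andbT -ltnNge.
Qed.

Local Open Scope ring_scope.

Lemma run_value_coef p N phi T cp s (b : nat -> bool) t y u : (1 < N)%N -> prime p ->
  ready N p phi T cp s -> (forall i, (i <= N)%N -> s 15 i = b i) ->
  (y.+1 < size T)%N -> (u < Dn N)%N ->
  same_but_values s t -> t 20 0%N = y -> t 21 0%N = u -> t 14 (y.+1 * Dn N + u)%N = 0%N ->
  let t' := run value_coef t in
  [/\ same_but_values s t', t' 20 0%N = y, t' 21 0%N = u,
    forall c, c <> (y.+1 * Dn N + u)%N -> t' 14 c = t 14 c
    & (t' 14 (y.+1 * Dn N + u)%N)%:R = \sum_(m < N.+1)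
        if (m <= u)%N then (t 14 (s 12 y.+1 * Dn N + (u - m))%N)%:R
          * ((node (s 13 y.+1))%:R ^+ m * (b m)%:R) else 0 :> 'F_p].
Proof.
move=> N1 pp r s15 yT uD st ty tu t0 t'.
have pF : p%:R = 0 :> 'F_p by apply: pchar_Fp_0.
have [xy _ /andP[k0 kR] _] := tab_parent (ready_table r) (yT : (0 < y.+1 < size T)%N).
set cl := (y.+1 * Dn N + u)%N.
pose I m (q : state) := [/\ same_but_values s q, q 20 0%N = y, q 21 0%N = u,
  forall c, c <> cl -> q 14 c = t 14 c
  & (q 14 cl)%:R = \sum_(m' < m)
        if (m' <= u)%N then (t 14 (s 12 y.+1 * Dn N + (u - m'))%N)%:R
          * ((node (s 13 y.+1))%:R ^+ m' * (b m')%:R) else 0 :> 'F_p].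
have n1E q : same_but_values s q -> eval vn1 q = N.+1.
  by move=> sq; rewrite /= sq // (ready_N r) addn1.
have DE q : same_but_values s q -> eval vDn q = Dn N.
  by move=> sq; rewrite /= !sq // (ready_N r) (ready_R r) addn1.
have clE q : same_but_values s q -> q 20 0%N = y -> q 21 0%N = u -> eval value_cell q = cl.
  by move=> sq qy qu; rewrite /cl -(DE q sq) -{1}qy -qu -addn1.
have: I (eval vn1 t) t'; last by rewrite n1E.
apply: (@run_for I 22 vn1 value_step t) => //.
  split=> //=; last by rewrite big_ord0 /update /= t0.
  by do 2!(apply: same_update => //).
move=> m q; rewrite n1E // => mN qm [sq qy qu qc qv].
have mE : (eval ($21 + #1 - $22)%E q != 0%N) = (m <= u)%N.
  by rewrite -lt0n /= qu qm subn_gt0 addn1 ltnS.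
set par_cell := (12.@($20 + #1) * vDn + ($21 - $22))%E.
set pow_cell := (13.@($20 + #1) * vn1 + $22)%E.
have parE : eval par_cell q = (s 12 y.+1 * Dn N + (u - m))%N.
  transitivity (q 12 (q 20 0 + 1) * eval vDn q + (q 21 0 - q 22 0))%N; first by [].
  by rewrite DE // qy qu qm addn1 sq.
have powE : eval pow_cell q = (s 13 y.+1 * N.+1 + m)%N.
  transitivity (q 13 (q 20 0 + 1) * eval vn1 q + q 22 0)%N; first by [].
  by rewrite n1E // qy qm addn1 sq.
have -> : run value_step q = if (m <= u)%N then update q 14 cl
    ((q 14 cl + q 14 (s 12 y.+1 * Dn N + (u - m)) * (q 6 (s 13 y.+1 * N.+1 + m) * q 15 m))
       %% (1 + (q 0 2 - 1)))%N else q.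
  by rewrite -mE -(clE q) // -parE -powE -qm.
case: leqP => mu; last first.
  split=> //; first exact: same_update.
  by rewrite big_ord_recr /= leqNgt mu addr0.
(* The parent occupies a strictly earlier row, so the cell being accumulated is never one that is
   read from it. *)
have q14 : q 14 (s 12 y.+1 * Dn N + (u - m))%N = t 14 (s 12 y.+1 * Dn N + (u - m))%N.
  apply: qc => /radix_inj[] //; first exact: leq_ltn_trans (leq_subr _ _) uD.
  by move=> e; rewrite e ltnn in xy.
split.
- by do 2!(apply: same_update => //).
- by rewrite /update.
- by rewrite /update.
- by move=> c cn; rewrite update_bank // update_cell ?qc //; apply/eqP.
rewrite update_bank // updateE (sq 0%N) // (sq 6%N) // (sq 15%N) // (ready_p r) subnKC ?prime_gt0 // natr_mod //.
rewrite natrD qv q14 big_ord_recr /= mu natrM natrM s15 // (ready_node r kR) // natr_mod //.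
by rewrite natrX.
Qed.

Lemma run_value_row p N phi T cp s (b : nat -> bool) t y : (1 < N)%N -> prime p ->
  ready N p phi T cp s -> (forall i, (i <= N)%N -> s 15 i = b i) ->
  (y.+1 < size T)%N -> same_but_values s t -> t 20 0%N = y ->
  (forall u, (u < Dn N)%N -> t 14 (y.+1 * Dn N + u)%N = 0%N) ->
  let t' := run value_row t in
  [/\ same_but_values s t', t' 20 0%N = y,
    forall c, (c < y.+1 * Dn N)%N || (y.+2 * Dn N <= c)%N -> t' 14 c = t 14 c
    & forall u, (u < Dn N)%N ->
      (t' 14 (y.+1 * Dn N + u)%N)%:R = \sum_(m < N.+1)
        if (m <= u)%N then (t 14 (s 12 y.+1 * Dn N + (u - m))%N)%:R
          * ((node (s 13 y.+1))%:R ^+ m * (b m)%:R) else 0 :> 'F_p].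
Proof.
move=> N1 pp r s15 yT st ty t0 t'.
have [xy _ _ _] := tab_parent (ready_table r) (yT : (0 < y.+1 < size T)%N).
pose J u (q : state) := [/\ same_but_values s q, q 20 0%N = y,
  forall c, (c < y.+1 * Dn N)%N || (y.+1 * Dn N + u <= c)%N -> q 14 c = t 14 c
  & forall u', (u' < u)%N ->
      (q 14 (y.+1 * Dn N + u')%N)%:R = \sum_(m < N.+1)
        if (m <= u')%N then (t 14 (s 12 y.+1 * Dn N + (u' - m))%N)%:R
          * ((node (s 13 y.+1))%:R ^+ m * (b m)%:R) else 0 :> 'F_p].
have DE q : same_but_values s q -> eval vDn q = Dn N.
  by move=> sq; rewrite /= !sq // (ready_N r) (ready_R r) addn1.
suff: J (eval vDn t) t' by rewrite DE // /J -mulSnr.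
apply: (@run_for J 21 vDn value_coef t) => //.
  by split=> //; do 2!(apply: same_update => //).
move=> u q; rewrite DE // => uD qu [sq qy qc qv].
have q0 : q 14 (y.+1 * Dn N + u)%N = 0%N by rewrite qc ?t0 // leqnn orbT.
have [s' y' u' c' v'] := run_value_coef N1 pp r s15 yT uD sq qy qu q0.
have qpar (u1 m : nat) : (u1 < Dn N)%N -> q 14 (s 12 y.+1 * Dn N + (u1 - m))%N = t 14 (s 12 y.+1 * Dn N + (u1 - m))%N.
  move=> u1D; apply: qc; apply/orP; left; apply: leq_trans (_ : (s 12 y.+1).+1 * Dn N <= _)%N.
    by rewrite mulSnr ltn_add2l (leq_ltn_trans (leq_subr _ _)).
  by rewrite leq_mul2r xy orbT.
split.
- exact: same_update.
- by rewrite update_bank.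
- move=> c hc; rewrite update_bank // c'; first by apply: qc; move: hc; lia.
  by move=> e; move: hc; rewrite e; lia.
move=> u1; rewrite ltnS leq_eqVlt => /orP[/eqP->|u1u]; rewrite update_bank //.
  by rewrite v'; apply: eq_bigr => m _; rewrite qpar.
rewrite c' ?qv // => /eqP; rewrite eqn_add2l => /eqP e.
by rewrite e ltnn in u1u.
Qed.

Lemma run_value_phase p N phi T cp s (b : nat -> bool) : (1 < N)%N -> prime p ->
  ready N p phi T cp s -> (forall i, (i <= N)%N -> s 15 i = b i) -> b 0%N ->
  (forall c, s 14 c = 0%N) ->
  monomial_values N b T (fun c => (run value_phase s 14 c)%:R : 'F_p).
Proof.
move=> N1 pp r s15 b0 s14.
have RN : (log_floor N < N)%N.
  by apply: leq_trans (log_floor_exp (ltnW N1)); rewrite ltn_expl.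
have R0 := log_floor_gt0 N1.
have rt := ready_table r.
set s1 := run (CAssign 14 #0 #1) s.
pose f := form_poly 'F_p N b.
have f0 : f 0%N = 1 by apply: form_poly0.
pose I y (q : state) := [/\ same_but_values s q,
  forall c, (y.+1 * Dn N <= c)%N -> q 14 c = 0%N
  & forall y' u (w : seq 'I_(log_floor N).+1), (y' <= y)%N -> (y' < size T)%N -> (u < Dn N)%N ->
    (size w <= log_floor N)%N -> (\sum_(k <- w) var_code N k)%N = nth 0%N T y' ->
    (q 14 (y' * Dn N + u)%N)%:R = (\prod_(k <- w) f k)`_u].
have ends : eval ($10 - #1)%E s1 = (size T).-1.
  by rewrite -[LHS]/(s 10 0 - 1)%N (tab_size rt) subn1.
have [_ _ h] : I (eval ($10 - #1)%E s1) (run (CFor 20 ($10 - #1) value_row) s1).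
  apply: (@run_for I 20 ($10 - #1)%E value_row s1) => //.
    split.
    - by do 3!(apply: same_update => //).
    - move=> c; rewrite mul1n => c0; rewrite /s1 /= /update /= s14.
      by case: eqP c0 => [->|].
    move=> y' u w; rewrite leqn0 => /eqP-> _ uD sw; rewrite (tab_head rt) => w0.
    rewrite (@word_prod _ N _ f w [::]) ?big_nil // coef1 /s1 /= /update /= s14.
    by rewrite mul0n add0n; case: (u == 0%N).
  move=> y q; rewrite ends => yT qy [sq q0 qv].
  have yT' : (y.+1 < size T)%N by rewrite -(prednK (tab_pos rt)) ltnS.
  have rz u : (u < Dn N)%N -> q 14 (y.+1 * Dn N + u)%N = 0%N by move=> _; rewrite q0 // leq_addr.
  have [s' y' c' v'] := run_value_row N1 pp r s15 yT' sq qy rz.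
  split.
  - exact: same_update.
  - move=> c hc; rewrite update_bank // c' ?hc ?orbT // q0 // (leq_trans _ hc) //.
    by rewrite leq_mul2r leqnSn orbT.
  move=> y1 u w; rewrite leq_eqVlt => /orP[/eqP->|y1y] y1T uD sw Tw; rewrite update_bank //; last first.
    by rewrite c' ?(radix_lt y1y uD) //; apply: qv.
  rewrite v' //.
  have [xy xcp /andP[k0 kR] Tx] := tab_parent rt (y1T : (0 < y.+1 < size T)%N).
  rewrite (ready_cp r) in xcp.
  have [w' sw' w'x] : form_code N (log_floor N) (log_floor N).-1 (nth 0%N T (s 12 y.+1)).
    apply/(ready_cp_codes r); rewrite -(nth_take 0%N xcp) mem_nth // size_take_min.
    by rewrite (minn_idPl (ready_cp_le r)).
  pose k : 'I_(log_floor N).+1 := Ordinal (kR : (s 13 y.+1 < _.+1)%N).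
  (* The value depends on the code only, so the given word may be replaced by the one that the table
     followed: last letter [k], then a word of the parent. *)
  rewrite (@word_prod _ N _ f w (k :: w')) //=; last 2 first.
  - by rewrite sw' prednK.
  - by rewrite Tw Tx big_cons addnC w'x.
  rewrite big_cons coef_form_mul; apply: eq_bigr => m _; case: ifP => // mu.
  rewrite mulrC; congr (_ * _); apply: qv => //.
  - exact: ltn_trans xy y1T.
  - exact: leq_ltn_trans (leq_subr _ _) uD.
  - by rewrite sw' leq_pred.
move=> y u w yT uD sw Tw; apply: h => //.
by rewrite ends -ltnS prednK // (tab_pos rt).
Qed.

(** * Outputs *)

Local Close Scope ring_scope.

Lemma mkseqD (A : Type) (f : nat -> A) m n :
  mkseq f (m + n) = mkseq f m ++ mkseq (fun i => f (m + i)) n.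
Proof.
by rewrite /mkseq iotaD map_cat add0n -{2}(addn0 m) iotaDl -map_comp.
Qed.

Lemma flatten_mkseq (A : Type) (f : nat -> nat -> A) k n :
  flatten (mkseq (fun i => mkseq (f i) n) k) = mkseq (fun t => f (t %/ n) (t %% n)) (k * n).
Proof.
elim: k => [//|k IH]; rewrite mkseqS -cats1 flatten_cat IH /= cats0 mulSnr mkseqD.
congr (_ ++ _); case: (posnP n) => [->//|n0].
apply/eq_in_map => i; rewrite mem_iota /= => iN.
by rewrite divnMDl // divn_small // addn0 modnMDl modn_small.
Qed.

Lemma map_enum_ord (A : Type) n (f : nat -> A) : [seq f (i : 'I_n) | i <- enum 'I_n] = mkseq f n.
Proof. by rewrite /mkseq -val_enum_ord -map_comp. Qed.

Lemma code_mx_natr p r c (f : nat -> nat -> nat) : prime p ->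
  code_mx (\matrix_(i < r, j < c) (f i j)%:R : 'M['F_p]_(r, c))%R
  = mkseq (fun t => f (t %/ c) (t %% c) %% p) (r * c).
Proof.
move=> pp; rewrite -(flatten_mkseq (fun i j => f i j %% p)); congr flatten.
rewrite -map_enum_ord; apply: eq_map => i; rewrite -map_enum_ord; apply: eq_map => j.
by rewrite mxE val_Fp_nat.
Qed.

Definition matrix_header : cmd := CAssign 1 #0 (#1 + vk * vm * vm) ;; CAssign 1 #1 vk.

Definition matrix_main (s : state) : state := run matrix_header (run (acc matrix_emit) s).

Lemma ready_keeps N p phi T cp s t : ready N p phi T cp s -> agree_vars [:: 0; 2; 4; 10] [::] t s ->
  eval vk t = size T * Dn N * N.+1 * N.+1 /\ eval vm t = mx_order N.
Proof.
move=> r [ag _]; rewrite /= !ag // (ready_N r) (ready_R r) (ready_C r) (tab_size (ready_table r)).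
by rewrite !addn1.
Qed.

Lemma output_matrix N p phi T cp s (k := size T * Dn N * N.+1 * N.+1) :
  1 < N -> prime p -> ready N p phi T cp s -> (forall c, s 1 c = 0) ->
  output (matrix_main s) = code_mxs [seq basis_mx p N s J | J <- iota 0 k].
Proof.
move=> N1 pp r s1; set m := mx_order N.
have sp := ready_p r.
set s' := run (acc matrix_emit) s.
have safe : agree_vars [:: 0; 2; 4; 5; 6; 8; 9; 10; 11] [::] s' s.
  exact: (@acc_keeps _ [::]).
have keep : agree_vars [:: 0; 2; 4; 10] [::] s' s.
  by split=> // b i; rewrite !inE => hb; apply: safe.1; move: hb; rewrite !inE; do ?case/orP; move/eqP->.
have [ek em] := ready_keeps r keep.
set s2 := run (CAssign 1 #0 (#1 + vk * vm * vm)) s'.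
have keep2 : agree_vars [:: 0; 2; 4; 10] [::] s2 s.
  split=> // b i; rewrite !inE => hb; rewrite /s2 /= update_bank; first by apply: keep.1; rewrite !inE.
  by apply: contraTneq hb => ->.
have [ek2 _] := ready_keeps r keep2.
have out0 : matrix_main s 1 0 = 1 + k * (m * m).
  transitivity (1 + eval vk s' * eval vm s' * eval vm s'); first by [].
  by rewrite ek em mulnA.
have out1 : matrix_main s 1 1 = k.
  by transitivity (eval vk s2).
have outc c : matrix_main s 1 (2 + c) = accf matrix_emit s (2 + c) %% p.
  transitivity (s' 1 (2 + c)); first by [].
  by rewrite /s' (run_acc (ro := [:: 0; 2; 4; 5; 6; 8; 9; 10; 11]) (V := [:: 0; 2; 4; 5; 6; 8; 9; 10; 11]) (LV := [::]) (s' := s)) ?sp ?s1 ?prime_gt0 ?add0n.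
rewrite /output out0 /code_mxs size_map size_iota mkseqD /= out1; congr (_ :: _).
rewrite -map_comp; transitivity (flatten (mkseq (fun J => mkseq (fun t =>
    accf matrix_emit s (2 + (J * m + t %/ m) * m + t %% m) %% p) (m * m)) k)); last first.
  by congr flatten; apply: eq_map => J; exact: (esym (@code_mx_natr p m m (fun row col => accf matrix_emit s (2 + (J * m + row) * m + col)) pp)).
rewrite flatten_mkseq; apply: eq_map => t; rewrite add1n -[t.+2]/(2 + t) outc.
congr (accf _ _ _ %% _); rewrite -addnA; congr (2 + _).
by rewrite mulnDl -addnA -divn_eq -mulnA -divn_eq.
Qed.

Definition coef_cell : expr := 14.@($20 * vDn + $21).
Definition row_expr : expr := (($20 * vDs + $21) * vn1 + $22)%E.

Definition honest_emit : acmd :=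
  AFor 20 $10 (AFor 21 vDn (AFor 22 vn1 (AFor 23 vn1
    (AAcc (#1 + param_expr $20 $21 $22 $23) (coef_cell * 15.@($22) * 15.@($23)))))).

Definition left_emit : acmd :=
  AFor 20 $10 (AFor 21 vDn (AFor 22 vn1
    (AAcc (#1 + vk + row_expr) (coef_cell * 15.@($22))))).

Definition right_emit : acmd :=
  AFor 23 vn1 (AAcc (#1 + vk + vm + $23) (15.@($23))).

(** The coefficients, [u] and [v] are written in consecutive address ranges starting at 1, after the
    length in cell 0; every other cell of each range keeps its initial 0. *)
Definition witness_emit : acmd := ASeq honest_emit (ASeq left_emit right_emit).

Definition witness_header : cmd := CAssign 1 #0 (vk + vm + vm).

Definition witness_main (s : state) : state := run witness_header (run (acc witness_emit) s).

Lemma output_witness N p phi T cp s (k := size T * Dn N * N.+1 * N.+1) (m := mx_order N) :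
  1 < N -> prime p -> ready N p phi T cp s -> (forall c, s 1 c = 0) ->
  output (witness_main s)
  = code_mx (\col_(J < k) (accf witness_emit s (1 + J))%:R : 'cV['F_p]_k)%R
    ++ code_mx (\col_(row < m) (accf witness_emit s (1 + k + row))%:R : 'cV['F_p]_m)%R
    ++ code_mx (\col_(col < m) (accf witness_emit s (1 + k + m + col))%:R : 'cV['F_p]_m)%R.
Proof.
move=> N1 pp r s1; have sp := ready_p r.
set s' := run (acc witness_emit) s.
have safe : agree_vars [:: 0; 2; 4; 10; 14; 15] [::] s' s.
  exact: (@acc_keeps _ [::]).
have keep : agree_vars [:: 0; 2; 4; 10] [::] s' s.
  by split=> // b i; rewrite !inE => hb; apply: safe.1; move: hb; rewrite !inE; do ?case/orP; move/eqP->.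
have [ek em] := ready_keeps r keep.
have out0 : witness_main s 1 0 = k + (m + m).
  transitivity (eval vk s' + eval vm s' + eval vm s'); first by [].
  by rewrite ek em addnA.
have outc c : witness_main s 1 (1 + c) = accf witness_emit s (1 + c) %% p.
  transitivity (s' 1 (1 + c)); first by [].
  by rewrite /s' (run_acc (ro := [:: 0; 2; 4; 10; 14; 15]) (V := [:: 0; 2; 4; 10; 14; 15])
    (LV := [::]) (s' := s)) ?sp ?s1 ?prime_gt0 ?add0n.
rewrite /output out0 (mkseqD _ k) (mkseqD _ m m).
have col n (f : nat -> nat) : mkseq (fun i => f i %% p) n
    = code_mx (\col_(J < n) (f J)%:R : 'cV['F_p]_n)%R.
  rewrite (code_mx_natr _ _ (fun i _ => f i) pp) muln1.
  by apply: eq_map => t; rewrite divn1.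
rewrite -(col k (fun J => accf witness_emit s (1 + J))).
rewrite -(col m (fun J => accf witness_emit s (1 + k + J))).
rewrite -(col m (fun J => accf witness_emit s (1 + k + m + J))).
have eqm n (f g : nat -> nat) : f =1 g -> mkseq f n = mkseq g n
  by move=> fg; rewrite /mkseq (eq_map fg).
congr (_ ++ _); first by apply: eqm => t; rewrite -add1n outc.
by congr (_ ++ _); apply: eqm => t; rewrite -add1n -?addnA outc.
Qed.

Local Open Scope ring_scope.

Lemma accf_witness N p phi T cp s (b : nat -> bool) a (k := (size T * Dn N * N.+1 * N.+1)%N)
    (pc := fun c => (s 14 c)%:R : 'F_p) :
  (1 < N)%N -> ready N p phi T cp s ->
  (forall i, (i <= N)%N -> s 15 i = b i) ->
  (accf witness_emit s a)%:R
  = (\sum_(x < size T) \sum_(t < Dn N) \sum_(i < N.+1) \sum_(l < N.+1)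
       if (1 + param N x t i l == a)%N then pc (x * Dn N + t)%N * (b i)%:R * (b l)%:R else 0)
   + ((\sum_(x < size T) \sum_(t < Dn N) \sum_(i < N.+1)
        if (1 + k + group_row N x t i == a)%N then pc (x * Dn N + t)%N * (b i)%:R else 0)
     + \sum_(l < N.+1) if (1 + k + mx_order N + l == a)%N then (b l)%:R else 0).
Proof.
move=> N1 r s15; have e := extends_refl s.
have cntE t : extends s t -> eval $10 t = size T.
  by move=> e'; rewrite /= e' // (tab_size (ready_table r)).
have kE t : extends s t -> eval vk t = k.
  by move=> e'; have [] := @ready_keeps N p phi T cp s t r; first by split=> // c i; rewrite !inE;
    do ?case/orP; move/eqP->; rewrite e'.
have accFor x ex c t : accf (AFor x ex c) t a = (\sum_(i < eval ex t) accf c (update t x 0 i) a)%N by [].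
have accAcc ad v t : accf (AAcc ad v) t a = (if eval ad t == a then eval v t else 0)%N by [].
have accSeq c1 c2 t : accf (ASeq c1 c2) t a = (accf c1 t a + accf c2 t a)%N by [].
have vE t : extends s t -> eval coef_cell t = s 14 (t 20 0 * Dn N + t 21 0)%N.
  move=> e'; transitivity (t 14 (t 20 0 * eval vDn t + t 21 0)%N); first by [].
  by rewrite (eval_vDn r e') e'.
have natr_if (c : bool) (v : nat) : (if c then v else 0)%:R = if c then v%:R else 0 :> 'F_p.
  by case: c.
rewrite !accSeq !natrD; congr (_ + (_ + _)).
- rewrite accFor cntE // natr_sum; apply: eq_bigr => x _.
  set t1 := update _ _ _ _; have e1 : extends s t1 by apply: extends_update.
  rewrite accFor (eval_vDn r e1) natr_sum; apply: eq_bigr => u _.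
  set t2 := update _ _ _ _; have e2 : extends s t2 by apply: extends_update.
  rewrite accFor (eval_vn1 r e2) natr_sum; apply: eq_bigr => i _.
  set t3 := update _ _ _ _; have e3 : extends s t3 by apply: extends_update.
  rewrite accFor (eval_vn1 r e3) natr_sum; apply: eq_bigr => l _.
  set t4 := update _ _ _ _; have e4 : extends s t4 by apply: extends_update.
  have -> : accf (AAcc (#1 + param_expr $20 $21 $22 $23) (coef_cell * 15.@($22) * 15.@($23))) t4 a
     = if (1 + param N x u i l == a)%N then (eval coef_cell t4 * t4 15 i * t4 15 l)%N else 0%N.
    by rewrite accAcc -(eval_param $20 $21 $22 $23 r e4).
  by rewrite natr_if !natrM vE // !(e4 15%N) // !s15 ?leq_ord.
- rewrite accFor cntE // natr_sum; apply: eq_bigr => x _.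
  set t1 := update _ _ _ _; have e1 : extends s t1 by apply: extends_update.
  rewrite accFor (eval_vDn r e1) natr_sum; apply: eq_bigr => u _.
  set t2 := update _ _ _ _; have e2 : extends s t2 by apply: extends_update.
  rewrite accFor (eval_vn1 r e2) natr_sum; apply: eq_bigr => i _.
  set t3 := update _ _ _ _; have e3 : extends s t3 by apply: extends_update.
  have -> : accf (AAcc (#1 + vk + row_expr) (coef_cell * 15.@($22))) t3 a
     = if (1 + k + group_row N x u i == a)%N then (eval coef_cell t3 * t3 15 i)%N else 0%N.
    rewrite accAcc -(kE _ e3); have -> // : group_row N x u i = eval row_expr t3.
    rewrite /group_row -(eval_vDs r e3).
    by transitivity ((x * eval vDs t3 + u) * eval vn1 t3 + i)%N; first rewrite (eval_vn1 r e3).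
  by rewrite natr_if !natrM vE // !(e3 15%N) // !s15 ?leq_ord.
rewrite accFor (eval_vn1 r e) natr_sum; apply: eq_bigr => l _.
set t1 := update _ _ _ _; have e1 : extends s t1 by apply: extends_update.
have -> : accf (AAcc (#1 + vk + vm + $23) (15.@($23))) t1 a
   = if (1 + k + mx_order N + l == a)%N then t1 15 l else 0%N.
  by rewrite accAcc -(kE _ e1) -(eval_vm r e1).
by rewrite natr_if e1 // s15 ?leq_ord.
Qed.

(** * Running times *)

Local Close Scope ring_scope.

(** A single cap for all loops reduces a polynomial step count to evaluating the loop bounds in the
    starting state of a phase. *)
Fixpoint loops_le (Q : nat) (c : cmd) (s : state) : bool :=
  match c with
  | CSkip | CAssign _ _ _ => true
  | CSeq c1 c2 | CIf _ c1 c2 => loops_le Q c1 s && loops_le Q c2 s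
  | CFor _ e c => (eval e s <= Q) && loops_le Q c s
  end.

Lemma steps_loops c : exists K d, forall s Q, loops_le Q c s -> steps c s <= K * Q.+1 ^ d.
Proof.
elim: c => [|a i e|c1 [K1 [d1 h1]] c2 [K2 [d2 h2]]|e c1 [K1 [d1 h1]] c2 [K2 [d2 h2]]|x e c [K [d h]]] /=.
- by exists 1, 0.
- by exists 1, 0.
- exists (K1 + K2), (d1 + d2) => s Q /andP[/h1 l1 /h2 l2]; rewrite mulnDl leq_add //.
    by apply: leq_trans l1 _; rewrite leq_mul2l leq_pexp2l ?leq_addr ?orbT.
  by apply: leq_trans l2 _; rewrite leq_mul2l leq_pexp2l ?leq_addl ?orbT.
- exists (K1 + K2 + 1), (d1 + d2) => s Q /andP[/h1 l1 /h2 l2].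
  rewrite -addn1 !mulnDl !leq_add //.
  + by apply: leq_trans l1 _; rewrite leq_mul2l leq_pexp2l ?leq_addr ?orbT.
  + by apply: leq_trans l2 _; rewrite leq_mul2l leq_pexp2l ?leq_addl ?orbT.
  by rewrite mul1n expn_gt0.
exists (K + 2), d.+1 => s Q /andP[eQ /h l].
have Q1 : 0 < Q.+1 ^ d by rewrite expn_gt0.
apply: (@leq_trans (Q * (K * Q.+1 ^ d).+1).+1); first by rewrite ltnS leq_mul.
rewrite expnS; move: (Q.+1 ^ d) Q1 => Z Z1.
by rewrite !(mulnDl, mulSn, mulnS, mulnA) mulnC; nia.
Qed.

Lemma pb_steps I D (X Q : I -> nat) c (s : I -> state) : pb D X Q ->
  (forall i, D i -> loops_le (Q i) c (s i)) -> pb D X (fun i => steps c (s i)).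
Proof.
move=> pQ hQ; have [K [d h]] := steps_loops c.
apply: (@pb_le _ _ _ _ (fun i => K * (Q i).+1 ^ d)); first by move=> i Di; apply: h; apply: hQ.
by apply: pb_mul; [apply: pb_const|apply/pb_exp/pb_S].
Qed.

Lemma pexec_phase ro c I D (X Q : I -> nat) (s : I -> state) : wf ro c -> pb D X Q ->
  (forall i, D i -> loops_le (Q i) c (s i)) -> pbounded D X s ->
  pbounded D X (fun i => run c (s i)) /\ pexec D X (compile c) s (fun i => run c (s i)).
Proof. by move=> w pQ hQ ps; apply: (pexec_compile w ps); apply: pb_steps pQ hQ. Qed.

Definition sizes_run (s : state) : state := run bin_phase (run log_phase s).

Definition prelude_run (s : state) : state :=
  run table_phase (run node_power_phase (run form_phase (sizes_run s))).

Definition sizes_prog : prog := Seq (compile log_phase) (compile bin_phase).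

Definition prelude_prog : prog :=
  Seq sizes_prog (Seq (compile form_phase) (Seq (compile node_power_phase) (compile table_phase))).

Record input_state (N p : nat) (phi : circuit) (s : state) : Prop := InputState {
  input_N : s 0 1 = N;
  input_p : s 0 2 = p;
  input_inputs : s 0 3 = ninputs phi;
  input_out : s 0 4 = out phi;
  input_size : s 0 5 = size (gates phi);
  input_gate : forall g j, g < size (gates phi) ->
    s 0 (6 + 3 * g + j) = nth 0 (code_gate (nth (NOT 0) (gates phi) g)) j \/ 2 < j;
  input_blank : forall b i, 0 < b -> s b i = 0
}.

Lemma sizes_run_spec s N : s 0 1 = N -> 0 < N -> s 2 0 = 0 ->
  sizes_run s 2 0 = log_floor N /\ sizes_run s 4 0 = 'C(2 * log_floor N, log_floor N).
Proof.
move=> sN N0 s2; have R := run_log_phase sN N0 s2; split.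
  by rewrite /sizes_run run_frame.
by rewrite /sizes_run run_bin_phase R.
Qed.

Lemma prelude_env s N p phi : 1 < N -> 1 < p -> input_state N p phi s ->
  let t := run node_power_phase (run form_phase (sizes_run s)) in
  [/\ t 2 0 = log_floor N, table_env N (log_floor N) 'C(2 * log_floor N, log_floor N) t,
    forall k m, k <= log_floor N -> m <= N -> t 6 (k * N.+1 + m) = node k ^ m %% p
    & forall b i, b \notin [:: 2; 3; 4; 5; 6; 7; 20; 21] -> t b i = s b i].
Proof.
move=> N1 p1 [sN sp _ _ _ _ sb] t.
have [e2 e4] := sizes_run_spec sN (ltnW N1) (sb 2 0 isT).
have fr b i : b \notin [:: 2; 3; 4; 5; 6; 7; 20; 21] -> t b i = s b i.
  by rewrite !inE !negb_or => /and4P[b2 b3 b4 /and4P[b5 b6 b7 /andP[b20 b21]]];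
    rewrite /t /sizes_run !run_frame // !inE !negb_or ?b2 ?b3 ?b4 ?b5 ?b6 ?b7 ?b20 ?b21.
set t1 := run form_phase (sizes_run s).
have t1N : t1 0 1 = N by rewrite /t1 /sizes_run !run_frame.
have t1p : t1 0 2 = p by rewrite /t1 /sizes_run !run_frame.
have t1R : t1 2 0 = log_floor N by rewrite /t1 run_frame.
have form k : k <= log_floor N -> t1 5 k = var_code N k /\ t1 7 k = node k.
  move=> kR; have := @run_form_phase (sizes_run s) k.
  rewrite e2 (_ : sizes_run s 0 1 = N); last by rewrite /sizes_run !run_frame.
  by apply=> //; rewrite /sizes_run !run_frame ?sb.
split=> //.
- by rewrite /t run_frame.
- split; first by rewrite /t run_frame.
    by rewrite /t !run_frame.
  by move=> k kR; rewrite /t run_frame //; case: (form k kR).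
move=> k m kR mN; have := @run_node_power_phase t1 k m.
rewrite t1N t1p t1R; apply=> //.
by move=> k' k'R; case: (form k' k'R).
Qed.

Lemma prelude_ready s N p phi : 1 < N -> 1 < p -> input_state N p phi s ->
  exists T cp, ready N p phi T cp (prelude_run s)
    /\ forall b i, b \in [:: 1; 14; 15] -> prelude_run s b i = 0.
Proof.
move=> N1 p1 si; have [t2 envt t6 fr] := prelude_env N1 p1 si.
rewrite /prelude_run; set t := run node_power_phase _ in t2 envt t6 fr *.
have [] := @run_table_phase t N (ltnW N1) envt.
- by move=> i; rewrite fr ?(input_blank si).
- by move=> i; rewrite fr ?(input_blank si).
move=> T [tabT TW /(_ (log_floor_gt0 N1))[cpT cpW]].
have keep b i : b \notin [:: 2; 3; 4; 5; 6; 7; 8; 9; 10; 11; 12; 13; 20; 21; 22] ->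
    run table_phase t b i = s b i.
  move=> h; rewrite run_frame ?fr //; apply: contra h; rewrite !inE;
  by do ![case/orP]; move/eqP->.
have [e2 e4 e5] := envt.
exists T, (run table_phase t 11 0); split; last first.
  by move=> b i; rewrite !inE => /or3P[] /eqP->; rewrite keep ?(input_blank si).
have keep0 i : run table_phase t 0 i = s 0 i by apply: keep.
split; rewrite ?keep0 ?(input_N si) ?(input_p si) ?(input_inputs si) ?(input_out si) ?(input_size si) //.
- by move=> g j gG; rewrite keep0; apply: (input_gate si).
- by rewrite run_frame.
- by rewrite run_frame.
- by move=> k kR; rewrite run_frame // e5.
- by move=> k m kR mN; rewrite run_frame // t6.
Qed.

(** Dominates every kind of loop bound that occurs: about N, $2NR+1$, and the number of monomials,
    at most $N^2$. *)
Definition loop_cap (N : nat) : nat := 2 * N.+1 ^ 2.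

Lemma cap_S N : N.+1 <= loop_cap N.
Proof. by apply: (leq_trans (leq_self_sqr N.+1)); rewrite /loop_cap leq_pmull. Qed.

Lemma cap_R N : (log_floor N).+1 <= loop_cap N.
Proof. by apply: leq_trans (cap_S N); rewrite ltnS log_floor_le. Qed.

Lemma cap_C N : 0 < N -> 'C(2 * log_floor N, log_floor N) <= loop_cap N.
Proof.
move=> N0; apply: leq_trans (bin_log_le N0) _.
by apply: leq_trans (_ : N.+1 ^ 2 <= _); [rewrite leq_exp2r|rewrite leq_pmull].
Qed.

Lemma cap_Ds N : Ds N <= loop_cap N.
Proof.
rewrite /Ds /loop_cap -mulnn; have := log_floor_le N; move: (log_floor N) => R RN.
have : N * R <= N * N by rewrite leq_mul2l RN orbT.
rewrite -[2 * N * R]mulnA; move: (N * R) => Z h.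
by rewrite mulSn mulnS; lia.
Qed.

Lemma pb_cap I D (X N : I -> nat) : pb D X N -> pb D X (fun i => loop_cap (N i)).
Proof. by move=> pN; apply: pb_mul; [apply: pb_const|apply/pb_exp/pb_S]. Qed.

Lemma sizes_pexec I D (X N : I -> nat) (s : I -> state) :
  (forall i, D i -> [/\ s i 0 1 = N i, 0 < N i & s i 2 0 = 0]) ->
  pb D X N -> pbounded D X s ->
  pbounded D X (fun i => sizes_run (s i)) /\ pexec D X sizes_prog s (fun i => sizes_run (s i)).
Proof.
move=> hs pN ps; have pQ := pb_cap pN.
have [|b1 x1] := @pexec_phase [:: 0] log_phase _ _ _ _ _ isT pQ _ ps.
  by move=> i Di; have [sN N0 s2] := hs i Di; rewrite /= sN andbT ltnW // cap_S.
have [|b2 x2] := @pexec_phase [:: 0; 2] bin_phase _ _ _ _ _ isT pQ _ b1.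
  move=> i Di; have [sN N0 s2] := hs i Di.
  have lE t : loops_le (loop_cap (N i)) bin_phase t = (t 2 0 <= loop_cap (N i)) by rewrite /= andbT.
  by rewrite lE (run_log_phase sN N0 s2) ltnW // cap_R.
by split=> //; apply: pexec_seq x1 x2.
Qed.

Lemma prelude_pexec I D (X N p : I -> nat) (phi : I -> circuit) (s : I -> state) :
  (forall i, D i -> [/\ input_state (N i) (p i) (phi i) (s i), 1 < N i & 1 < p i]) ->
  pb D X N -> pbounded D X s ->
  pbounded D X (fun i => prelude_run (s i)) /\ pexec D X prelude_prog s (fun i => prelude_run (s i)).
Proof.
move=> hs pN ps; have pQ := pb_cap pN.
have [|b1 x1] := sizes_pexec _ pN ps.
  by move=> i Di; have [si N1 p1] := hs i Di; rewrite (input_N si) (input_blank si) // ltnW.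
have R i : D i -> sizes_run (s i) 2 0 = log_floor (N i).
  move=> Di; have [si N1 p1] := hs i Di.
  by have [] := sizes_run_spec (input_N si) (ltnW N1) (input_blank si 0 (isT : 0 < 2)).
have [|b2 x2] := @pexec_phase [:: 0; 2] form_phase _ _ _ _ _ isT pQ _ b1.
  move=> i Di; have lE t : loops_le (loop_cap (N i)) form_phase t = (t 2 0 <= loop_cap (N i)).
    by rewrite /= andbT.
  by rewrite lE R // ltnW // cap_R.
have [|b3 x3] := @pexec_phase [:: 0; 2; 7] node_power_phase _ _ _ _ _ isT pQ _ b2.
  move=> i Di; have [si N1 p1] := hs i Di.
  have lE t : loops_le (loop_cap (N i)) node_power_phase t
      = (t 2 0 + 1 <= loop_cap (N i)) && (t 0 1 <= loop_cap (N i)) by rewrite /= andbT.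
  have e0 : run form_phase (sizes_run (s i)) 0 1 = N i.
    by rewrite /sizes_run !run_frame // (input_N si).
  have e2 : run form_phase (sizes_run (s i)) 2 0 = log_floor (N i).
    by rewrite run_frame // R.
  by rewrite lE e0 e2 addn1 cap_R ltnW // cap_S.
have [|b4 x4] := @pexec_phase [:: 0; 2; 4; 5] table_phase _ _ _ _ _ isT pQ _ b3.
  move=> i Di; have [si N1 p1] := hs i Di.
  have lE t : loops_le (loop_cap (N i)) table_phase t
      = (t 2 0 <= loop_cap (N i)) && (t 4 0 <= loop_cap (N i)).
    by rewrite /= !andbT; case: (t 2 0 <= _); rewrite ?andbT.
  have [e2 [_ e4 _] _ _] := prelude_env N1 p1 si.
  by rewrite lE e2 e4 ltnW ?cap_R ?cap_C // ltnW.
split=> //; apply: pexec_seq x1 _; apply: pexec_seq x2 _; exact: pexec_seq x3 x4.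
Qed.

Lemma nth_code_gates gs extra g j : g < size gs -> j <= 2 ->
  nth 0 (flatten [seq code_gate h | h <- gs] ++ extra) (3 * g + j)
  = nth 0 (code_gate (nth (NOT 0) gs g)) j.
Proof.
have sg h : size (code_gate h) = 3 by case: h.
elim: gs g => [|h gs IH] [|g] //= gG j2; rewrite -catA nth_cat sg.
  by rewrite muln0 add0n ltnS j2.
by rewrite mulnS -addnA ltnNge leq_addr /= addKn IH.
Qed.

Lemma size_code_gates gs : size (flatten [seq code_gate h | h <- gs]) = 3 * size gs.
Proof. by elim: gs => [//|h gs IH]; rewrite /= size_cat IH mulnS; case: h. Qed.

Lemma load_input N p phi extra : input_state N p phi (load [:: N, p & code_circuit phi ++ extra]).
Proof.
split=> //; last by move=> [|b] i.
move=> g j gG; case: (leqP j 2) => j2; [left|by right].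
by rewrite -(nth_code_gates extra gG j2) -addnA.
Qed.

Lemma load_extra N p phi extra t :
  load [:: N, p & code_circuit phi ++ extra] 0 (6 + 3 * size (gates phi) + t) = nth 0 extra t.
Proof.
rewrite -addnA; transitivity (nth 0 (flatten [seq code_gate h | h <- gates phi] ++ extra)
  (3 * size (gates phi) + t)); first by [].
by rewrite nth_cat size_code_gates ltnNge leq_addr /= addKn.
Qed.

Lemma bitlen_leS n : bitlen n <= n.+1.
Proof. by rewrite bitlenE // (leq_trans (ltn_expl n (isT : 1 < 2))) // leq_exp2l. Qed.

Lemma load_bounded l B : 0 < B -> (forall v, v \in size l :: l -> bitlen v <= B) -> bounded (load l) B.
Proof.
move=> B0 h a i; rewrite /load; case: ifP => // _.
case: (ltnP i (size (size l :: l))) => il; first by apply: h; apply: mem_nth.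
by rewrite nth_default.
Qed.

Lemma code_gates_le w gs v : gates_wf w gs ->
  v \in flatten [seq code_gate g | g <- gs] -> v <= w + size gs.
Proof.
elim: gs w => [//|g gs IH] w /= /andP[gw gsw]; rewrite mem_cat => /orP[|vg]; last first.
  by rewrite -addSnnS IH.
by case: g gw => [i j|i] /= gw; rewrite !inE => /or3P[] /eqP->; lia.
Qed.

Lemma circuit_load_bounded N p phi (extra : seq nat) : circuit_size phi <= N ->
  size extra <= N -> (forall v, v \in extra -> v <= 1) ->
  bounded (load [:: N, p & code_circuit phi ++ extra]) (4 * N + trunc_log 2 p + 7).
Proof.
move=> phiN eN e1; apply: load_bounded; first by rewrite addn_gt0 orbT.
have small v : v <= 4 * N + 5 -> bitlen v <= 4 * N + trunc_log 2 p + 7.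
  by move=> h; apply: leq_trans (bitlen_leS v) _; lia.
have GN : size (gates phi) <= N by apply: leq_trans phiN; apply: leq_addl.
have nN : ninputs phi <= N by apply: leq_trans phiN; apply: leq_addr.
have oN : out phi <= N by apply: leq_trans (ltnW (out_ok phi)) phiN.
move=> v; rewrite in_cons => /orP[/eqP->|].
  by apply: small; rewrite /= !size_cat size_code_gates; lia.
rewrite -[[:: N, p & _]]/([:: N; p; ninputs phi; out phi; size (gates phi)]
  ++ (flatten [seq code_gate g | g <- gates phi] ++ extra)) mem_cat => /orP[|].
  rewrite !inE => /orP[/eqP->|]; first by apply: small; lia.
  case/orP => [/eqP->|]; first by rewrite /bitlen; lia.
  by do 2?(case/orP => [/eqP->|]; first by apply: small; lia); move/eqP->; apply: small; lia.
rewrite mem_cat => /orP[|/e1 v1]; last by apply: small; lia.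
by move/(code_gates_le (gates_ok phi)) => h; apply: small; move: phiN; rewrite /circuit_size; lia.
Qed.

Lemma ready_loops N p phi T cp s (Q := loop_cap N) : 1 < N -> circuit_size phi <= N ->
  ready N p phi T cp s ->
  [/\ [&& s 10 0 <= Q, s 11 0 <= Q & s 2 0 + 1 <= Q],
      [&& eval vDn s <= Q, eval vDs s <= Q & eval vn1 s <= Q]
    & (s 0 3 <= Q) && (s 0 5 <= Q)].
Proof.
move=> N1 phiN r; have e := extends_refl s.
have TQ : size T <= Q by apply: leq_trans (cap_C (ltnW N1)); apply: size_table r.
have NQ : N <= Q by apply: ltnW (cap_S N).
split.
- by rewrite (tab_size (ready_table r)) TQ (ready_cp r) (leq_trans (ready_cp_le r)) // (ready_R r) addn1 cap_R.
- rewrite (eval_vDn r e) (eval_vDs r e) (eval_vn1 r e) cap_Ds cap_S.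
  by rewrite (leq_trans (Dn_le_Ds N) (cap_Ds N)).
rewrite (ready_inputs r) (ready_size r) !(leq_trans _ NQ) //; apply: leq_trans phiN.
  exact: leq_addl.
exact: leq_addr.
Qed.

Lemma matrix_loops N p phi T cp s : 1 < N -> circuit_size phi <= N -> ready N p phi T cp s ->
  loops_le (loop_cap N) (acc matrix_emit) s.
Proof.
move=> N1 phiN r; have [/and3P[h10 h11 h2] /and3P[hDn hDs hn1] /andP[h3 h5]] := ready_loops N1 phiN r.
by move: hDn hDs hn1; rewrite /= => -> -> ->; rewrite h10 h11 h2 h5.
Qed.

Lemma wire_loops N p phi T cp s : 1 < N -> circuit_size phi <= N -> ready N p phi T cp s ->
  loops_le (loop_cap N) wire_phase s.
Proof.
move=> N1 phiN r; have [_ _ /andP[h3 h5]] := ready_loops N1 phiN r.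
by rewrite /= h3 h5.
Qed.

Lemma value_loops N p phi T cp s : 1 < N -> circuit_size phi <= N -> ready N p phi T cp s ->
  loops_le (loop_cap N) value_phase s.
Proof.
move=> N1 phiN r; have [/and3P[h10 _ _] /and3P[hDn _ hn1] _] := ready_loops N1 phiN r.
by move: hDn hn1; rewrite /= => -> ->; rewrite (leq_trans (leq_subr _ _) h10).
Qed.

Lemma witness_loops N p phi T cp s : 1 < N -> circuit_size phi <= N -> ready N p phi T cp s ->
  loops_le (loop_cap N) (acc witness_emit) s.
Proof.
move=> N1 phiN r; have [/and3P[h10 _ _] /and3P[hDn _ hn1] _] := ready_loops N1 phiN r.
by move: hDn hn1; rewrite /= => -> ->; rewrite h10.
Qed.

(* The two programs must use the same basis although their inputs differ beyond
   the header N, p: the order in which monomials are enumerated depends on N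
   and p only. *)
Fixpoint reads_head (e : expr) : bool :=
  match e with
  | Const _ => true
  | Get a e => reads_head e && ((a != 0) || if e is Const n then 0 < n <= 2 else false)
  | Op _ e1 e2 => reads_head e1 && reads_head e2
  end.

Fixpoint head_only (c : cmd) : bool :=
  match c with
  | CSkip => true
  | CAssign a i e => reads_head i && reads_head e
  | CSeq c1 c2 => head_only c1 && head_only c2
  | CIf e c1 c2 => [&& reads_head e, head_only c1 & head_only c2]
  | CFor x e c => [&& x != 0, reads_head e & head_only c]
  end.

Definition same_head (s t : state) : Prop :=
  forall b i, (b != 0) || (0 < i <= 2) -> s b i = t b i.

Lemma eval_same_head e s t : reads_head e -> same_head s t -> eval e s = eval e t.
Proof.
move=> + st; elim: e => [//|a e IH|o e1 IH1 e2 IH2] /= /andP[].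
  move=> /IH -> h; apply: st; case: (a != 0) h => //=.
  by case: e {IH}.
by move=> /IH1-> /IH2->.
Qed.

Lemma same_head_update s t a i v : same_head s t -> same_head (update s a i v) (update t a i v).
Proof. by move=> st b j h; rewrite /update; case: ifP => // _; apply: st. Qed.

Lemma run_same_head c s t : head_only c -> same_head s t -> same_head (run c s) (run c t).
Proof.
elim: c s t => [|a i e|c1 IH1 c2 IH2|e c1 IH1 c2 IH2|x e c IH] s t //=.
- move=> /andP[hi he] st; rewrite (eval_same_head hi st) (eval_same_head he st).
  exact: same_head_update.
- by case/andP => h1 h2 st; apply: IH2 => //; apply: IH1.
- case/and3P => he h1 h2 st; rewrite (eval_same_head he st).
  by case: ifP => _; [apply: IH1|apply: IH2].
case/and3P => x0 he hc st; rewrite (eval_same_head he st).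
set s' := update _ x 0 0; set t' := update _ x 0 0.
have : same_head s' t' by do 2!(apply: same_head_update).
elim: (eval e t) s' t' => [|n IHn] s' t' st'; first by [].
rewrite !iterSr; apply: IHn; have h := IH _ _ hc st'.
by rewrite /= (h x 0) ?x0 //; apply: same_head_update.
Qed.

Lemma prelude_same_head s t : same_head s t -> same_head (prelude_run s) (prelude_run t).
Proof. by move=> st; do 5!(apply: run_same_head => //). Qed.

Lemma tabulates_inj N R s t T U : same_head s t -> tabulates N R s T -> tabulates N R t U -> T = U.
Proof.
move=> st tT tU; have sz : size T = size U by rewrite -(tab_size tT) -(tab_size tU) st.
apply: (@eq_from_nth _ 0) => // i iT.
by rewrite -(tab_nth tT) // -(tab_nth tU) -?sz // st.
Qed.

Lemma pexec_poly I D (X : I -> nat) P s s' : pexec D X P s s' -> (forall i, D i -> 0 < X i) ->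
  exists c d, forall i, D i -> exists2 t, exec P (s i) (s' i) t & t <= c * X i ^ d.
Proof.
move=> [B [c [d hB]] h] X0; exists (c * 2 ^ d), d => i Di.
have [t e le] := h i Di; exists t => //; apply: leq_trans le (leq_trans (hB i Di) _).
rewrite -mulnA -expnMn leq_mul2l; case: d {hB} => [|d]; first by rewrite !expn0 orbT.
by rewrite leq_exp2r // mul2n -addnn -addn1 leq_add2l X0 ?orbT.
Qed.

Definition matrix_prog : prog :=
  Seq prelude_prog (Seq (compile (acc matrix_emit)) (compile matrix_header)).

Definition witness_prog : prog :=
  Seq prelude_prog (Seq (compile wire_phase) (Seq (compile value_phase)
    (Seq (compile (acc witness_emit)) (compile witness_header)))).

Definition value_run (s : state) : state := run value_phase (run wire_phase s).

Definition input_of (i : circuit * nat * nat * seq nat) : seq nat :=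
  let: (phi, N, p, extra) := i in [:: N, p & code_circuit phi ++ extra].

(** One index set serves both programs: the last component is empty for the basis and consists of
    the witness bits otherwise. *)
Definition admissible (i : circuit * nat * nat * seq nat) : Prop :=
  let: (phi, N, p, extra) := i in
  [/\ 1 < N, prime p, circuit_size phi <= N, size extra <= N & forall v, v \in extra -> v <= 1].

Definition input_size_of (i : circuit * nat * nat * seq nat) : nat :=
  let: (_, N, p, _) := i in N + trunc_log 2 p.

Lemma prelude_ready_load N p phi extra : 1 < N -> prime p ->
  let s := prelude_run (load [:: N, p & code_circuit phi ++ extra]) in
  exists T cp, ready N p phi T cp s /\ forall b i, b \in [:: 1; 14; 15] -> s b i = 0.
Proof. by move=> N1 pp; exact: (prelude_ready N1 (prime_gt1 pp) (load_input _ _ _ _)). Qed.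

Lemma load_pbounded :
  pbounded admissible input_size_of (fun i => load (input_of i)).
Proof.
exists (fun i => 4 * input_size_of i + 7).
  by apply: pb_add (pb_const _ _ _); apply: pb_mul (pb_const _ _ _) (pb_size _ _).
move=> [[[phi N] p] extra] [N1 pp phiN eN e1].
apply: bounded_le (circuit_load_bounded p phiN eN e1) _.
by rewrite /input_size_of; lia.
Qed.

Lemma prelude_load_pexec :
  pbounded admissible input_size_of (fun i => prelude_run (load (input_of i)))
  /\ pexec admissible input_size_of prelude_prog (fun i => load (input_of i))
       (fun i => prelude_run (load (input_of i))).
Proof.
apply: (@prelude_pexec _ _ _ (fun i => i.1.1.2) (fun i => i.1.2) (fun i => i.1.1.1)) load_pbounded.
  move=> [[[phi N] p] extra] [N1 pp phiN eN e1]; split=> //; last exact: prime_gt1.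
  exact: load_input.
by exists 1, 1 => -[[[phi N] p] extra] _; rewrite mul1n expn1 /= ltnW // ltnS leq_addr.
Qed.

Lemma pb_loop_cap : pb admissible input_size_of (fun i => loop_cap i.1.1.2).
Proof.
apply: pb_cap; exists 1, 1 => -[[[phi N] p] extra] _.
by rewrite mul1n expn1 /= ltnW // ltnS leq_addr.
Qed.

Lemma matrix_pexec : pexec admissible input_size_of matrix_prog (fun i => load (input_of i))
  (fun i => matrix_main (prelude_run (load (input_of i)))).
Proof.
have [b1 x1] := prelude_load_pexec; apply: pexec_seq x1 _.
have [|b2 x2] := @pexec_phase [:: 0; 2; 4; 5; 6; 8; 9; 10; 11] (acc matrix_emit)
  _ _ _ _ _ isT pb_loop_cap _ b1.
  move=> [[[phi N] p] extra] [N1 pp phiN eN e1].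
  have [T [cp [r _]]] := prelude_ready_load phi extra N1 pp.
  exact: matrix_loops phiN r.
apply: pexec_seq x2 _.
by have [] := @pexec_phase [:: 0; 2; 4; 10] matrix_header _ _ _ _ _ isT pb_loop_cap (fun _ _ => isT) b2.
Qed.

Lemma value_ready N p phi T cp s : ready N p phi T cp s -> ready N p phi T cp (value_run s).
Proof. by move=> r; apply: ready_run => //; apply: ready_run. Qed.

Lemma witness_pexec : pexec admissible input_size_of witness_prog (fun i => load (input_of i))
  (fun i => witness_main (value_run (prelude_run (load (input_of i))))).
Proof.
have [b1 x1] := prelude_load_pexec; apply: pexec_seq x1 _.
have [|b2 x2] := @pexec_phase [:: 0] wire_phase _ _ _ _ _ isT pb_loop_cap _ b1.
  move=> [[[phi N] p] extra] [N1 pp phiN eN e1].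
  have [T [cp [r _]]] := prelude_ready_load phi extra N1 pp.
  exact: wire_loops phiN r.
apply: pexec_seq x2 _.
have [|b3 x3] := @pexec_phase [:: 0; 2; 6; 10; 12; 13; 15] value_phase _ _ _ _ _ isT pb_loop_cap _ b2.
  move=> [[[phi N] p] extra] [N1 pp phiN eN e1].
  have [T [cp [r _]]] := prelude_ready_load phi extra N1 pp.
  by apply: value_loops phiN _ => //; apply: ready_run r _.
apply: pexec_seq x3 _.
have [|b4 x4] := @pexec_phase [:: 0; 2; 4; 10; 14; 15] (acc witness_emit) _ _ _ _ _ isT pb_loop_cap _ b3.
  move=> [[[phi N] p] extra] [N1 pp phiN eN e1].
  have [T [cp [r _]]] := prelude_ready_load phi extra N1 pp.
  by apply: witness_loops phiN _ => //; apply: value_ready r.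
apply: pexec_seq x4 _.
by have [] := @pexec_phase [:: 0; 2; 4; 10] witness_header _ _ _ _ _ isT pb_loop_cap (fun _ _ => isT) b4.
Qed.

(** * Honest witnesses *)

Lemma nth_wires_input x gs i : i < size x -> nth false (wires x gs) i = nth false x i.
Proof.
elim: gs x => [//|g gs IH] x ix; rewrite [LHS]IH ?size_rcons ?leqW //.
by rewrite nth_rcons ix.
Qed.

Lemma gate_value_wires x gs g : gate_wf (size x) g -> gate_value (wires x gs) g = gate_value x g.
Proof. by case: g => [i j /andP[ix jx]|i ix]; rewrite /= !nth_wires_input. Qed.

Lemma nth_wires_gate x gs g : gates_wf (size x) gs -> g < size gs ->
  nth false (wires x gs) (size x + g) = gate_value (wires x gs) (nth (NOT 0) gs g).
Proof.
elim: gs x g => [//|h gs IH] x [|g] /andP[hw gw] gG.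
  rewrite addn0 [RHS](gate_value_wires (h :: gs) hw).
  rewrite -[wires x _]/(wires (rcons x (gate_value x h)) gs).
  by rewrite nth_wires_input ?size_rcons // nth_rcons ltnn eqxx.
rewrite -[wires x _]/(wires (rcons x (gate_value x h)) gs) addnS -addSn.
by rewrite -(size_rcons x (gate_value x h)) IH ?size_rcons.
Qed.

Lemma wire_circuit_form (F : fieldType) phi (x : (ninputs phi).-tuple bool) g
    (b := wire_value x (gates phi)) : g < size (gates phi) ->
  circuit_form phi (fun i j => (b i)%:R * (b j)%:R : F)%R g = 0%R.
Proof.
move=> gG; have ok : gates_wf (size x) (gates phi) by rewrite size_tuple gates_ok.
have := nth_wires_gate ok gG; rewrite size_tuple /circuit_form.
case: (nth _ _ g) => [i j|i] /= e; rewrite e !mulr1.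
  by case: (nth _ _ i); case: (nth _ _ j); rewrite /= ?mulr0 ?mul0r ?mulr1 subrr.
by case: (nth _ _ i); rewrite /= ?add0r ?addr0 subrr.
Qed.

Local Open Scope ring_scope.

Lemma honest_rightE (F : fieldType) N b col :
  honest_right F N b col = ((col <= N)%N && b col)%:R.
Proof.
rewrite /honest_right; case: leqP => cN.
  rewrite (bigD1 (Ordinal (cN : (col < N.+1)%N))) //= eqxx big1 ?addr0 // => l.
  by rewrite -val_eqE /= eq_sym => /negPf->.
by apply: big1 => l _; case: eqP => // e; move: cN; rewrite e ltnNge leq_ord.
Qed.

Lemma wt_honest_right p N b n :
  (wt (\col_(col < n) honest_right 'F_p N b col) <= N + 1)%N.
Proof.
rewrite /wt cardE -(size_map val) addn1 -[X in (_ <= X)%N](size_iota 0).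
apply: uniq_leq_size; first by rewrite map_inj_uniq ?enum_uniq //; apply: val_inj.
move=> c /mapP[i]; rewrite mem_enum inE mxE honest_rightE => h ->.
by rewrite mem_iota /= add0n ltnS; move: h; case: leqP => //; rewrite eqxx.
Qed.

(** Position 0 of the table is the monomial 1, whose constant coefficient is 1, and $b_0 b_0=1$;
    this one entry shows that the rank-one matrix is nonzero. *)
Lemma honest_corner (F : fieldType) N p phi T cp s b (pc : nat -> F) :
  ready N p phi T cp s -> monomial_values N b T pc -> b 0%N ->
  honest_left N b T pc 0 * honest_right F N b 0 = 1.
Proof.
move=> r mv b0; have T0 := tab_pos (ready_table r).
rewrite -main_part_honest.
have -> : main_part N T (honest N b T pc) 0 0 = main_part N T (honest N b T pc) (group_row N 0 0 0) 0.
  by rewrite /group_row mul0n addn0 mul0n.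
rewrite main_part_entry // T0 honest_param // b0 !mulr1.
by rewrite (mv _ _ [::]) ?big_nil ?coef1 ?(tab_head (ready_table r)).
Qed.

Lemma witness_vectors N p phi T cp s (b : nat -> bool) (k := (size T * Dn N * N.+1 * N.+1)%N)
    (pc := fun c => (s 14 c)%:R : 'F_p) :
  (1 < N)%N -> ready N p phi T cp s -> (forall i, (i <= N)%N -> s 15 i = b i) ->
  [/\ forall J, (J < k)%N -> (accf witness_emit s (1 + J))%:R = honest N b T pc J,
      forall row, (row < mx_order N)%N ->
        (accf witness_emit s (1 + k + row))%:R = honest_left N b T pc row
    & forall col, (accf witness_emit s (1 + k + mx_order N + col))%:R = honest_right 'F_p N b col].
Proof.
move=> N1 r s15.
have par (x : 'I_(size T)) (t : 'I_(Dn N)) (i l : 'I_N.+1) : (param N x t i l < k)%N.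
  by apply: param_lt; rewrite ?leq_ord.
have grp (x : 'I_(size T)) (t : 'I_(Dn N)) (i : 'I_N.+1) : (group_row N x t i < mx_order N)%N.
  apply: group_row_lt; rewrite ?leq_ord //; first exact: leq_trans (ltn_ord x) (size_table r).
  exact: leq_trans (ltn_ord t) (Dn_le_Ds N).
split=> [J Jk|row rm|col]; rewrite (accf_witness _ N1 r s15) -/k.
- rewrite [X in _ + (X + _)]big1 => [|x _]; last first.
    by apply: big1 => t _; apply: big1 => i _; rewrite ifF //; apply/eqP; lia.
  rewrite add0r [X in _ + X]big1 ?addr0 => [|l _]; last by rewrite ifF //; apply/eqP; lia.
  do 4!(apply: eq_bigr => ? _); congr (if _ then _ else _).
  by rewrite eqn_add2l eq_sym.
- rewrite [X in X + _]big1 ?add0r => [|x _]; last first.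
    apply: big1 => t _; apply: big1 => i _; apply: big1 => l _; rewrite ifF //.
    by have := par x t i l; move=> h; apply/eqP; lia.
  rewrite [X in _ + X]big1 ?addr0 => [|l _]; last by rewrite ifF //; apply/eqP; lia.
  do 3!(apply: eq_bigr => ? _); congr (if _ then _ else _).
  by rewrite eqn_add2l eq_sym.
rewrite [X in X + _]big1 ?add0r => [|x _]; last first.
  apply: big1 => t _; apply: big1 => i _; apply: big1 => l _; rewrite ifF //.
  by have := par x t i l; move=> h; apply/eqP; lia.
rewrite [X in X + _]big1 ?add0r => [|x _]; last first.
  apply: big1 => t _; apply: big1 => i _; rewrite ifF //.
  by have := grp x t i; move=> h; apply/eqP; lia.
by apply: eq_bigr => l _; rewrite eqn_add2l eq_sym.
Qed.

(* The matrix order and the final assembly *)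
Local Close Scope ring_scope.

(** The constant is $2\cdot 3$, from $N+1\le 2N$ and $2NR+1\le 3NR$; the binomial coefficient
    contributes $N^2$. *)
Lemma mx_order_le N : 2 <= N -> mx_order N <= 6 * (N ^ 4 * log_floor N).
Proof.
move=> N2; rewrite /mx_order; have R0 := log_floor_gt0 N2.
have := bin_log_le (ltnW N2); move: (log_floor N) R0 => R R0 hC.
have h1 : N.+1 <= 2 * N by rewrite mul2n -addnn -addn1 leq_add2l ltnW.
have h2 : (2 * N * R).+1 <= 3 * (N * R).
  have : 0 < N * R by rewrite muln_gt0 R0 ltnW.
  by rewrite -mulnA; lia.
apply: leq_trans (leq_mul (leq_mul h1 h2) hC) _.
by rewrite (_ : 2 * N * (3 * (N * R)) * N ^ 2 = 6 * (N ^ 4 * R)) //; ring.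
Qed.

Definition order_header : cmd := CAssign 1 #0 #1 ;; CAssign 1 #1 vm.

Definition order_prog : prog := Seq sizes_prog (compile order_header).

Lemma order_output N : 1 < N ->
  output (run order_header (sizes_run (load [:: N]))) = [:: mx_order N].
Proof.
move=> N1; have [e2 e4] := @sizes_run_spec (load [:: N]) N erefl (ltnW N1) erefl.
have e0 : sizes_run (load [:: N]) 0 1 = N by rewrite /sizes_run !run_frame.
set s := sizes_run _ in e0 e2 e4 *.
have out0 : run order_header s 1 0 = 1 by [].
have out1 : run order_header s 1 1 = mx_order N.
  transitivity ((s 0 1 + 1) * (2 * s 0 1 * s 2 0 + 1) * s 4 0); first by [].
  by rewrite e0 e2 e4 !addn1.
by rewrite /output out0 -out1.
Qed.

Lemma order_computes : exists (B : prog) (c d : nat), forall N : nat, 2 <= N ->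
  computes_within B [:: N] [:: mx_order N] (c * N ^ d).
Proof.
have pX : pb (fun N => 1 < N) id id by apply: pb_size.
have b0 : pbounded (fun N => 1 < N) id (fun N => load [:: N]).
  exists (fun N => N + 1); first exact: pb_add pX (pb_const _ _ _).
  move=> N N1; apply: load_bounded; first by rewrite addn1.
  by move=> v; rewrite !inE => /orP[] /eqP->; apply: leq_trans (bitlen_leS _) _; move: N1; clear; rewrite /=; lia.
have [|b1 x1] := sizes_pexec _ pX b0; first by move=> N N1; rewrite ltnW.
have [_ x2] := @pexec_phase [:: 0; 2; 4] order_header _ _ _ _ _ isT (pb_cap pX) (fun _ _ => isT) b1.
have [c [d h]] := pexec_poly (pexec_seq x1 x2) (fun N => @ltnW 1 N).
exists order_prog, c, d => N N2; have [t e le] := h N N2.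
by exists (run order_header (sizes_run (load [:: N]))), t; split=> //; apply: order_output.
Qed.

Lemma value_run_wires N p phi (x : (ninputs phi).-tuple bool)
    (s := prelude_run (load [:: N, p & code_circuit phi ++ code_witness x]))
    (b := wire_value x (gates phi)) T cp :
  1 < N -> prime p -> ready N p phi T cp s ->
  (forall c i, c \in [:: 1; 14; 15] -> s c i = 0) ->
  [/\ ready N p phi T cp (value_run s), forall i, value_run s 15 i = b i,
    monomial_values N b T (fun c => (value_run s 14 c)%:R : 'F_p)%R
    & forall i, value_run s 1 i = 0].
Proof.
move=> N1 pp r sb.
have w15 i : run wire_phase s 15 i = b i.
  apply: run_wire_phase; last by move=> j; apply: sb.
  - exact: ready_inputs r.
  - exact: ready_size r.
  - exact: ready_gate r.
  move=> t tn; rewrite /s /prelude_run /sizes_run !run_frame // load_extra.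
  by rewrite (nth_map false) ?size_tuple.
split.
- exact: value_ready.
- by move=> i; rewrite /value_run run_frame.
- have s15 i : i <= N -> run wire_phase s 15 i = b i by [].
  have w14 c : run wire_phase s 14 c = 0 by rewrite run_frame // sb.
  have rw : ready N p phi T cp (run wire_phase s) by apply: ready_run r _.
  exact: (run_value_phase N1 pp rw s15 isT w14).
by move=> i; rewrite /value_run !run_frame // sb.
Qed.

Lemma prelude_table_extra N p phi extra extra' T cp T' cp' :
  ready N p phi T cp (prelude_run (load [:: N, p & code_circuit phi ++ extra])) ->
  ready N p phi T' cp' (prelude_run (load [:: N, p & code_circuit phi ++ extra'])) ->
  T' = T.
Proof.
move=> r r'; apply: tabulates_inj (ready_table r') (ready_table r).
by apply: prelude_same_head => -[|b] [|[|[|i]]].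
Qed.

Theorem theorem3p1 :
  (exists (A W : prog) (c d : nat),
    forall (phi : circuit) (N p : nat),
      maxn 2 (circuit_size phi) <= N ->
      num_vars (boolean_quadratic_encoding phi) <= N ->
      prime p ->
      maxn (2 ^ N) (2 * N * log_floor N) < p ->
      exists (k : nat) (M : k.-tuple 'M['F_p]_(mx_order N))
             (S : {vspace 'M['F_p]_(mx_order N)}),
        [/\ computes_within A [:: N, p & code_circuit phi] (code_mxs M)
              (c * (N + trunc_log 2 p) ^ d),
            basis_of S M,
            satisfiable phi ->
              forall x : (ninputs phi).-tuple bool, satisfies x ->
              exists (a : 'cV['F_p]_k) (u v : 'cV['F_p]_(mx_order N)),
                [/\ computes_within W
                      [:: N, p & code_circuit phi ++ code_witness x]
                      (code_mx a ++ code_mx u ++ code_mx v)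
                      (c * (N + trunc_log 2 p) ^ d),
                    (\sum_(j < k) a j ord0 *: tnth M j = u *m v^T)%R,
                    (u *m v^T != 0)%R,
                    boolean_vector v
                  & wt v <= N + 1]
          & ~ satisfiable phi ->
              forall X : 'M['F_p]_(mx_order N), X \in S -> X != 0%R ->
              log_floor N + 1 <= \rank X])
  /\ (exists C : nat, forall N : nat, 2 <= N ->
        mx_order N <= C * (N ^ 4 * log_floor N))
  /\ (exists (B : prog) (c d : nat), forall N : nat, 2 <= N ->
        computes_within B [:: N] [:: mx_order N] (c * N ^ d)).
Proof.
split; last by split; [exists 6; exact: mx_order_le|exact: order_computes].
have X0 i : admissible i -> 0 < input_size_of i.
  by case: i => [[[phi N] p] extra] [N1 _ _ _ _]; rewrite /= addn_gt0 ltnW.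
have [c1 [d1 h1]] := pexec_poly matrix_pexec X0.
have [c2 [d2 h2]] := pexec_poly witness_pexec X0.
(* Sums make one pair of constants serve both programs, the base of the power being positive. *)
exists matrix_prog, witness_prog, (c1 + c2), (d1 + d2) => phi N p.
rewrite geq_max => /andP[N1 phiN] _ pp; rewrite gtn_max => /andP[Np _].
have Xpos : 0 < N + trunc_log 2 p by rewrite addn_gt0 ltnW.
have [T [cp [r sb]]] := prelude_ready_load phi [::] N1 pp.
set s := prelude_run _ in r sb.
pose k := size T * Dn N * N.+1 * N.+1.
pose M := [tuple basis_mx p N s J | J < k].
have comb (a : 'I_k -> 'F_p) (a' : nat -> 'F_p) : (forall J : 'I_k, a J = a' J) ->
    (\sum_(J < k) a J *: tnth M J = combination N s k a')%R.
  by move=> aa; apply: eq_bigr => J _; rewrite tnth_mktuple aa.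
(* Combinations take coefficients indexed by all naturals; indices from [k] on get the value 0. *)
pose ext (a : 'I_k -> 'F_p) (J : nat) : 'F_p := (if insub J is Some i then a i else 0)%R.
have extE a (J : 'I_k) : a J = ext a J by rewrite /ext valK.
exists k, M, (span M); split.
- have adm : admissible (phi, N, p, [::]) by [].
  have [t e le] := h1 _ adm.
  exists (matrix_main s), t; split.
  + by rewrite -[code_circuit phi]cats0.
  + rewrite (output_matrix N1 pp r) -/k; last by move=> i; apply: sb.
    by congr (code_mxs _); rewrite /= -val_enum_ord -map_comp.
  apply: leq_trans le _; rewrite leq_mul ?leq_addr // leq_pexp2l ?leq_addr //.
- rewrite /basis_of eqxx; apply/freeP => a a0 J.
  rewrite extE; apply: (combination_free N1 pp phiN r) => //.
  rewrite -(comb a) // -[RHS]a0; apply: eq_bigr => i _.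
  by rewrite (tnth_nth 0%R).
- move=> _ x sat; set b := wire_value x (gates phi).
  have exw : forall v, v \in code_witness x -> v <= 1.
    by move=> v /mapP[y _ ->]; case: y.
  have szw : size (code_witness x) <= N.
    by rewrite size_map size_tuple (leq_trans _ phiN) // leq_addr.
  have [T' [cp' [r' sb']]] := prelude_ready_load phi (code_witness x) N1 pp.
  (* Equality of the two tables ensures that the coefficients found by the witness program refer to
     the basis [M] of the other run. *)
  have TT := prelude_table_extra r r'; rewrite TT in r'.
  have [rv v15 mv v1] := value_run_wires N1 pp r' sb'.
  have [aE uE vE] := witness_vectors N1 rv (fun i _ => v15 i).
  set sv := value_run _ in rv v15 mv v1 aE uE vE.
  set pc := (fun c => _) in mv.
  exists (\col_(J < k) (accf witness_emit sv (1 + J))%:R)%R.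
  exists (\col_(row < mx_order N) (accf witness_emit sv (1 + k + row))%:R)%R.
  exists (\col_(col < mx_order N) (accf witness_emit sv (1 + k + mx_order N + col))%:R)%R.
  have colu : (\col_(row < mx_order N) (accf witness_emit sv (1 + k + row))%:R
      = \col_(row < mx_order N) honest_left N b T pc row :> 'cV['F_p]_(mx_order N))%R.
    by apply/colP => i; rewrite !mxE uE.
  have colv : (\col_(col < mx_order N) (accf witness_emit sv (1 + k + mx_order N + col))%:R
      = \col_(col < mx_order N) honest_right 'F_p N b col :> 'cV['F_p]_(mx_order N))%R.
    by apply/colP => i; rewrite !mxE vE.
  split.
  + have adm : admissible (phi, N, p, code_witness x) by [].
    have [t e le] := h2 _ adm.
    exists (witness_main sv), t; split=> //; first exact: output_witness rv v1.
    by apply: leq_trans le _; rewrite leq_mul ?leq_addl // leq_pexp2l ?leq_addl.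
  + rewrite colu colv -(combination_honest N1 pp phiN r mv) //; last by move=> g gG; apply: wire_circuit_form.
    by apply: comb => J; rewrite mxE aE.
  + rewrite colu colv; apply/eqP => /matrixP h.
    have m0 : 0 < mx_order N by apply: leq_trans (toeplitz_band_fits N1); rewrite addSn.
    by have := h (Ordinal m0) (Ordinal m0); rewrite !mxE big_ord1 !mxE (honest_corner r mv) //.
  + by rewrite colv; exists (fun i : 'I__ => (i <= N) && b i); apply/colP => i; rewrite !mxE honest_rightE.
  by rewrite colv; apply: wt_honest_right.
move=> unsat X XS X0'; rewrite addn1.
have XE : X = combination N s k (ext (fun J => coord M J X)).
  rewrite -(comb _ _ (extE (fun J => coord M J X))) {1}(coord_span XS).
  by apply: eq_bigr => J _; rewrite (tnth_nth 0%R).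
by move: X0'; rewrite XE => X0'; exact: (combination_rank N1 pp Np phiN r unsat X0').
Qed.
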